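(* Let $0<2\alpha<1$, $0<2\beta<1$, let $\Omega,\Gamma,q_3,w^{(3)}$ be as in the context, and let $\mu_3$ be continuous on $[0,l]$. For $t\in(0,l)$, the potential $w^{(3)}(x_0,y_0)$ has a limit $w^{(3)}_i(t)$ as $(x_0,y_0)\to(x(t),y(t))$ from inside $\Omega$, and a limit $w^{(3)}_e(t)$ as $(x_0,y_0)\to(x(t),y(t))$ from the exterior $\{x_0>0,y_0>0\}\setminus\overline\Omega$, and $$w^{(3)}_i(t)=-\tfrac12\mu_3(t)+\int_0^l\mu_3(s)K_3(s,t)\,ds,\qquad w^{(3)}_e(t)=\tfrac12\mu_3(t)+\int_0^l\mu_3(s)K_3(s,t)\,ds,$$ where $$K_3(s,t)=[x(s)]^{2\alpha}[y(s)]^{2\beta}\frac{\partial}{\partial n}\,q_3\big(x(s),y(s);x(t),y(t)\big)$$ (the integrals being understood as improper integrals at $s=t$).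
   Context: Let $0<2\alpha<1$, $0<2\beta<1$. Pochhammer symbol: $(a)_0=1$, $(a)_n=a(a+1)\cdots(a+n-1)$. Appell's function $F_2(a;b_1,b_2;c_1,c_2;\xi,\eta)=\sum_{m,n\ge0}\frac{(a)_{m+n}(b_1)_m(b_2)_n}{(c_1)_m(c_2)_n m!n!}\xi^m\eta^n$ (analytically continued to the negative arguments used below). For $(x,y)\ne(x_0,y_0)$ put $r^2=(x-x_0)^2+(y-y_0)^2$, $r_1^2=(x+x_0)^2+(y-y_0)^2$, $r_2^2=(x-x_0)^2+(y+y_0)^2$, $\xi=(r^2-r_1^2)/r^2$, $\eta=(r^2-r_2^2)/r^2$, and $$q_3(x,y;x_0,y_0)=k_3\,(r^2)^{-\alpha+\beta-1}y^{1-2\beta}y_0^{1-2\beta}F_2(1+\alpha-\beta;\alpha,1-\beta;2\alpha,2-2\beta;\xi,\eta),\quad k_3=\frac{2^{2+2\alpha-2\beta}}{4\pi}\frac{\Gamma(\alpha)\Gamma(1-\beta)\Gamma(1+\alpha-\beta)}{\Gamma(2\alpha)\Gamma(2-2\beta)},$$ the third fundamental solution of $u_{xx}+u_{yy}+\frac{2\alpha}{x}u_x+\frac{2\beta}{y}u_y=0$. Domain: $a,b>0$; $\Omega$ is the bounded domain in the first quadrant bounded by the segment $[0,a]$ of the $x$-axis, the segment $[0,b]$ of the $y$-axis, and a curve $\Gamma$ joining $A(a,0)$ and $B(0,b)$ and otherwise lying in $\{x>0,y>0\}$; $\overline\Omega=\Omega\cup\Gamma$. $\Gamma$ is parametrized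 by arc length $s\in[0,l]$ measured from $B$, $x=x(s),y=y(s)$, where $x',y'$ are continuous on $[0,l]$ and do not vanish simultaneously, $x'',y''$ are Hölder continuous with exponent $\varepsilon\in(0,1)$, and near $A$ and $B$ on $\Gamma$: $|dx/ds|\le C\,y(s)^{1+\varepsilon}$, $|dy/ds|\le C\,x(s)^{1+\varepsilon}$ for a constant $C$. $\partial/\partial n$ is the derivative in $(x,y)$ along the outward unit normal to $\Omega$ at $(x(s),y(s))\in\Gamma$. The third double-layer potential with density $\mu_3$ is $$w^{(3)}(x_0,y_0)=\int_0^l x(s)^{2\alpha}y(s)^{2\beta}\mu_3(s)\frac{\partial q_3(x(s),y(s);x_0,y_0)}{\partial n}\,ds,\qquad x_0>0,\ y_0>0.$$ *)

(* Defs.v *)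
From Stdlib Require Import Reals Lra Arith Factorial ClassicalEpsilon.
Open Scope R_scope.

(* limit of a real sequence (value chosen by Hilbert epsilon; unique when it exists) *)
Definition lim_seq (u : nat -> R) : R :=
  epsilon (inhabits 0) (fun l => Un_cv u l).

(* derivative of f at x (value chosen by epsilon; unique when it exists) *)
Definition Dlim (f : R -> R) (x : R) : R :=
  epsilon (inhabits 0) (fun d => derivable_pt_lim f x d).

Definition cont_on (f : R -> R) (a b : R) : Prop :=
  forall x, a <= x <= b -> forall e, e > 0 -> exists d, d > 0 /\
    forall y, a <= y <= b -> Rabs (y - x) < d -> Rabs (f y - f x) < e.

Definition improper_int (f : R -> R) (a b I : R) : Prop :=
  (forall c d, a < c -> c <= d -> d < b -> inhabited (Riemann_integrable f c d)) /\
  (forall e, e > 0 -> exists del, del > 0 /\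
     forall c d (pr : Riemann_integrable f c d),
       a < c < a + del -> b - del < d < b -> c <= d ->
       Rabs (RiemannInt pr - I) < e).

Fixpoint poch (a : R) (n : nat) : R :=
  match n with
  | O => 1
  | S k => poch a k * (a + INR k)
  end.

(* Euler's Gamma function (Gauss' limit formula), used for z > 0 *)
Definition Gamma (z : R) : R :=
  lim_seq (fun n => INR (fact n) * Rpower (INR n) z / poch z (S n)).

Definition F2term (a b1 b2 c1 c2 x y : R) (m n : nat) : R :=
  poch a (m + n) * poch b1 m * poch b2 n /
    (poch c1 m * poch c2 n * INR (fact m) * INR (fact n)) * x ^ m * y ^ n.

Definition F2series (a b1 b2 c1 c2 x y : R) : R :=
  lim_seq (fun N => sum_f_R0 (fun k =>
     sum_f_R0 (fun m => F2term a b1 b2 c1 c2 x y m (k - m)) k) N).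

(* Analytic continuation of F2 to nonpositive arguments x <= 0, y <= 0 via the classical
   transformation  F2(a;b1,b2;c1,c2;x,y) =
     (1-x-y)^(-a) F2(a;c1-b1,c2-b2;c1,c2; x/(x+y-1), y/(x+y-1)),
   whose right-hand series converges for x,y <= 0 (new arguments are >= 0 with sum < 1). *)
Definition F2 (a b1 b2 c1 c2 x y : R) : R :=
  Rpower (1 - x - y) (- a) *
  F2series a (c1 - b1) (c2 - b2) c1 c2 (x / (x + y - 1)) (y / (x + y - 1)).

Definition k3 (al be : R) : R :=
  Rpower 2 (2 + 2*al - 2*be) / (4 * PI) *
  (Gamma al * Gamma (1 - be) * Gamma (1 + al - be)) / (Gamma (2*al) * Gamma (2 - 2*be)).

Definition q3 (al be x y x0 y0 : R) : R :=
  let r2  := (x - x0)^2 + (y - y0)^2 in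
  let r12 := (x + x0)^2 + (y - y0)^2 in
  let r22 := (x - x0)^2 + (y + y0)^2 in
  let xi  := (r2 - r12) / r2 in
  let eta := (r2 - r22) / r2 in
  k3 al be * Rpower r2 (- al + be - 1) * Rpower y (1 - 2*be) * Rpower y0 (1 - 2*be) *
  F2 (1 + al - be) al (1 - be) (2*al) (2 - 2*be) xi eta.

(* derivative of q3 in (x,y) along the outward normal at the point (X s, Y s) of Gamma.
   Gamma is run from B to A with unit speed (dX,dY); the outward normal is (-dY, dX). *)
Definition dn_q3 (al be : R) (X Y dX dY : R -> R) (s x0 y0 : R) : R :=
  Dlim (fun h => q3 al be (X s - h * dY s) (Y s + h * dX s) x0 y0) 0.

Definition w3_integrand (al be : R) (X Y dX dY mu : R -> R) (x0 y0 : R) (s : R) : R :=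
  Rpower (X s) (2*al) * Rpower (Y s) (2*be) * mu s * dn_q3 al be X Y dX dY s x0 y0.

Definition w3_is (al be l : R) (X Y dX dY mu : R -> R) (x0 y0 v : R) : Prop :=
  improper_int (w3_integrand al be X Y dX dY mu x0 y0) 0 l v.

Definition K3 (al be : R) (X Y dX dY : R -> R) (s t : R) : R :=
  Rpower (X s) (2*al) * Rpower (Y s) (2*be) * dn_q3 al be X Y dX dY s (X t) (Y t).

Definition bdry (a b l : R) (X Y : R -> R) (x y : R) : Prop :=
  (y = 0 /\ 0 <= x <= a) \/ (x = 0 /\ 0 <= y <= b) \/
  (exists s, 0 <= s <= l /\ x = X s /\ y = Y s).

(* (x,y) can be joined to points arbitrarily far away by a continuous path avoiding the curve,
   i.e. (x,y) lies in the unbounded component of the complement *)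
Definition escapes (a b l : R) (X Y : R -> R) (x y : R) : Prop :=
  forall M, exists g1 g2 : R -> R,
    cont_on g1 0 1 /\ cont_on g2 0 1 /\ g1 0 = x /\ g2 0 = y /\
    (g1 1)^2 + (g2 1)^2 > M /\
    forall u, 0 <= u <= 1 -> ~ bdry a b l X Y (g1 u) (g2 u).

(* Omega: bounded component of the complement (lies in the open first quadrant) *)
Definition Omega (a b l : R) (X Y : R -> R) (x y : R) : Prop :=
  x > 0 /\ y > 0 /\ ~ bdry a b l X Y x y /\ ~ escapes a b l X Y x y.

(* exterior {x>0,y>0} \ closure(Omega) *)
Definition Exterior (a b l : R) (X Y : R -> R) (x y : R) : Prop :=
  x > 0 /\ y > 0 /\ ~ bdry a b l X Y x y /\ escapes a b l X Y x y.

(* "W(x,y) -> L as (x,y) -> (px,py) within D", for a relationally given function W: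
   W is defined near (px,py) on D, and its values tend to L. *)
Definition rel_lim_within (D : R -> R -> Prop) (W : R -> R -> R -> Prop) (px py L : R) : Prop :=
  (exists del, del > 0 /\ forall x y, D x y -> (x - px)^2 + (y - py)^2 < del ->
      exists v, W x y v) /\
  (forall e, e > 0 -> exists del, del > 0 /\ forall x y v, D x y ->
      (x - px)^2 + (y - py)^2 < del -> W x y v -> Rabs (v - L) < e).

(* Main.v *)
Require Import Defs.
From Stdlib Require Import Reals Lra Lia Factorial ClassicalEpsilon.
From Coquelicot Require Import Coquelicot.
Open Scope R_scope.

(** Put [a = 1 + al - be], [R2 = (x + x0)^2 + (y + y0)^2], [u = 4 x x0 / R2], [v = 4 y y0 / R2]; then
    [q3] is an elementary factor times [S (u, v)], a double series with positive coefficients, and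
    [1 - (u + v) = r^2 / R2]. Averaging the coefficient asymptotics against binomial weights gives
    [S_u, S_v = c0 p^(-al) q^(be-1) / (1 - (u + v)) + O(log)] with [p = u / (u + v)], [q = v / (u + v)],
    and the Gamma factors of [c0] and [k3] cancel, so that [x^(2 al) y^(2 be) dq3/dn] equals
    [- n.(x - x0) / (2 pi r^2)] up to an integrable error [O(r^(-1/2))].

    A point near the curve is [x(sg) + de n(sg)] with [sg] the parameter of a nearest point, and there
    the kernel is the half-plane Poisson kernel [de / (2 pi ((s - sg)^2 + de^2))] up to
    [O(|s - sg|^(-1/2))]; the Poisson kernel carries mass [1/2] of the sign of [de], which is the jump.

    The sign of [de] separates [Omega] from the exterior: for [de > 0] one slides along the parallel
    curve to [B] and leaves through the left half plane; for [de < 0] the winding number of the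
    boundary, which is constant along paths and vanishes far away, differs by one from its value
    across the curve and so is not zero. *)

(** * Double power series *)

(** The expansion of the kernel is needed only with both points away from the axes, because t is
    interior; there p and q stay in a compact part of (0, 1), which makes the binomial averages
    uniform. Toward the ends of the curve a bound is enough: the weight turns y^(1 - 2 be) into y,
    and only the target point has to keep off the axes.

    The asymptotics are proved for the partial derivatives of S themselves, since an estimate of S
    could not be differentiated. Both partials have the same leading coefficient, so only the
    derivative of u + v = 1 - r^2 / R2 survives, and this is what makes the singularity that of the
    Laplacian.

    An error of relative order 1/N, on average over the degree N, sums to a logarithm of r^2 / R2.
    The logarithm is majorised by the power -1/4, that is r^(-1/2), whose primitive along the curve
    is explicit.

    Since [Omega] is defined by the failure to escape, the side of a point is a question of
    topology. It is settled with differences of winding integrals only, whose primitive is a single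
    arctangent, so no continuous choice of argument is made. *)

Lemma MVT_bound (f df : R -> R) (a b K : R) :
  (forall x, Rmin a b <= x <= Rmax a b -> is_derive f x (df x)) ->
  (forall x, Rmin a b <= x <= Rmax a b -> Rabs (df x) <= K) ->
  Rabs (f b - f a) <= K * Rabs (b - a).
Proof.
intros Hd HK.
destruct (MVT_gen f a b df) as [c [Hc ->]].
- intros x Hx; apply Hd; lra.
- intros x Hx; apply continuity_pt_filterlim.
  apply (ex_derive_continuous f); exists (df x); apply Hd; lra.
- rewrite Rabs_mult; apply Rmult_le_compat_r; [apply Rabs_pos | auto].
Qed.

Lemma ex_series_le_R (a b : nat -> R) :
  (forall n, Rabs (a n) <= b n) -> ex_series b -> ex_series a.
Proof. exact (@ex_series_le R_AbsRing R_CompleteNormedModule a b). Qed.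

Lemma Series_tail_small (M : nat -> R) (e : R) :
  ex_series M -> 0 < e -> exists N, Rabs (Series (fun k => M (S N + k)%nat)) < e.
Proof.
intros HM He.
destruct HM as [l Hl].
assert (H : is_lim_seq (sum_n M) l) by exact Hl.
apply is_lim_seq_spec in H.
destruct (H (mkposreal e He)) as [N HN].
exists N.
assert (E : Series M = sum_f_R0 M (pred (S N)) + Series (fun k => M (S N + k)%nat)).
{ apply Series_incr_n; [lia | now exists l]. }
rewrite (is_series_unique M l Hl) in E.
specialize (HN N (Nat.le_refl N)); simpl in HN.
rewrite sum_n_Reals in HN; simpl pred in E.
replace (Series _) with (- (sum_f_R0 M N - l)) by lra.
now rewrite Rabs_Ropp.
Qed.

(** The mean value theorem bounds the n-th first-order remainder by [2 * M n * Rabs (h - x)]. The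
    tail of these bounds is small independently of h, and the finite sum that remains is
    differentiable; no continuity of the [f' n] enters. *)
Lemma Series_is_derive (f f' : nat -> R -> R) (M : nat -> R) (x d : R) :
  0 < d -> ex_series M ->
  (forall n h, Rabs (h - x) < d -> is_derive (f n) h (f' n h)) ->
  (forall n h, Rabs (h - x) < d -> Rabs (f' n h) <= M n) ->
  (forall h, Rabs (h - x) < d -> ex_series (fun n => f n h)) ->
  is_derive (fun h => Series (fun n => f n h)) x (Series (fun n => f' n x)).
Proof.
intros Hd HM Hf HB Hs.
assert (Hx : Rabs (x - x) < d) by (rewrite Rminus_diag, Rabs_R0; lra).
assert (Hs' : ex_series (fun n => f' n x)).
{ now apply ex_series_le_R with M; auto. }
assert (HA : forall n h, Rabs (h - x) < d ->
  Rabs (f n h - f n x - f' n x * (h - x)) <= 2 * M n * Rabs (h - x)).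
{ intros n h Hh.
  assert (Rabs (f n h - f n x) <= M n * Rabs (h - x)).
  { apply (MVT_bound (f n) (f' n)); intros z Hz; [apply Hf | apply HB];
    revert Hz Hh; unfold Rmin, Rmax, Rabs;
    repeat destruct Rle_dec; repeat destruct Rcase_abs; lra. }
  assert (Rabs (f' n x * (h - x)) <= M n * Rabs (h - x)).
  { rewrite Rabs_mult; apply Rmult_le_compat_r; [apply Rabs_pos | auto]. }
  unfold Rminus at 1; eapply Rle_trans; [apply Rabs_triang|].
  rewrite Rabs_Ropp; lra. }
apply is_derive_Reals; intros e He.
destruct (Series_tail_small (fun n => 2 * M n) (e / 2)) as [N HN].
{ now apply (ex_series_scal_l 2 M). } { lra. }
assert (Hfin : is_derive (fun h => sum_n (fun n => f n h) N) x
   (sum_n (fun n => f' n x) N)).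
{ apply (is_derive_sum_n (fun n h => f n h) N x (fun n => f' n x)).
  intros k _; now apply Hf. }
apply is_derive_Reals in Hfin.
destruct (Hfin (e / 2)) as [d1 Hd1]; [lra|].
assert (Hd2 : 0 < Rmin d1 d) by (apply Rmin_pos; [apply cond_pos | auto]).
exists (mkposreal _ Hd2); intros h Hh0 Hh; simpl in Hh.
assert (Hhd1 : Rabs h < d1) by (eapply Rlt_le_trans; [apply Hh | apply Rmin_l]).
assert (Hhd : Rabs (x + h - x) < d).
{ replace (x + h - x) with h by ring; eapply Rlt_le_trans; [apply Hh | apply Rmin_r]. }
specialize (Hd1 h Hh0 Hhd1).
assert (Hp : 0 < Rabs h) by now apply Rabs_pos_lt.
set (A := fun n => f n (x + h) - f n x - f' n x * h).
assert (HA' : forall n, Rabs (A n) <= 2 * M n * Rabs h).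
{ intros n; unfold A; specialize (HA n _ Hhd).
  now replace (x + h - x) with h in HA by ring. }
assert (exA : ex_series A).
{ unfold A; apply ex_series_le_R with (fun n => 2 * M n * Rabs h); [apply HA'|].
  apply (ex_series_scal_r (Rabs h) (fun n => 2 * M n)).
  now apply (ex_series_scal_l 2 M). }
assert (EA : Series A = Series (fun n => f n (x + h)) - Series (fun n => f n x)
   - Series (fun n => f' n x) * h).
{ unfold A; rewrite Series_minus, Series_minus, Series_scal_r; auto.
  apply (ex_series_minus (fun n => f n (x + h))); auto.
  now apply ex_series_scal_r. }
assert (EA2 : Series A = sum_f_R0 A N + Series (fun k => A (S N + k)%nat)).
{ apply (Series_incr_n A (S N)); [lia | auto]. }
assert (EA3 : sum_f_R0 A N = sum_n (fun n => f n (x + h)) N - sum_n (fun n => f n x) N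
   - sum_n (fun n => f' n x) N * h).
{ rewrite !sum_n_Reals; unfold A.
  rewrite (Rmult_comm _ h), scal_sum, <- !minus_sum.
  reflexivity. }
assert (Ht : Rabs (Series (fun k => A (S N + k)%nat)) <= e / 2 * Rabs h).
{ eapply Rle_trans; [apply Series_Rabs|].
  { apply ex_series_le_R with (fun k => 2 * M (S N + k)%nat * Rabs h).
    - intros k; rewrite Rabs_Rabsolu; apply HA'.
    - apply (ex_series_scal_r (Rabs h) (fun k => 2 * M (S N + k)%nat)).
      apply (ex_series_scal_l 2 (fun k => M (S N + k)%nat)).
      now apply ex_series_incr_n. }
  eapply Rle_trans.
  { apply (Series_le _ (fun k => 2 * M (S N + k)%nat * Rabs h)).
    - intros k; split; [apply Rabs_pos | apply HA'].
    - apply (ex_series_scal_r (Rabs h) (fun k => 2 * M (S N + k)%nat)).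
      apply (ex_series_scal_l 2 (fun k => M (S N + k)%nat)).
      now apply ex_series_incr_n. }
  rewrite (Series_scal_r (Rabs h) (fun k => 2 * M (S N + k)%nat)).
  apply Rmult_le_compat_r; [lra|].
  apply Rle_trans with (2 := Rlt_le _ _ HN), Rle_abs. }
replace ((Series (fun n => f n (x + h)) - Series (fun n => f n x)) / h
  - Series (fun n => f' n x)) with (Series A / h) by (rewrite EA; field; auto).
assert (Hlt : Rabs (sum_f_R0 A N) < e / 2 * Rabs h).
{ replace (sum_f_R0 A N) with (((sum_n (fun n => f n (x + h)) N - sum_n (fun n => f n x) N) / h
    - sum_n (fun n => f' n x) N) * h) by (rewrite EA3; field; auto).
  rewrite Rabs_mult; apply Rmult_lt_compat_r; lra. }
unfold Rdiv; rewrite Rabs_mult, Rabs_inv.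
apply Rmult_lt_reg_r with (Rabs h); [lra|].
rewrite Rmult_assoc, Rinv_l, Rmult_1_r by lra.
rewrite EA2; eapply Rle_lt_trans; [apply Rabs_triang | lra].
Qed.

(** Homogeneous part of degree N. Summing by total degree is the order chosen in [F2series] and
    reduces a double series to a single one. *)
Definition diag (c : nat -> nat -> R) (u v : R) (N : nat) : R :=
  sum_f_R0 (fun m => c m (N - m)%nat * u ^ m * v ^ (N - m)) N.

Definition dser (c : nat -> nat -> R) (u v : R) : R := Series (diag c u v).

(** The binomial factor is chosen so that the binomial theorem bounds degree N by
    [kap N * (Rabs u + Rabs v) ^ N]: convergence is that of a power series in one variable. *)
Definition dominated (kap : nat -> R) (c : nat -> nat -> R) : Prop :=
  forall m n, Rabs (c m n) <= kap (m + n)%nat * Binomial.C (m + n) m.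

Definition coefu (c : nat -> nat -> R) (m n : nat) : R := INR (S m) * c (S m) n.
Definition coefv (c : nat -> nat -> R) (m n : nat) : R := INR (S n) * c m (S n).

Lemma C_pos n m : 0 < Binomial.C n m.
Proof.
unfold Binomial.C; apply Rdiv_lt_0_compat; [apply INR_fact_lt_0|].
apply Rmult_lt_0_compat; apply INR_fact_lt_0.
Qed.

Lemma C_sum_l m n : Binomial.C (m + n) m = INR (fact (m + n)) / (INR (fact m) * INR (fact n)).
Proof. unfold Binomial.C; now replace (m + n - m)%nat with n by lia. Qed.

(** By (m + 1) C(m + n + 1, m + 1) = (m + n + 1) C(m + n, m), differentiating the double series
    differentiates its majorant. *)
Lemma coefu_dominated kap c : dominated kap c -> dominated (PS_derive kap) (coefu c).
Proof.
intros H m n; unfold coefu, PS_derive.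
rewrite Rabs_mult, (Rabs_pos_eq (INR (S m))) by apply pos_INR.
apply Rle_trans with (1 := Rmult_le_compat_l _ _ _ (pos_INR _) (H (S m) n)).
rewrite !C_sum_l.
replace (S m + n)%nat with (S (m + n)) by lia.
rewrite !fact_simpl, !mult_INR.
right; field.
repeat split; auto using INR_fact_neq_0, not_0_INR.
Qed.

Lemma coefv_dominated kap c : dominated kap c -> dominated (PS_derive kap) (coefv c).
Proof.
intros H m n; unfold coefv, PS_derive.
rewrite Rabs_mult, (Rabs_pos_eq (INR (S n))) by apply pos_INR.
apply Rle_trans with (1 := Rmult_le_compat_l _ _ _ (pos_INR _) (H m (S n))).
rewrite !C_sum_l.
replace (m + S n)%nat with (S (m + n)) by lia.
rewrite !fact_simpl, !mult_INR.
right; field.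
repeat split; auto using INR_fact_neq_0, not_0_INR.
Qed.

Lemma dominated_nonneg kap c : dominated kap c -> forall N, 0 <= kap N.
Proof.
intros H N.
specialize (H N O); rewrite Nat.add_0_r in H.
apply Rmult_le_reg_r with (Binomial.C N N); [apply C_pos|].
rewrite Rmult_0_l; eapply Rle_trans; [apply Rabs_pos | apply H].
Qed.

Lemma diag_bound kap c : dominated kap c ->
  forall u v N, Rabs (diag c u v N) <= kap N * (Rabs u + Rabs v) ^ N.
Proof.
intros H u v N; unfold diag.
eapply Rle_trans; [apply Rsum_abs|].
rewrite binomial, scal_sum; apply sum_Rle; intros m Hm.
rewrite !Rabs_mult, <- !RPow_abs.
replace (Binomial.C N m * Rabs u ^ m * Rabs v ^ (N - m) * kap N)
  with (kap N * Binomial.C N m * Rabs u ^ m * Rabs v ^ (N - m)) by ring.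
repeat (apply Rmult_le_compat_r; [apply pow_le, Rabs_pos|]).
specialize (H m (N - m)%nat).
now replace (m + (N - m))%nat with N in H by lia.
Qed.

Lemma diag_bound_rho kap c u v rho : dominated kap c -> Rabs u + Rabs v <= rho ->
  forall N, Rabs (diag c u v N) <= kap N * rho ^ N.
Proof.
intros H Hr N.
eapply Rle_trans; [now apply diag_bound with (kap := kap)|].
apply Rmult_le_compat_l; [now apply dominated_nonneg with c|].
apply pow_incr; split; auto.
apply Rplus_le_le_0_compat; apply Rabs_pos.
Qed.

Lemma ex_series_radius kap rho : Rbar_le 1 (CV_radius kap) -> 0 <= rho < 1 ->
  ex_series (fun N => kap N * rho ^ N).
Proof.
intros H Hr; apply ex_series_Rabs, CV_disk_inside.
eapply Rbar_lt_le_trans; [|apply H]; simpl; rewrite Rabs_pos_eq; lra.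
Qed.

Lemma CV_radius_PS_derive kap : Rbar_le 1 (CV_radius kap) ->
  Rbar_le 1 (CV_radius (PS_derive kap)).
Proof. now rewrite CV_radius_derive. Qed.

Lemma ex_series_diag kap c u v : Rbar_le 1 (CV_radius kap) -> dominated kap c ->
  Rabs u + Rabs v < 1 -> ex_series (diag c u v).
Proof.
intros Hk H Huv.
apply ex_series_le_R with (fun N => kap N * (Rabs u + Rabs v) ^ N).
- now apply diag_bound.
- apply ex_series_radius; auto; split; auto.
  apply Rplus_le_le_0_compat; apply Rabs_pos.
Qed.

Lemma dser_bound kap c u v rho : Rbar_le 1 (CV_radius kap) -> dominated kap c ->
  Rabs u + Rabs v <= rho -> rho < 1 -> Rabs (dser c u v) <= PSeries kap rho.
Proof.
intros Hk H Hr Hr1.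
assert (Hr0 : 0 <= rho).
{ eapply Rle_trans; [|apply Hr]; apply Rplus_le_le_0_compat; apply Rabs_pos. }
assert (He : ex_series (fun N => kap N * rho ^ N)) by now apply ex_series_radius.
unfold dser; eapply Rle_trans; [apply Series_Rabs|].
- apply ex_series_le_R with (2 := He).
  intros n; rewrite Rabs_Rabsolu; now apply diag_bound_rho.
- apply Series_le; auto.
  intros n; split; [apply Rabs_pos | now apply diag_bound_rho].
Qed.

Lemma is_derive_monomial (U V : R -> R) (x dU dV k : R) (m n : nat) :
  is_derive U x dU -> is_derive V x dV ->
  is_derive (fun h => k * U h ^ m * V h ^ n) x
    (INR m * k * U x ^ pred m * V x ^ n * dU + INR n * k * U x ^ m * V x ^ pred n * dV).
Proof.
intros HU HV.
auto_derive.
- repeat split; auto; [now exists dU | now exists dV].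
- replace (Derive (fun x0 => U x0) x) with dU by (symmetry; now apply is_derive_unique).
  replace (Derive (fun x0 => V x0) x) with dV by (symmetry; now apply is_derive_unique).
  ring.
Qed.

Lemma is_derive_diag (U V : R -> R) (x dU dV : R) c (N : nat) :
  is_derive U x dU -> is_derive V x dV ->
  is_derive (fun h => diag c (U h) (V h) (S N)) x
    (diag (coefu c) (U x) (V x) N * dU + diag (coefv c) (U x) (V x) N * dV).
Proof.
intros HU HV; unfold diag.
apply (is_derive_ext (fun h => sum_n (fun m => c m (S N - m)%nat * U h ^ m * V h ^ (S N - m)) (S N)));
  [intros h; apply sum_n_Reals|].
evar (e : R).
replace (sum_f_R0 _ N * dU + _ * dV) with e; unfold e.
- apply (is_derive_sum_n (fun m h => c m (S N - m)%nat * U h ^ m * V h ^ (S N - m))).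
  intros m _; apply is_derive_monomial; [apply HU | apply HV].
- rewrite sum_n_Reals, sum_plus; f_equal.
  + rewrite decomp_sum by lia; simpl pred.
    rewrite (Rmult_comm (sum_f_R0 _ _) dU), scal_sum.
    simpl INR at 1; rewrite !Rmult_0_l, Rplus_0_l.
    apply sum_eq; intros m _; unfold coefu; simpl Nat.sub; ring.
  + rewrite tech5, Nat.sub_diag; simpl (INR 0).
    rewrite !Rmult_0_l, Rplus_0_r, (Rmult_comm (sum_f_R0 _ _) dV), scal_sum.
    apply sum_eq; intros m Hm; unfold coefv.
    replace (S N - m)%nat with (S (N - m)) by lia; simpl pred; ring.
Qed.

(** Near x the sum |U| + |V| stays below [rho], the midpoint between its value at x and 1, and U',
    V' stay bounded by continuity. This gives one summable majorant for all nearby h, as termwise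
    differentiation requires. *)
Lemma is_derive_dser kap c (U V U' V' : R -> R) (x : R) :
  Rbar_le 1 (CV_radius kap) -> dominated kap c ->
  locally x (fun h => is_derive U h (U' h)) ->
  locally x (fun h => is_derive V h (V' h)) ->
  continuous U' x -> continuous V' x ->
  Rabs (U x) + Rabs (V x) < 1 ->
  is_derive (fun h => dser c (U h) (V h)) x
    (dser (coefu c) (U x) (V x) * U' x + dser (coefv c) (U x) (V x) * V' x).
Proof.
intros Hk H HU HV CU CV Hx.
assert (Hc : continuous (fun h => Rabs (U h) + Rabs (V h)) x).
{ apply (continuous_plus (fun h => Rabs (U h)) (fun h => Rabs (V h)));
  apply continuous_comp; try apply continuous_Rabs;
  apply (ex_derive_continuous (V := R_NormedModule)).
  - exists (U' x); now apply locally_singleton in HU.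
  - exists (V' x); now apply locally_singleton in HV. }
set (rho := (1 + (Rabs (U x) + Rabs (V x))) / 2).
assert (Hr : 0 <= rho < 1).
{ unfold rho; pose proof (Rabs_pos (U x)); pose proof (Rabs_pos (V x)); lra. }
assert (L1 : locally x (fun h => Rabs (U h) + Rabs (V h) < rho)).
{ apply (Hc (fun z => z < rho)), open_lt; unfold rho; lra. }
assert (bd : forall F : R -> R, continuous F x -> locally x (fun h => Rabs (F h) < Rabs (F x) + 1)).
{ intros F HF.
  assert (HF' : continuous (fun h => Rabs (F h)) x)
    by (apply continuous_comp; [auto | apply continuous_Rabs]).
  apply (HF' (fun z => z < Rabs (F x) + 1)), open_lt; lra. }
assert (LU := bd U' CU); assert (LV := bd V' CV).
assert (L := filter_and _ _ HU (filter_and _ _ HV (filter_and _ _ L1 (filter_and _ _ LU LV)))).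
destruct L as [d L].
assert (L' : forall h, Rabs (h - x) < d -> is_derive U h (U' h) /\ is_derive V h (V' h) /\
  Rabs (U h) + Rabs (V h) < rho /\ Rabs (U' h) < Rabs (U' x) + 1 /\ Rabs (V' h) < Rabs (V' x) + 1)
  by (intros h Hh; apply L, Hh).
(* The part of degree N + 1 differentiates into parts of degree N; the shift is absorbed by a zero
   at index 0, where the term is constant. *)
set (f' := fun n h => match n with O => 0 | S N =>
   diag (coefu c) (U h) (V h) N * U' h + diag (coefv c) (U h) (V h) N * V' h end).
set (B := (Rabs (U' x) + 1) + (Rabs (V' x) + 1)).
set (M := fun n => match n with O => 0 | S N => PS_derive kap N * rho ^ N * B end).
assert (Hu := coefu_dominated _ _ H); assert (Hv := coefv_dominated _ _ H).
assert (Hk' := CV_radius_PS_derive _ Hk).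
replace (dser (coefu c) (U x) (V x) * U' x + dser (coefv c) (U x) (V x) * V' x)
  with (Series (fun n => f' n x)).
- apply (Series_is_derive (fun n h => diag c (U h) (V h) n) f' M x d).
  + apply cond_pos.
  + apply ex_series_incr_1; unfold M.
    apply (ex_series_scal_r B (fun N => PS_derive kap N * rho ^ N)).
    now apply ex_series_radius.
  + intros [|n] h Hh; destruct (L' h Hh) as (E1 & E2 & _); unfold f'.
    * apply (is_derive_ext (fun _ => c O O)); [|apply (is_derive_const (c O O) h)].
      intros z; unfold diag; simpl; ring.
    * now apply is_derive_diag.
  + intros [|n] h Hh; destruct (L' h Hh) as (_ & _ & E3 & E4 & E5); unfold f', M.
    * rewrite Rabs_R0; lra.
    * eapply Rle_trans; [apply Rabs_triang|]; rewrite !Rabs_mult; unfold B.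
      rewrite Rmult_plus_distr_l; apply Rplus_le_compat;
      apply Rmult_le_compat; try apply Rabs_pos; try lra;
      apply diag_bound_rho; auto; lra.
  + intros h Hh; destruct (L' h Hh) as (_ & _ & E3 & _).
    apply ex_series_diag with kap; auto; lra.
- rewrite Series_incr_1_aux by reflexivity; unfold f', dser.
  rewrite <- !Series_scal_r, <- Series_plus; auto.
  + apply ex_series_scal_r, ex_series_diag with (PS_derive kap); auto.
  + apply ex_series_scal_r, ex_series_diag with (PS_derive kap); auto.
Qed.

(** The set |u| + |v| <= rho is convex, so the mean value bound applies along the segment between
    the two points. *)
Lemma dser_lipschitz kap c rho : Rbar_le 1 (CV_radius kap) -> dominated kap c -> rho < 1 ->
  exists K, 0 <= K /\ forall u v u' v', Rabs u + Rabs v <= rho -> Rabs u' + Rabs v' <= rho ->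
    Rabs (dser c u' v' - dser c u v) <= K * (Rabs (u' - u) + Rabs (v' - v)).
Proof.
intros Hk H Hr.
exists (Rabs (PSeries (PS_derive kap) rho)); split; [apply Rabs_pos|].
intros u v u' v' Huv Huv'.
set (U := fun h => u + h * (u' - u)); set (V := fun h => v + h * (v' - v)).
assert (HU : forall h, is_derive U h (u' - u)) by (intros h; unfold U; auto_derive; auto; ring).
assert (HV : forall h, is_derive V h (v' - v)) by (intros h; unfold V; auto_derive; auto; ring).
assert (Hc : forall h, 0 <= h <= 1 -> Rabs (U h) + Rabs (V h) <= rho).
{ intros h Hh; unfold U, V.
  replace (u + h * (u' - u)) with ((1 - h) * u + h * u') by ring.
  replace (v + h * (v' - v)) with ((1 - h) * v + h * v') by ring.
  assert (T := Rabs_triang ((1 - h) * u) (h * u')).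
  assert (T' := Rabs_triang ((1 - h) * v) (h * v')).
  rewrite !Rabs_mult, (Rabs_pos_eq h), (Rabs_pos_eq (1 - h)) in T, T' by lra.
  nra. }
assert (Hu := coefu_dominated _ _ H); assert (Hv := coefv_dominated _ _ H).
assert (Hk' := CV_radius_PS_derive _ Hk).
pose proof (MVT_bound (fun h => dser c (U h) (V h))
  (fun h => dser (coefu c) (U h) (V h) * (u' - u) + dser (coefv c) (U h) (V h) * (v' - v))
  0 1 (Rabs (PSeries (PS_derive kap) rho) * (Rabs (u' - u) + Rabs (v' - v)))) as E.
rewrite Rminus_0_r, Rabs_R1, Rmult_1_r in E.
rewrite Rmin_left, Rmax_right in E by lra.
assert (E1 : dser c u' v' = dser c (U 1) (V 1)) by (f_equal; unfold U, V; ring).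
assert (E0 : dser c u v = dser c (U 0) (V 0)) by (f_equal; unfold U, V; ring).
rewrite E1, E0; apply E.
- intros h Hh; apply (is_derive_dser kap c U V (fun _ => u' - u) (fun _ => v' - v)); auto.
  + apply filter_forall; auto.
  + apply filter_forall; auto.
  + apply continuous_const.
  + apply continuous_const.
  + specialize (Hc h Hh); lra.
- intros h Hh; eapply Rle_trans; [apply Rabs_triang|]; rewrite !Rabs_mult, Rmult_plus_distr_l.
  apply Rplus_le_compat; apply Rmult_le_compat_r; try apply Rabs_pos;
  (eapply Rle_trans; [|apply Rle_abs]); apply dser_bound; auto.
Qed.

(** * Pochhammer symbols and the Gamma function *)

(** Convergence at speed 1/n, stable under sums, products and exp. Plain convergence would only give
    the leading term, without an integrable error. *)
Definition rate (f : nat -> R) (c : R) : Prop :=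
  exists K, forall n, Rabs (f n - c) <= K / INR (S n).

Lemma Rle_div_intro a b c : 0 < c -> a * c <= b -> a <= b / c.
Proof.
intros Hc H; apply Rmult_le_reg_r with c; auto.
unfold Rdiv; rewrite Rmult_assoc, Rinv_l; lra.
Qed.

Lemma Rdiv_le_intro a b c : 0 < c -> a <= b * c -> a / c <= b.
Proof.
intros Hc H; apply Rmult_le_reg_r with c; auto.
unfold Rdiv; rewrite Rmult_assoc, Rinv_l; lra.
Qed.

Lemma INR_S_pos n : 0 < INR (S n).
Proof. apply lt_0_INR; lia. Qed.

Lemma INR_S_ge1 n : 1 <= INR (S n).
Proof. rewrite S_INR; pose proof (pos_INR n); lra. Qed.

Lemma rate_bound f c K : (forall n, Rabs (f n - c) <= K / INR (S n)) -> 0 <= K.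
Proof.
intros H; specialize (H O); simpl INR in H; pose proof (Rabs_pos (f O - c)); lra.
Qed.

Lemma div_S_le K n : 0 <= K -> K / INR (S n) <= K.
Proof.
intros HK; pose proof (INR_S_ge1 n).
apply Rdiv_le_intro; nra.
Qed.

Lemma rate_const c : rate (fun _ => c) c.
Proof.
exists 0; intros n; rewrite Rminus_diag, Rabs_R0; unfold Rdiv; rewrite Rmult_0_l; lra.
Qed.

Lemma rate_plus f g c d : rate f c -> rate g d -> rate (fun n => f n + g n) (c + d).
Proof.
intros [K H] [L G]; exists (K + L); intros n.
replace (f n + g n - (c + d)) with ((f n - c) + (g n - d)) by ring.
unfold Rdiv; rewrite Rmult_plus_distr_r.
eapply Rle_trans; [apply Rabs_triang | now apply Rplus_le_compat].
Qed.

Lemma rate_opp f c : rate f c -> rate (fun n => - f n) (- c).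
Proof.
intros [K H]; exists K; intros n.
replace (- f n - - c) with (- (f n - c)) by ring; now rewrite Rabs_Ropp.
Qed.

Lemma rate_mult f g c d : rate f c -> rate g d -> rate (fun n => f n * g n) (c * d).
Proof.
intros [K H] [L G]; exists (K * (Rabs d + L) + Rabs c * L); intros n.
assert (HL := rate_bound _ _ _ G).
replace (f n * g n - c * d) with ((f n - c) * g n + c * (g n - d)) by ring.
eapply Rle_trans; [apply Rabs_triang|]; rewrite !Rabs_mult.
assert (Rabs (g n) <= Rabs d + L).
{ replace (g n) with (d + (g n - d)) by ring.
  eapply Rle_trans; [apply Rabs_triang|]; apply Rplus_le_compat_l.
  eapply Rle_trans; [apply G | now apply div_S_le]. }
replace ((K * (Rabs d + L) + Rabs c * L) / INR (S n)) with
  (K / INR (S n) * (Rabs d + L) + Rabs c * (L / INR (S n)))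
  by (field; apply Rgt_not_eq, INR_S_pos).
apply Rplus_le_compat.
- apply Rmult_le_compat; auto using Rabs_pos.
- apply Rmult_le_compat_l; auto using Rabs_pos.
Qed.

Lemma exp_le_mono x y : x <= y -> exp x <= exp y.
Proof. intros [H| ->]; [left; now apply exp_increasing | lra]. Qed.

Lemma Rabs_exp_minus_1 x : Rabs (exp x - 1) <= Rabs x * exp (Rabs x).
Proof.
assert (P : forall y, 0 <= y -> exp y - 1 <= y * exp y).
{ intros y Hy; pose proof (exp_ineq1_le (- y)) as H; rewrite exp_Ropp in H.
  pose proof (exp_pos y).
  apply Rmult_le_compat_r with (r := exp y) in H; [|lra].
  rewrite Rinv_l in H by lra; lra. }
destruct (Rle_dec 0 x) as [Hx|Hx].
- rewrite (Rabs_pos_eq x), Rabs_pos_eq; auto.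
  pose proof (exp_ineq1_le x); lra.
- rewrite (Rabs_left x) by lra.
  pose proof (exp_ineq1_le x); pose proof (exp_ineq1_le (- x)); pose proof (exp_pos x).
  assert (exp x < 1) by (rewrite <- exp_0; apply exp_increasing; lra).
  rewrite Rabs_left by lra; nra.
Qed.

Lemma rate_exp f c : rate f c -> rate (fun n => exp (f n)) (exp c).
Proof.
intros [K H]; assert (HK := rate_bound _ _ _ H).
exists (exp c * (K * exp K)); intros n.
replace (exp (f n) - exp c) with (exp c * (exp (f n - c) - 1)).
- rewrite Rabs_mult, (Rabs_pos_eq (exp c)) by (left; apply exp_pos).
  replace (exp c * (K * exp K) / INR (S n)) with (exp c * (K / INR (S n) * exp K))
    by (field; apply Rgt_not_eq, INR_S_pos).
  apply Rmult_le_compat_l; [left; apply exp_pos|].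
  eapply Rle_trans; [apply Rabs_exp_minus_1|].
  apply Rmult_le_compat; auto using Rabs_pos.
  + left; apply exp_pos.
  + apply exp_le_mono. eapply Rle_trans; [apply H | now apply div_S_le].
- replace (f n) with (c + (f n - c)) at 2 by ring.
  rewrite exp_plus; ring.
Qed.

Lemma Un_cv_Rabs_le (u : nat -> R) l B k :
  Un_cv u l -> (forall n, (k <= n)%nat -> Rabs (u n) <= B) -> Rabs l <= B.
Proof.
intros Hu HB; apply Rnot_lt_le; intros Hlt.
destruct (Hu (Rabs l - B)) as [N HN]; [lra|].
specialize (HN (N + k)%nat ltac:(lia)); specialize (HB (N + k)%nat ltac:(lia)).
unfold Rdist in HN.
pose proof (Rabs_triang (u (N + k)%nat) (l - u (N + k)%nat)) as T.
rewrite (Rabs_minus_sym l) in T.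
replace (u (N + k)%nat + (l - u (N + k)%nat)) with l in T by ring; lra.
Qed.

Lemma rate_cv f c : rate f c -> Un_cv f c.
Proof.
intros [K H]; assert (HK := rate_bound _ _ _ H).
intros e He.
destruct (archimed_cor1 (e / (K + 1))) as [N [HN HN0]].
{ apply Rdiv_lt_0_compat; lra. }
exists N; intros n Hn; unfold Rdist; eapply Rle_lt_trans; [apply H|].
assert (0 < INR N) by now apply lt_0_INR.
assert (INR N <= INR (S n)) by (apply le_INR; lia).
apply Rle_lt_trans with ((K + 1) / INR N).
- apply Rmult_le_compat; try lra; [left; apply Rinv_0_lt_compat, INR_S_pos|].
  apply Rinv_le_contravar; auto.
- apply Rmult_lt_compat_l with (r := K + 1) in HN; [|lra].
  replace ((K + 1) * (e / (K + 1))) with e in HN by (field; lra); exact HN.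
Qed.

(** The bound on the increments telescopes: 1 / (k (k + 1)) = 1 / k - 1 / (k + 1). *)
Lemma rate_of_increments (h : nat -> R) (K : R) :
  (forall n, Rabs (h (S n) - h n) <= K / (INR (S n) * INR (S (S n)))) ->
  exists H, rate h H.
Proof.
intros Hh.
assert (T : forall n k, Rabs (h (n + k)%nat - h n) <= K / INR (S n) - K / INR (S (n + k))).
{ intros n k; induction k.
  - rewrite Nat.add_0_r, !Rminus_diag, Rabs_R0; lra.
  - rewrite Nat.add_succ_r.
    replace (h (S (n + k)) - h n) with ((h (S (n + k)) - h (n + k)%nat) + (h (n + k)%nat - h n)) by ring.
    eapply Rle_trans; [apply Rabs_triang|].
    specialize (Hh (n + k)%nat).
    replace (K / (INR (S (n + k)) * INR (S (S (n + k))))) with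
      (K / INR (S (n + k)) - K / INR (S (S (n + k)))) in Hh; [lra|].
    rewrite (S_INR (S _)); field.
    pose proof (INR_S_pos (n + k)); lra. }
assert (HK : 0 <= K).
{ specialize (Hh O); simpl in Hh; pose proof (Rabs_pos (h 1%nat - h O)); lra. }
assert (T' : forall n k, Rabs (h (n + k)%nat - h n) <= K / INR (S n)).
{ intros n k; specialize (T n k).
  assert (0 <= K / INR (S (n + k))) by (apply Rdiv_le_0_compat; [auto | apply INR_S_pos]).
  lra. }
assert (HC : Cauchy_crit h).
{ intros e He.
  assert (HR : rate (fun n => K / INR (S n)) 0).
  { exists K; intros n; rewrite Rminus_0_r, Rabs_pos_eq; [lra|].
    apply Rdiv_le_0_compat; [auto | apply INR_S_pos]. }
  apply rate_cv in HR; destruct (HR (e / 2)) as [N HN]; [lra|].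
  exists N; intros n m Hn Hm; unfold Rdist.
  specialize (HN N (Nat.le_refl N)); unfold Rdist in HN.
  rewrite Rminus_0_r in HN; pose proof (Rle_abs (K / INR (S N))).
  pose proof (T' N (n - N)%nat) as A; pose proof (T' N (m - N)%nat) as B.
  replace (N + (n - N))%nat with n in A by lia.
  replace (N + (m - N))%nat with m in B by lia.
  replace (h n - h m) with ((h n - h N) - (h m - h N)) by ring.
  eapply Rle_lt_trans; [apply Rabs_triang|]; rewrite Rabs_Ropp; lra. }
destruct (Rcomplete.R_complete h HC) as [H HH].
exists H, K; intros n.
rewrite Rabs_minus_sym.
apply Un_cv_Rabs_le with (u := fun k => h k - h n) (k := n).
- intros e He; destruct (HH e He) as [N HN]; exists N; intros k Hk.
  specialize (HN k Hk); unfold Rdist in *.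
  now replace (h k - h n - (H - h n)) with (h k - H) by ring.
- intros k Hk; specialize (T' n (k - n)%nat).
  now replace (n + (k - n))%nat with k in T' by lia.
Qed.

Lemma poch_pos z n : 0 < z -> 0 < poch z n.
Proof.
intros Hz; induction n; simpl; [lra|].
apply Rmult_lt_0_compat; auto; pose proof (pos_INR n); lra.
Qed.

Lemma ln_le_minus_1 x : 0 < x -> ln x <= x - 1.
Proof.
intros Hx; pose proof (exp_ineq1_le (ln x)) as H; rewrite exp_ln in H; lra.
Qed.

Lemma ln_1p_ge t : -1 < t -> t / (1 + t) <= ln (1 + t).
Proof.
intros Ht; pose proof (ln_le_minus_1 (/ (1 + t))) as H.
rewrite ln_Rinv in H by lra.
assert (0 < / (1 + t)) by (apply Rinv_0_lt_compat; lra).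
specialize (H H0).
replace (t / (1 + t)) with (1 - / (1 + t)) by (field; lra); lra.
Qed.

(** Minus the logarithm of the product of Gauss, with n + 1 instead of n under the power so that the
    index 0 does not produce [ln 0]. Its limit is [- ln (Gamma z)]. *)
Definition lnG (z : R) (n : nat) : R :=
  ln (poch z (S n)) - ln (INR (fact n)) - z * ln (INR (S n)).

Lemma lnG_rate z : 0 < z -> exists L, rate (lnG z) L.
Proof.
intros Hz; apply rate_of_increments with (2 * (z + z * z)); intros n.
unfold lnG.
assert (Hn := INR_S_pos n).
assert (Hf := INR_fact_lt_0 n).
assert (Hp : 0 < poch z (S n)) by now apply poch_pos.
change (poch z (S (S n))) with (poch z (S n) * (z + INR (S n))).
rewrite fact_simpl, mult_INR, (ln_mult (poch z (S n))), (ln_mult (INR (S n))) by lra.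
set (x := / INR (S n)).
assert (Hx : 0 < x <= 1).
{ split; [now apply Rinv_0_lt_compat|]. unfold x; rewrite <- Rinv_1.
  apply Rinv_le_contravar; [lra | apply INR_S_ge1]. }
replace (ln (z + INR (S n))) with (ln (INR (S n)) + ln (1 + z * x)).
2:{ rewrite <- ln_mult by nra. f_equal; unfold x; field; lra. }
replace (ln (INR (S (S n)))) with (ln (INR (S n)) + ln (1 + x)).
2:{ rewrite <- ln_mult by lra. f_equal; rewrite (S_INR (S n)); unfold x; field; lra. }
match goal with |- Rabs ?e <= _ => replace e with (ln (1 + z * x) - z * ln (1 + x)) by ring end.
assert (A1 := ln_le_minus_1 (1 + z * x) ltac:(nra)).
assert (A2 := ln_le_minus_1 (1 + x) ltac:(lra)).
assert (A3 := ln_1p_ge x ltac:(lra)).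
assert (A4 := ln_1p_ge (z * x) ltac:(nra)).
assert (A5 : x - x * x <= x / (1 + x)) by (apply Rle_div_intro; nra).
assert (A6 : z * x - (z * x) * (z * x) <= z * x / (1 + z * x)).
{ assert (0 < z * x) by nra; apply Rle_div_intro; [lra|].
  assert (0 <= (z * x) * (z * x) * (z * x)) by (repeat apply Rmult_le_pos; lra). nra. }
assert (A7 : x * x <= 2 / (INR (S n) * INR (S (S n)))).
{ assert (Hg := INR_S_ge1 n); rewrite (S_INR (S n)).
  apply Rle_div_intro; [nra|].
  replace (x * x * (INR (S n) * (INR (S n) + 1))) with (1 + x) by (unfold x; field; lra); lra. }
replace (2 * (z + z * z) / _) with ((z + z * z) * (2 / (INR (S n) * INR (S (S n)))))
  by (unfold Rdiv; ring).
apply Rle_trans with ((z + z * z) * (x * x)).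
2:{ apply Rmult_le_compat_l; nra. }
apply Rabs_le; split; nra.
Qed.

Lemma lim_seq_eq u l : Un_cv u l -> lim_seq u = l.
Proof.
intros H; unfold lim_seq.
apply (UL_sequence u); auto.
apply epsilon_spec; now exists l.
Qed.

Lemma ln_succ_rate : rate (fun n => ln (INR (S (S n))) - ln (INR (S n))) 0.
Proof.
exists 1; intros n; rewrite Rminus_0_r.
assert (Hn := INR_S_pos n).
assert (Hx : 0 < / INR (S n)) by now apply Rinv_0_lt_compat.
replace (ln (INR (S (S n))) - ln (INR (S n))) with (ln (1 + / INR (S n))).
- rewrite Rabs_pos_eq.
  + pose proof (ln_le_minus_1 (1 + / INR (S n))); lra.
  + rewrite <- ln_1; apply ln_le; lra.
- rewrite <- ln_div; [|apply lt_0_INR; lia | auto].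
  f_equal; rewrite (S_INR (S n)); field; lra.
Qed.

Lemma lnG_Gamma z : 0 < z -> 0 < Gamma z /\ rate (lnG z) (- ln (Gamma z)).
Proof.
intros Hz; destruct (lnG_rate z Hz) as [L HL].
assert (E : Gamma z = exp (- L)).
{ unfold Gamma; apply lim_seq_eq.
  assert (HR : rate (fun n => exp (- lnG z n + - (z * (ln (INR (S n)) - ln (INR n)))))
     (exp (- L + - (z * 0)))).
  { apply rate_exp, rate_plus; [now apply rate_opp|].
    apply rate_opp, rate_mult; [apply rate_const|].
    destruct ln_succ_rate as [K HK].
    (* At n = 0 the term contains the default value [ln 0], which the constant absorbs; the factor 2
       pays for the shift of the index by one. *)
    exists (2 * K + Rabs (ln 1 - ln 0)).
    assert (0 <= K) by (eapply rate_bound; apply HK).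
    intros [|n].
    - simpl INR. rewrite Rminus_0_r, Rdiv_1_r; lra.
    - eapply Rle_trans; [apply HK|].
      pose proof (INR_S_ge1 n); rewrite (S_INR (S n)).
      apply Rdiv_le_intro; [lra|].
      replace ((2 * K + Rabs (ln 1 - ln 0)) / (INR (S n) + 1) * INR (S n)) with
        ((2 * K + Rabs (ln 1 - ln 0)) * (INR (S n) / (INR (S n) + 1))) by (field; lra).
      assert (/ 2 <= INR (S n) / (INR (S n) + 1)) by (apply Rle_div_intro; lra).
      pose proof (Rabs_pos (ln 1 - ln 0)).
      apply Rle_trans with ((2 * K + Rabs (ln 1 - ln 0)) * / 2); [lra|].
      apply Rmult_le_compat_l; lra. }
  rewrite Rmult_0_r, Ropp_0, Rplus_0_r in HR.
  apply rate_cv in HR.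
  intros e He; destruct (HR e He) as [N HN]; exists N; intros n Hn.
  specialize (HN n Hn).
  replace (INR (fact n) * Rpower (INR n) z / poch z (S n)) with
    (exp (- lnG z n + - (z * (ln (INR (S n)) - ln (INR n))))); auto.
  unfold lnG.
  replace (- _ + - _) with (ln (INR (fact n)) + z * ln (INR n) + - ln (poch z (S n))) by ring.
  rewrite !exp_plus, exp_Ropp, !exp_ln; auto using INR_fact_lt_0, poch_pos. }
split.
- rewrite E; apply exp_pos.
- now rewrite E, ln_exp, Ropp_involutive.
Qed.

(** * Binomial averages of inverse powers *)

(** The expectation of f (m, N - m) when m has the binomial law of parameters N and p. *)
Definition bavg (p q : R) (N : nat) (f : nat -> nat -> R) : R :=
  sum_f_R0 (fun m => Binomial.C N m * p ^ m * q ^ (N - m) * f m (N - m)%nat) N.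

Section BinomialAverage.
Variables (p q : R).
Hypotheses (Hp : 0 < p) (Hq : 0 < q) (Hpq : p + q = 1).

Lemma bweight_pos N m : 0 < Binomial.C N m * p ^ m * q ^ (N - m).
Proof.
apply Rmult_lt_0_compat; [apply Rmult_lt_0_compat; [apply C_pos|]|]; now apply pow_lt.
Qed.

Lemma bavg_const N k : bavg p q N (fun _ _ => k) = k.
Proof.
unfold bavg.
rewrite <- (scal_sum (fun m => Binomial.C N m * p ^ m * q ^ (N - m))).
now rewrite <- binomial, Hpq, pow1, Rmult_1_r.
Qed.

Lemma bavg_le N f g : (forall m n, (m + n)%nat = N -> f m n <= g m n) ->
  bavg p q N f <= bavg p q N g.
Proof.
intros H; apply sum_Rle; intros m Hm.
apply Rmult_le_compat_l; [left; apply bweight_pos | apply H; lia].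
Qed.

Lemma bavg_ext N f g : (forall m n, (m + n)%nat = N -> f m n = g m n) ->
  bavg p q N f = bavg p q N g.
Proof. intros H; apply Rle_antisym; apply bavg_le; intros m n E; rewrite H; auto; lra. Qed.

Lemma bavg_plus N f g : bavg p q N (fun m n => f m n + g m n) = bavg p q N f + bavg p q N g.
Proof.
unfold bavg; rewrite <- sum_plus; apply sum_eq; intros; ring.
Qed.

Lemma bavg_scal N k f : bavg p q N (fun m n => k * f m n) = k * bavg p q N f.
Proof.
unfold bavg; rewrite scal_sum; apply sum_eq; intros; ring.
Qed.

Lemma bavg_abs N f : Rabs (bavg p q N f) <= bavg p q N (fun m n => Rabs (f m n)).
Proof.
unfold bavg; eapply Rle_trans; [apply Rsum_abs|]; apply sum_Rle; intros m _.
rewrite Rabs_mult, Rabs_pos_eq; [lra | left; apply bweight_pos].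
Qed.

Lemma C_succ_l m n : Binomial.C (m + n) m = Binomial.C (S (m + n)) (S m) * (INR (S m) / INR (S (m + n))).
Proof.
replace (S (m + n)) with (S m + n)%nat at 1 by lia.
rewrite !C_sum_l; replace (S m + n)%nat with (S (m + n)) by lia.
rewrite !fact_simpl, !mult_INR.
pose proof (INR_S_pos m); pose proof (INR_S_pos (m + n)).
field; repeat split; try apply INR_fact_neq_0; lra.
Qed.

Lemma C_succ_r m n : Binomial.C (m + n) m = Binomial.C (S (m + n)) m * (INR (S n) / INR (S (m + n))).
Proof.
replace (S (m + n)) with (m + S n)%nat at 1 by lia.
rewrite !C_sum_l; replace (m + S n)%nat with (S (m + n)) by lia.
rewrite !fact_simpl, !mult_INR.
pose proof (INR_S_pos n); pose proof (INR_S_pos (m + n)).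
field; repeat split; try apply INR_fact_neq_0; lra.
Qed.

(** Since C(N, m) / (m + 1) = C(N + 1, m + 1) / (N + 1), a factor 1 / (m + 1) raises the order of
    the average by one and costs 1 / ((N + 1) p). The term m = 0 of the new average is missing,
    whence the inequality and the sign condition on g. *)
Lemma bavg_shift_m N g : (forall m n, 0 <= g m n) ->
  bavg p q N (fun m n => g (S m) n / INR (S m)) <= bavg p q (S N) g / (INR (S N) * p).
Proof.
intros Hg; pose proof (INR_S_pos N).
apply Rle_div_intro; [nra|]; unfold bavg.
rewrite (Rmult_comm (sum_f_R0 _ _)), scal_sum.
rewrite (decomp_sum _ (S N)) by lia; simpl pred.
match goal with |- ?A <= ?B + ?D => assert (0 <= B) by
  (apply Rmult_le_pos; [left; apply bweight_pos | auto]); apply Rle_trans with D; [|lra] end.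
apply sum_Rle; intros m Hm.
pose proof (INR_S_pos m).
pose proof (C_succ_l m (N - m)) as E; replace (m + (N - m))%nat with N in E by lia.
rewrite E; simpl Nat.sub; simpl pow; right; field; lra.
Qed.

Lemma bavg_shift_n N g : (forall m n, 0 <= g m n) ->
  bavg p q N (fun m n => g m (S n) / INR (S n)) <= bavg p q (S N) g / (INR (S N) * q).
Proof.
intros Hg; pose proof (INR_S_pos N).
apply Rle_div_intro; [nra|]; unfold bavg.
rewrite (Rmult_comm (sum_f_R0 _ _)), scal_sum, tech5.
match goal with |- ?A <= ?D + ?B => assert (0 <= B) by
  (apply Rmult_le_pos; [left; apply bweight_pos | auto]); apply Rle_trans with D; [|lra] end.
apply sum_Rle; intros m Hm.
replace (S N - m)%nat with (S (N - m)) by lia.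
pose proof (INR_S_pos (N - m)).
pose proof (C_succ_r m (N - m)) as E; replace (m + (N - m))%nat with N in E by lia.
rewrite E; simpl pow; right; field; lra.
Qed.

Lemma bavg_inv_m N : bavg p q N (fun m _ => / INR (S m)) <= / (INR (S N) * p).
Proof.
pose proof (bavg_shift_m N (fun _ _ => 1) ltac:(intros; lra)) as H.
rewrite bavg_const in H; unfold Rdiv in H; rewrite Rmult_1_l in H.
eapply Rle_trans; [|apply H]; apply bavg_le; intros; lra.
Qed.

Lemma bavg_inv_n N : bavg p q N (fun _ n => / INR (S n)) <= / (INR (S N) * q).
Proof.
pose proof (bavg_shift_n N (fun _ _ => 1) ltac:(intros; lra)) as H.
rewrite bavg_const in H; unfold Rdiv in H; rewrite Rmult_1_l in H.
eapply Rle_trans; [|apply H]; apply bavg_le; intros; lra.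
Qed.

(** Replaces a square by a product of consecutive inverses, to which the shift lemma applies
    twice. *)
Lemma inv_sqr_S m : / INR (S m) * / INR (S m) <= 2 * (/ INR (S (S m)) / INR (S m)).
Proof.
rewrite (S_INR (S m)); pose proof (INR_S_ge1 m).
replace (2 * (/ (INR (S m) + 1) / INR (S m))) with ((2 * / (INR (S m) + 1)) * / INR (S m)) by (unfold Rdiv; ring).
apply Rmult_le_compat_r; [left; apply Rinv_0_lt_compat; lra|].
apply Rle_div_intro; [lra|].
apply Rmult_le_reg_l with (INR (S m)); [lra|].
replace (INR (S m) * (/ INR (S m) * (INR (S m) + 1))) with (INR (S m) + 1) by (field; lra).
lra.
Qed.

Lemma bavg_inv_sqr_m N :
  bavg p q N (fun m _ => / INR (S m) * / INR (S m)) <= 2 / (INR (S N) * INR (S (S N)) * p ^ 2).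
Proof.
pose proof (INR_S_pos N); pose proof (INR_S_pos (S N)).
apply Rle_trans with (2 * bavg p q N (fun m _ => / INR (S (S m)) / INR (S m))).
- rewrite <- bavg_scal; apply bavg_le; intros; apply inv_sqr_S.
- apply Rle_trans with (2 * (bavg p q (S N) (fun m _ => / INR (S m)) / (INR (S N) * p))).
  + apply Rmult_le_compat_l; [lra|].
    apply (bavg_shift_m N (fun m _ => / INR (S m))).
    intros; left; apply Rinv_0_lt_compat, INR_S_pos.
  + replace (2 / (INR (S N) * INR (S (S N)) * p ^ 2)) with
      (2 * (/ (INR (S (S N)) * p) / (INR (S N) * p))) by (field; lra).
    apply Rmult_le_compat_l; [lra|].
    apply Rmult_le_compat_r; [left; apply Rinv_0_lt_compat; nra | apply bavg_inv_m].
Qed.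

Lemma bavg_inv_sqr_n N :
  bavg p q N (fun _ n => / INR (S n) * / INR (S n)) <= 2 / (INR (S N) * INR (S (S N)) * q ^ 2).
Proof.
pose proof (INR_S_pos N); pose proof (INR_S_pos (S N)).
apply Rle_trans with (2 * bavg p q N (fun _ m => / INR (S (S m)) / INR (S m))).
- rewrite <- bavg_scal; apply bavg_le; intros; apply inv_sqr_S.
- apply Rle_trans with (2 * (bavg p q (S N) (fun _ m => / INR (S m)) / (INR (S N) * q))).
  + apply Rmult_le_compat_l; [lra|].
    apply (bavg_shift_n N (fun _ m => / INR (S m))).
    intros; left; apply Rinv_0_lt_compat, INR_S_pos.
  + replace (2 / (INR (S N) * INR (S (S N)) * q ^ 2)) with
      (2 * (/ (INR (S (S N)) * q) / (INR (S N) * q))) by (field; lra).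
    apply Rmult_le_compat_l; [lra|].
    apply Rmult_le_compat_r; [left; apply Rinv_0_lt_compat; nra | apply bavg_inv_n].
Qed.

Lemma bavg_m N : bavg p q N (fun m _ => INR m) = INR N * p.
Proof.
destruct N as [|N]; [unfold bavg; simpl; ring|].
transitivity (INR (S N) * (p * bavg p q N (fun _ _ => 1))); [|rewrite bavg_const; ring].
unfold bavg; rewrite decomp_sum by lia; simpl pred; simpl (INR 0).
rewrite Rmult_0_r, Rplus_0_l.
rewrite <- Rmult_assoc, scal_sum; apply sum_eq; intros m Hm.
pose proof (C_succ_l m (N - m)) as E; replace (m + (N - m))%nat with N in E by lia.
rewrite E; simpl Nat.sub; simpl pow; field.
pose proof (INR_S_pos N); lra.
Qed.

Lemma bavg_n N : bavg p q N (fun _ n => INR n) = INR N * q.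
Proof.
assert (E : bavg p q N (fun m n => INR m + INR n) = INR N).
{ rewrite <- (bavg_const N (INR N)); apply bavg_ext; intros m n <-.
  now rewrite plus_INR. }
rewrite bavg_plus, bavg_m in E.
assert (INR N * q = INR N - INR N * p) by (replace q with (1 - p) by lra; ring); lra.
Qed.

End BinomialAverage.

(** Convexity of exp on [0, L], read off the tangent at [al * L]: its inequalities at 0 and at L are
    added with the weights 1 - al and al. *)
Lemma exp_convex_combination al L : 0 <= al <= 1 -> exp (al * L) <= 1 + al * (exp L - 1).
Proof.
intros H.
pose proof (exp_ineq1_le (- (al * L))) as A.
pose proof (exp_ineq1_le (L - al * L)) as B.
unfold Rminus in B; rewrite exp_plus in B.
rewrite exp_Ropp in A, B.
pose proof (exp_pos (al * L)) as P.
set (y := exp (al * L)) in *; set (T := exp L) in *.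
assert (C : 1 <= (1 - al) * / y + al * (T * / y)) by nra.
apply Rmult_le_compat_r with (r := y) in C; [|lra].
replace (((1 - al) * / y + al * (T * / y)) * y) with (1 - al + al * T) in C by (field; lra).
lra.
Qed.

(** This bound and the next enclose a product of powers between expressions linear in z, w and in
    1/z, 1/w, whose binomial averages are known or bounded. *)
Lemma power_product_lower al ga z w : 0 <= al -> 0 <= ga -> 0 < z -> 0 < w ->
  1 - al * (z - 1) - ga * (w - 1) <= exp (- al * ln z - ga * ln w).
Proof.
intros Ha Hg Hz Hw.
pose proof (exp_ineq1_le (- al * ln z - ga * ln w)).
pose proof (ln_le_minus_1 z Hz); pose proof (ln_le_minus_1 w Hw); nra.
Qed.

(* With p (z - 1) + q (w - 1) = 0 the cross term (1/z - 1) (1/w - 1) is nonpositive. *)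
Lemma power_product_upper al ga p q z w : 0 <= al <= 1 -> 0 <= ga <= 1 ->
  0 < p -> 0 < q -> 0 < z -> 0 < w -> p + q = 1 -> p * z + q * w = 1 ->
  exp (- al * ln z - ga * ln w) <= 1 + al * (/ z - 1) + ga * (/ w - 1).
Proof.
intros Ha Hg Hp Hq Hz Hw Hpq E.
unfold Rminus at 1; rewrite exp_plus.
replace (- al * ln z) with (al * ln (/ z)) by (rewrite ln_Rinv by auto; ring).
replace (- (ga * ln w)) with (ga * ln (/ w)) by (rewrite ln_Rinv by auto; ring).
assert (Hz' := Rinv_0_lt_compat _ Hz); assert (Hw' := Rinv_0_lt_compat _ Hw).
assert (A := exp_convex_combination al (ln (/ z)) Ha).
assert (B := exp_convex_combination ga (ln (/ w)) Hg).
rewrite exp_ln in A, B by auto.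
apply Rle_trans with ((1 + al * (/ z - 1)) * (1 + ga * (/ w - 1))).
- apply Rmult_le_compat; auto; left; apply exp_pos.
- assert ((/ z - 1) * (/ w - 1) <= 0).
  { replace ((/ z - 1) * (/ w - 1)) with (((1 - z) * (1 - w)) * (/ z * / w)) by (field; lra).
    assert (q * ((1 - z) * (1 - w)) = - p * ((1 - z) * (1 - z))).
    { assert (q * (1 - w) = - p * (1 - z)) by lra.
      replace (q * ((1 - z) * (1 - w))) with ((q * (1 - w)) * (1 - z)) by ring.
      rewrite H; ring. }
    assert (0 <= (1 - z) * (1 - z)) by apply Rle_0_sqr.
    assert ((1 - z) * (1 - w) <= 0).
    { apply Rnot_lt_le; intros Hc.
      assert (0 < q * ((1 - z) * (1 - w))) by now apply Rmult_lt_0_compat.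
      assert (0 <= p * ((1 - z) * (1 - z))) by (apply Rmult_le_pos; lra). lra. }
    assert (0 < / z * / w) by now apply Rmult_lt_0_compat.
    apply Rle_trans with (0 * (/ z * / w)); [|lra].
    apply Rmult_le_compat_r; lra. }
  assert (0 <= al * ga) by (apply Rmult_le_pos; lra).
  assert (0 <= al * ga * - ((/ z - 1) * (/ w - 1))) by (apply Rmult_le_pos; lra); lra.
Qed.

(** The product z^(-al) w^(-ga) with z, w the ratios of m + 1, n + 1 to their ideal values. The
    factor N + 2 = (m + 1) + (n + 1) makes p z + q w = 1, the condition of [power_product_upper]. *)
Definition fpow (al ga p q : R) (N m n : nat) : R :=
  exp (- al * ln (INR (S m) / (INR (S (S N)) * p)) - ga * ln (INR (S n) / (INR (S (S N)) * q))).

Lemma fpow_upper al ga p q N m n : 0 <= al <= 1 -> 0 <= ga <= 1 -> 0 < p -> 0 < q ->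
  p + q = 1 -> (m + n)%nat = N ->
  fpow al ga p q N m n <= 1 + al * (INR (S (S N)) * p * / INR (S m) - 1)
    + ga * (INR (S (S N)) * q * / INR (S n) - 1).
Proof.
intros Ha Hg Hp Hq Hpq E; unfold fpow.
assert (HM := INR_S_pos (S N)); assert (Hm := INR_S_pos m); assert (Hn := INR_S_pos n).
assert (HM' : INR (S (S N)) = INR (S m) + INR (S n)) by (rewrite <- E, !S_INR, plus_INR; ring).
assert (A := Rmult_lt_0_compat _ _ HM Hp); assert (B := Rmult_lt_0_compat _ _ HM Hq).
eapply Rle_trans.
- apply power_product_upper with (p := p) (q := q); auto; try (now apply Rdiv_lt_0_compat).
  rewrite HM'; field; lra.
- right; f_equal; [f_equal|]; field; lra.
Qed.

(** From below the linear bound needs only the means of m and n; from above it needs the averages of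
    1 / (m + 1) and 1 / (n + 1). Both sides equal 1 up to a multiple of 1 / (p0 (N + 1)). *)
Lemma bavg_fpow al ga p0 p q N : 0 <= al <= 1 -> 0 <= ga <= 1 -> 0 < p0 ->
  p0 <= p -> p0 <= q -> p + q = 1 ->
  Rabs (bavg p q N (fpow al ga p q N) - 1) <= (2 / p0) / INR (S N).
Proof.
intros Ha Hg H0 Hp Hq Hpq.
assert (Hp' : 0 < p) by lra; assert (Hq' : 0 < q) by lra.
assert (HN := INR_S_pos N); assert (HM := INR_S_pos (S N)).
assert (EM : INR (S (S N)) = INR (S N) + 1) by apply S_INR.
assert (EN : INR (S N) = INR N + 1) by apply S_INR.
set (M := INR (S (S N))) in *.
assert (A := Rmult_lt_0_compat _ _ HM Hp'); assert (B := Rmult_lt_0_compat _ _ HM Hq').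
assert (Hi0 : 1 <= / p0).
{ rewrite <- Rinv_1; apply Rinv_le_contravar; lra. }
apply Rabs_le; split.
- assert (L : bavg p q N (fun m n => (1 + al + ga) + ((- al / (M * p)) * (INR m + 1) +
      (- ga / (M * q)) * (INR n + 1))) <= bavg p q N (fpow al ga p q N)).
  { apply bavg_le; auto; intros m n _.
    eapply Rle_trans; [|apply power_product_lower; [lra | lra |
      apply Rdiv_lt_0_compat; [apply INR_S_pos | assumption] .. ]].
    rewrite (S_INR m), (S_INR n); fold M; right; field; lra. }
  rewrite !bavg_plus, !bavg_scal, !bavg_plus, !bavg_const, bavg_m, bavg_n in L by auto.
  assert (F : forall k r, 0 <= k <= 1 -> p0 <= r -> r <= 1 -> - k / (M * r) * (INR N * r + 1) >= - k - / p0 / INR (S N)).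
  { intros k r Hk Hr Hr1.
    assert (Hr' : / r <= / p0) by (apply Rinv_le_contravar; lra).
    replace (- k / (M * r) * (INR N * r + 1)) with (- k + k * ((2 - / r) / M))
      by (replace (INR N) with (M - 2) by lra; field; lra).
    assert (- (/ p0 / INR (S N)) <= (2 - / r) / M); [|
      assert (0 < / p0 / INR (S N)) by (apply Rdiv_lt_0_compat; lra); nra].
    assert (- (/ p0) / M <= (2 - / r) / M).
    { apply Rmult_le_compat_r; [left; now apply Rinv_0_lt_compat | lra]. }
    assert (/ p0 / M <= / p0 / INR (S N)).
    { apply Rmult_le_compat_l; [lra | apply Rinv_le_contravar; lra]. }
    unfold Rdiv in *; lra. }
  assert (F1 := F al p Ha Hp ltac:(lra)); assert (F2 := F ga q Hg Hq ltac:(lra)).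
  unfold Rdiv in *; lra.
- assert (L : bavg p q N (fpow al ga p q N) <= bavg p q N (fun m n => (1 - al - ga) +
     ((al * (M * p)) * / INR (S m) + (ga * (M * q)) * / INR (S n)))).
  { apply bavg_le; auto; intros m n E.
    eapply Rle_trans; [apply fpow_upper; auto|]; fold M; right; ring. }
  rewrite !bavg_plus, !bavg_scal, !bavg_const in L by auto.
  assert (F : forall k r S, 0 <= k <= 1 -> 0 < r -> S <= / (INR (Datatypes.S N) * r) ->
     k * (M * r) * S <= k + / p0 / INR (Datatypes.S N)).
  { intros k r S Hk Hr HS.
    apply Rle_trans with (k * (M * r) * / (INR (Datatypes.S N) * r)).
    - apply Rmult_le_compat_l; auto; apply Rmult_le_pos; [lra | nra].
    - replace (k * (M * r) * / (INR (Datatypes.S N) * r)) with (k + k / INR (Datatypes.S N))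
        by (rewrite EM; field; lra).
      apply Rplus_le_compat_l, Rmult_le_compat_r; [left; now apply Rinv_0_lt_compat | lra]. }
  assert (F1 := F al p _ Ha Hp' (bavg_inv_m p q Hp' Hq' Hpq N)).
  assert (F2 := F ga q _ Hg Hq' (bavg_inv_n p q Hp' Hq' Hpq N)).
  unfold Rdiv in *; lra.
Qed.

Lemma bavg_fpow_inv al ga p0 p q N : 0 <= al <= 1 -> 0 <= ga <= 1 -> 0 < p0 ->
  p0 <= p -> p0 <= q -> p + q = 1 ->
  bavg p q N (fun m n => fpow al ga p q N m n * (/ INR (S m) + / INR (S n)))
    <= (16 / p0 ^ 2) / INR (S N).
Proof.
intros Ha Hg H0 Hp Hq Hpq.
assert (Hp' : 0 < p) by lra; assert (Hq' : 0 < q) by lra.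
assert (HN := INR_S_pos N); assert (HM := INR_S_pos (S N)).
set (M := INR (S (S N))) in *.
apply Rle_trans with (bavg p q N (fun m n => (4 * M) * (/ INR (S m) * / INR (S m)) +
   (4 * M) * (/ INR (S n) * / INR (S n)))).
- apply bavg_le; auto; intros m n E.
  assert (Hm := INR_S_pos m); assert (Hn := INR_S_pos n).
  assert (HM' : M = INR (S m) + INR (S n)) by (unfold M; rewrite <- E, !S_INR, plus_INR; ring).
  assert (U := fpow_upper al ga p q N m n Ha Hg Hp' Hq' Hpq E); fold M in U.
  set (x := / INR (S m)) in *; set (y := / INR (S n)) in *.
  assert (Hx : 0 < x) by now apply Rinv_0_lt_compat.
  assert (Hy : 0 < y) by now apply Rinv_0_lt_compat.
  (* A crude bound suffices: after multiplication by x + y, averages of inverse squares are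
     O(1/N^2), and the factor M leaves O(1/N). *)
  assert (U1 : fpow al ga p q N m n <= 2 * M * (x + y)).
  { assert (1 <= M * x).
    { apply Rmult_le_reg_r with (INR (S m)); auto.
      replace (M * x * INR (S m)) with M by (unfold x; field; lra); lra. }
    assert (Mx : 0 < M * x) by now apply Rmult_lt_0_compat.
    assert (My : 0 < M * y) by now apply Rmult_lt_0_compat.
    assert (al * (M * p * x - 1) <= M * x).
    { replace (al * (M * p * x - 1)) with ((al * p) * (M * x) - al) by ring.
      assert (al * p <= 1) by nra. nra. }
    assert (ga * (M * q * y - 1) <= M * y).
    { replace (ga * (M * q * y - 1)) with ((ga * q) * (M * y) - ga) by ring.
      assert (ga * q <= 1) by nra. nra. }
    lra. }
  apply Rle_trans with ((2 * M * (x + y)) * (x + y)).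
  + apply Rmult_le_compat_r; lra.
  + assert (0 <= M * ((x - y) * (x - y))) by (apply Rmult_le_pos; [lra | apply Rle_0_sqr]).
    lra.
- rewrite bavg_plus, !bavg_scal by auto.
  assert (A := bavg_inv_sqr_m p q Hp' Hq' Hpq N); assert (B := bavg_inv_sqr_n p q Hp' Hq' Hpq N).
  fold M in A, B.
  assert (F : forall r S, p0 <= r -> S <= 2 / (INR (Datatypes.S N) * M * r ^ 2) ->
     4 * M * S <= (8 / p0 ^ 2) / INR (Datatypes.S N)).
  { intros r S Hr HS.
    apply Rle_trans with (4 * M * (2 / (INR (Datatypes.S N) * M * r ^ 2))).
    - apply Rmult_le_compat_l; lra.
    - replace (4 * M * (2 / (INR (Datatypes.S N) * M * r ^ 2))) with (8 * / r ^ 2 / INR (Datatypes.S N))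
        by (field; lra).
      apply Rmult_le_compat_r; [left; now apply Rinv_0_lt_compat|].
      apply Rmult_le_compat_l; [lra|].
      apply Rinv_le_contravar; [now apply pow_lt | apply pow_incr; lra]. }
  assert (F1 := F p _ Hp A); assert (F2 := F q _ Hq B).
  replace (16 / p0 ^ 2 / INR (S N)) with (8 / p0 ^ 2 / INR (S N) + 8 / p0 ^ 2 / INR (S N))
    by (field; lra).
  lra.
Qed.

(** The same product as [fpow] without p and q, hence usable for the coefficients, which do not know
    the direction (u, v). The two differ by the factor p^(-al) q^(-ga). *)
Definition psi (al ga : R) (m n : nat) : R :=
  exp ((al + ga) * ln (INR (S (S (m + n)))) - al * ln (INR (S m)) - ga * ln (INR (S n))).

Lemma psi_fpow al ga p q m n : 0 < p -> 0 < q ->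
  psi al ga m n = exp (- al * ln p - ga * ln q) * fpow al ga p q (m + n) m n.
Proof.
intros Hp Hq; unfold psi, fpow; rewrite <- exp_plus; f_equal.
assert (HM := INR_S_pos (S (m + n))); assert (Hm := INR_S_pos m); assert (Hn := INR_S_pos n).
rewrite !ln_div, !ln_mult; auto; try (now apply Rmult_lt_0_compat).
ring.
Qed.

(* The coefficients of the series behave like [c0 C(N,m) psi(m,n)], and averaging [psi] against
   the binomial weights reproduces its value at the mean up to a relative error O(1/N). *)
Definition regular_coef (al ga c0 : R) (d : nat -> nat -> R) : Prop :=
  exists K, forall m n, Rabs (d m n - Binomial.C (m + n) m * psi al ga m n * c0)
    <= K * Binomial.C (m + n) m * psi al ga m n * (/ INR (S m) + / INR (S n)).

(** Writing u = s p, v = s q with p + q = 1 pulls out s^N and leaves a binomial average of d / C.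
    The cone condition keeps p, q above [p0], and p^(-al) q^(-ga) below [E0], so that K is
    uniform. *)
Lemma diag_asymptotics al ga c0 d p0 : 0 <= al <= 1 -> 0 <= ga <= 1 -> 0 < p0 ->
  regular_coef al ga c0 d ->
  exists K, 0 <= K /\ forall u v N, 0 < u + v -> p0 * (u + v) <= u -> p0 * (u + v) <= v ->
    Rabs (diag d u v N - c0 * exp (- al * ln (u / (u + v)) - ga * ln (v / (u + v))) * (u + v) ^ N)
      <= K * (u + v) ^ N / INR (S N).
Proof.
intros Ha Hg H0 [K HK].
assert (HK0 : 0 <= K).
{ specialize (HK O O); simpl INR in HK.
  pose proof (Rabs_pos (d O O - Binomial.C (0 + 0) 0 * psi al ga 0 0 * c0)) as P.
  assert (Q : 0 < Binomial.C (0 + 0) 0 * psi al ga 0 0)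
    by (apply Rmult_lt_0_compat; [apply C_pos | apply exp_pos]).
  rewrite Rinv_1 in HK; apply Rnot_lt_le; intros HK'; nra. }
set (E0 := exp (- (al + ga) * ln p0)).
assert (HE0 : 0 < E0) by apply exp_pos.
exists (E0 * (K * (16 / p0 ^ 2) + Rabs c0 * (2 / p0))); split.
{ apply Rmult_le_pos; [lra|]; apply Rplus_le_le_0_compat; apply Rmult_le_pos; auto using Rabs_pos.
  - apply Rdiv_le_0_compat; [lra | now apply pow_lt].
  - apply Rdiv_le_0_compat; lra. }
intros u v N Hs Hu Hv.
set (s := u + v) in *; set (p := u / s); set (q := v / s).
assert (Hp : p0 <= p) by now apply Rle_div_intro.
assert (Hq : p0 <= q) by now apply Rle_div_intro.
assert (Hpq : p + q = 1) by (unfold p, q, s in *; field; lra).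
assert (Hp' : 0 < p) by lra; assert (Hq' : 0 < q) by lra.
set (P := exp (- al * ln p - ga * ln q)).
assert (HP : 0 < P <= E0).
{ split; [apply exp_pos|]; apply exp_le_mono.
  assert (ln p0 <= ln p) by (apply ln_le; lra).
  assert (ln p0 <= ln q) by (apply ln_le; lra). nra. }
assert (ED : diag d u v N = s ^ N * bavg p q N (fun m n => d m n / Binomial.C (m + n) m)).
{ unfold diag, bavg; rewrite scal_sum; apply sum_eq; intros m Hm.
  replace (m + (N - m))%nat with N by lia.
  replace u with (s * p) by (unfold p; field; lra).
  replace v with (s * q) by (unfold q; field; lra).
  rewrite !Rpow_mult_distr.
  replace (s ^ N) with (s ^ m * s ^ (N - m)) by (rewrite <- pow_add; f_equal; lia).
  field; apply Rgt_not_eq, C_pos. }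
assert (Hsn : 0 < s ^ N) by now apply pow_lt.
replace (diag d u v N - c0 * P * s ^ N) with
  (s ^ N * (bavg p q N (fun m n => d m n / Binomial.C (m + n) m + (- (c0 * P)) * fpow al ga p q N m n)
    + (c0 * P) * (bavg p q N (fpow al ga p q N) - 1))).
2:{ rewrite ED, bavg_plus, bavg_scal; auto; ring. }
rewrite Rabs_mult, (Rabs_pos_eq (s ^ N)) by lra.
replace (E0 * (K * (16 / p0 ^ 2) + Rabs c0 * (2 / p0)) * s ^ N / INR (S N)) with
  (s ^ N * (E0 * (K * (16 / p0 ^ 2 / INR (S N))) + Rabs c0 * E0 * (2 / p0 / INR (S N))))
  by (field; pose proof (INR_S_pos N); lra).
apply Rmult_le_compat_l; [lra|].
eapply Rle_trans; [apply Rabs_triang|]; apply Rplus_le_compat.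
- eapply Rle_trans; [now apply bavg_abs|].
  apply Rle_trans with (bavg p q N (fun m n => (P * K) *
    (fpow al ga p q N m n * (/ INR (S m) + / INR (S n))))).
  + apply bavg_le; auto; intros m n E.
    specialize (HK m n); rewrite (psi_fpow al ga p q), E in HK by auto; fold P in HK; rewrite E.
    assert (HC := C_pos N m).
    replace (d m n / Binomial.C N m + - (c0 * P) * fpow al ga p q N m n) with
      ((d m n - Binomial.C N m * (P * fpow al ga p q N m n) * c0) / Binomial.C N m) by (field; lra).
    unfold Rdiv; rewrite Rabs_mult, (Rabs_pos_eq (/ _)) by (left; now apply Rinv_0_lt_compat).
    apply Rdiv_le_intro; auto; lra.
  + rewrite bavg_scal by auto.
    rewrite <- Rmult_assoc; apply Rmult_le_compat.
    * apply Rmult_le_pos; lra.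
    * rewrite <- (bavg_const p q Hpq N 0); apply bavg_le; auto; intros m n _.
      apply Rmult_le_pos; [left; apply exp_pos|].
      pose proof (Rinv_0_lt_compat _ (INR_S_pos m)); pose proof (Rinv_0_lt_compat _ (INR_S_pos n)); lra.
    * apply Rmult_le_compat_r; lra.
    * now apply bavg_fpow_inv.
- rewrite !Rabs_mult, (Rabs_pos_eq P) by lra.
  apply Rmult_le_compat; auto using Rabs_pos.
  + apply Rmult_le_pos; [apply Rabs_pos | lra].
  + apply Rmult_le_compat_l; [apply Rabs_pos | lra].
  + now apply bavg_fpow.
Qed.

(** * Asymptotics of the Appell series *)

(** The difference of the two sides vanishes at 0 and has derivative y^(n+1) / (1 - y) >= 0. *)
Lemma log_partial_sum x n : 0 <= x < 1 ->
  sum_f_R0 (fun k => x ^ S k / INR (S k)) n <= - ln (1 - x).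
Proof.
intros Hx.
set (F := fun y => - ln (1 - y) - sum_n (fun k => y ^ S k / INR (S k)) n).
set (F' := fun y => / (1 - y) - sum_n (fun k => y ^ k) n).
assert (HF : forall y, 0 <= y < 1 -> is_derive F y (F' y)).
{ intros y Hy; unfold F, F'.
  apply (is_derive_minus (fun y => - ln (1 - y)) (fun y => sum_n (fun k => y ^ S k / INR (S k)) n)).
  - auto_derive; [lra | field; lra].
  - apply (is_derive_sum_n (fun k y => y ^ S k / INR (S k)) n y (fun k => y ^ k)).
    intros k _; auto_derive; auto; simpl pred.
    change (match k with O => 1 | S _ => INR k + 1 end) with (INR (S k)).
    field; apply Rgt_not_eq, INR_S_pos. }
destruct (MVT_gen F 0 x F') as [c [Hc E]].
- intros y Hy; rewrite Rmin_left, Rmax_right in Hy by lra; apply HF; lra.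
- intros y Hy; rewrite Rmin_left, Rmax_right in Hy by lra.
  apply continuity_pt_filterlim, (ex_derive_continuous F); exists (F' y); apply HF; lra.
- rewrite Rmin_left, Rmax_right in Hc by lra.
  assert (F0 : F 0 = 0).
  { unfold F; rewrite Rminus_0_r, ln_1, sum_n_Reals.
    rewrite (sum_eq _ (fun _ => 0)); [rewrite sum_cte; ring|].
    intros k _; rewrite pow_i by lia; unfold Rdiv; ring. }
  assert (0 <= F' c).
  { unfold F'; rewrite sum_n_Reals, tech3 by lra.
    assert (0 <= c ^ S n) by (apply pow_le; lra).
    replace (/ (1 - c) - (1 - c ^ S n) / (1 - c)) with (c ^ S n / (1 - c)) by (field; lra).
    apply Rdiv_le_0_compat; lra. }
  assert (0 <= F x) by (rewrite F0 in E; nra).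
  unfold F in *; rewrite sum_n_Reals in *; lra.
Qed.

(** The exponent is chosen for x = r^2 / R2: the power -1/4 of r^2 is r^(-1/2), integrable along a
    curve. *)
Lemma neg_ln_le_power x : 0 < x <= 1 -> 1 - ln x <= 5 * Rpower x (- / 4).
Proof.
intros Hx; unfold Rpower.
assert (ln x <= 0) by (rewrite <- ln_1; apply ln_le; lra).
pose proof (exp_ineq1_le (- / 4 * ln x)); lra.
Qed.

Lemma log_series s : 0 <= s < 1 ->
  ex_series (fun N => s ^ N / INR (S N)) /\
  Series (fun N => s ^ N / INR (S N)) <= 5 * Rpower (1 - s) (- / 4).
Proof.
intros Hs.
assert (Hex : ex_series (fun N => s ^ N / INR (S N))).
{ apply ex_series_le_R with (fun N => s ^ N).
  - intros n; assert (0 <= s ^ n) by (apply pow_le; lra); pose proof (INR_S_pos n).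
    rewrite Rabs_pos_eq; [now apply div_S_le | apply Rdiv_le_0_compat; lra].
  - apply ex_series_geom; rewrite Rabs_pos_eq; lra. }
split; auto.
apply Rle_trans with (1 - ln (1 - s)).
2:{ apply neg_ln_le_power; lra. }
destruct Hex as [l Hl]; rewrite (is_series_unique _ _ Hl).
assert (Hlim : is_lim_seq (sum_n (fun N => s ^ N / INR (S N))) l) by exact Hl.
apply (is_lim_seq_le (sum_n (fun N => s ^ N / INR (S N))) (fun _ => 1 - ln (1 - s)) l (1 - ln (1 - s)));
  [|exact Hlim | apply is_lim_seq_const].
intros n; rewrite sum_n_Reals.
assert (L0 : 0 <= - ln (1 - s)).
{ assert (ln (1 - s) <= ln 1) by (apply ln_le; lra); rewrite ln_1 in *; lra. }
destruct n as [|n]; [simpl; lra|].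
rewrite decomp_sum by lia; simpl pred.
assert (L := log_partial_sum s n Hs).
assert (sum_f_R0 (fun i => s ^ S i / INR (S (S i))) n <= sum_f_R0 (fun k => s ^ S k / INR (S k)) n).
{ apply sum_Rle; intros k _; apply Rmult_le_compat_l; [apply pow_le; lra|].
  apply Rinv_le_contravar; [apply INR_S_pos | apply le_INR; lia]. }
simpl (s ^ 0); simpl (INR 1); lra.
Qed.

(** The leading terms of the diagonals form a geometric series, the source of 1 / (1 - s); the
    errors s^N / (N + 1) sum to a logarithm. *)
Lemma dser_asymptotics al ga c0 d p0 : 0 <= al <= 1 -> 0 <= ga <= 1 -> 0 < p0 ->
  regular_coef al ga c0 d ->
  exists K, 0 <= K /\ forall u v, 0 < u + v < 1 -> p0 * (u + v) <= u -> p0 * (u + v) <= v ->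
    Rabs (dser d u v - c0 * exp (- al * ln (u / (u + v)) - ga * ln (v / (u + v))) / (1 - (u + v)))
      <= K * Rpower (1 - (u + v)) (- / 4).
Proof.
intros Ha Hg H0 Hd.
destruct (diag_asymptotics al ga c0 d p0 Ha Hg H0 Hd) as [K [HK H]].
exists (5 * K); split; [lra|]; intros u v Huv Hu Hv.
set (s := u + v) in *.
set (B := c0 * exp (- al * ln (u / s) - ga * ln (v / s))).
assert (Hs : 0 <= s < 1) by lra.
destruct (log_series s Hs) as [Hex Hle].
assert (HexK : ex_series (fun N => K * (s ^ N / INR (S N)))) by now apply (ex_series_scal_l K (fun N => s ^ N / INR (S N))).
set (D := fun N => diag d u v N - B * s ^ N).
assert (HD : forall N, Rabs (D N) <= K * (s ^ N / INR (S N))).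
{ intros N; unfold D, B, s.
  eapply Rle_trans; [apply H; unfold s in *; lra|]; right; unfold Rdiv; ring. }
assert (exD : ex_series D) by now apply ex_series_le_R with (2 := HexK).
assert (Hg1 : Rabs s < 1) by (rewrite Rabs_pos_eq; lra).
assert (exG : ex_series (fun N => B * s ^ N)) by (apply (ex_series_scal_l B (fun N => s ^ N)), ex_series_geom; auto).
assert (E : dser d u v = Series D + B / (1 - s)).
{ unfold dser; rewrite (Series_ext (diag d u v) (fun N => D N + B * s ^ N)).
  - rewrite Series_plus, Series_scal_l, Series_geom; auto.
  - intros N; unfold D; ring. }
rewrite E; replace (Series D + B / (1 - s) - B / (1 - s)) with (Series D) by ring.
assert (exA : ex_series (fun N => Rabs (D N))).
{ apply ex_series_le_R with (2 := HexK); intros N; rewrite Rabs_Rabsolu; apply HD. }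
eapply Rle_trans; [now apply Series_Rabs|].
eapply Rle_trans; [apply (Series_le _ (fun N => K * (s ^ N / INR (S N)))); auto|].
{ intros N; split; [apply Rabs_pos | apply HD]. }
rewrite Series_scal_l; apply Rle_trans with (K * (5 * Rpower (1 - s) (- / 4))); [|lra].
now apply Rmult_le_compat_l.
Qed.

(** With ga = 1 - be, the coefficients of the transformed series in [F2]: both parameters satisfy c
    = 2 b, so c - b is b again. The expression is symmetric under the exchange of (al, m) with (ga,
    n). *)
Definition cF (al ga : R) (m n : nat) : R :=
  poch (al + ga) (m + n) * poch al m * poch ga n /
  (poch (2 * al) m * poch (2 * ga) n * INR (fact m) * INR (fact n)).

Lemma coefu_cF al ga m n : 0 < al -> 0 < ga ->
  coefu (cF al ga) m n = cF al ga m n * (al + ga + INR (m + n)) * ((al + INR m) / (2 * al + INR m)).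
Proof.
intros Ha Hg; unfold coefu, cF.
replace (S m + n)%nat with (S (m + n)) by lia.
simpl poch; rewrite fact_simpl, mult_INR.
pose proof (poch_pos (2 * al) m ltac:(lra)); pose proof (poch_pos (2 * ga) n ltac:(lra)).
pose proof (INR_S_pos m); pose proof (pos_INR m).
field; repeat split; try apply INR_fact_neq_0; lra.
Qed.

Lemma coefv_cF al ga m n : coefv (cF al ga) m n = coefu (cF ga al) n m.
Proof.
unfold coefv, coefu, cF; f_equal.
rewrite (Nat.add_comm (S n) m), (Rplus_comm ga al).
f_equal; ring.
Qed.

Lemma exp_rates X Y Z x y z : rate X x -> rate Y y -> rate Z z ->
  exists K, forall m n, Rabs (exp (X (m + n)%nat + Y m + Z n) - exp (x + y + z))
    <= K * (/ INR (S m) + / INR (S n)).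
Proof.
intros [A HA] [B HB] [D HD].
assert (A0 := rate_bound _ _ _ HA); assert (B0 := rate_bound _ _ _ HB); assert (D0 := rate_bound _ _ _ HD).
set (T := A + B + D).
exists (exp (x + y + z) * (T * exp T)); intros m n.
set (r := / INR (S m) + / INR (S n)).
assert (Hm := Rinv_0_lt_compat _ (INR_S_pos m)); assert (Hn := Rinv_0_lt_compat _ (INR_S_pos n)).
set (w := (X (m + n)%nat - x) + (Y m - y) + (Z n - z)).
assert (Hw : Rabs w <= T * r).
{ unfold w; eapply Rle_trans; [apply Rabs_triang|].
  assert (Rabs (X (m + n)%nat - x + (Y m - y)) <= Rabs (X (m + n)%nat - x) + Rabs (Y m - y)) by apply Rabs_triang.
  specialize (HA (m + n)%nat); specialize (HB m); specialize (HD n).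
  assert (/ INR (S (m + n)) <= / INR (S m)).
  { apply Rinv_le_contravar; [apply INR_S_pos | apply le_INR; lia]. }
  assert (A / INR (S (m + n)) <= A * r).
  { apply Rmult_le_compat_l; auto; unfold r; lra. }
  assert (B / INR (S m) <= B * r) by (apply Rmult_le_compat_l; auto; unfold r; lra).
  assert (D / INR (S n) <= D * r) by (apply Rmult_le_compat_l; auto; unfold r; lra).
  unfold T; lra. }
assert (Hw2 : Rabs w <= T).
{ unfold w; eapply Rle_trans; [apply Rabs_triang|].
  assert (Rabs (X (m + n)%nat - x + (Y m - y)) <= Rabs (X (m + n)%nat - x) + Rabs (Y m - y)) by apply Rabs_triang.
  specialize (HA (m + n)%nat); specialize (HB m); specialize (HD n).
  pose proof (div_S_le A (m + n) A0); pose proof (div_S_le B m B0); pose proof (div_S_le D n D0).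
  unfold T; lra. }
replace (X (m + n)%nat + Y m + Z n) with ((x + y + z) + w) by (unfold w; ring).
rewrite exp_plus; replace (exp (x + y + z) * exp w - exp (x + y + z)) with
  (exp (x + y + z) * (exp w - 1)) by ring.
rewrite Rabs_mult, (Rabs_pos_eq (exp _)) by (left; apply exp_pos).
rewrite Rmult_assoc; apply Rmult_le_compat_l; [left; apply exp_pos|].
eapply Rle_trans; [apply Rabs_exp_minus_1|].
replace (T * exp T * r) with (T * r * exp T) by ring.
apply Rmult_le_compat; auto using Rabs_pos, exp_le_mono; left; apply exp_pos.
Qed.

Definition c0F (al ga : R) : R :=
  Gamma (2 * al) * Gamma (2 * ga) / (Gamma al * Gamma ga * Gamma (al + ga)).

(** Every Pochhammer symbol is rewritten through [lnG]; the powers of m + 1, n + 1, m + n + 2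
    assemble into [psi], the factorials into the binomial coefficient, and the limits of [lnG] into
    [c0F]. *)
Lemma coefu_cF_regular al ga : 0 < al -> 0 < ga ->
  regular_coef al ga (c0F al ga) (coefu (cF al ga)).
Proof.
intros Ha Hg.
destruct (lnG_Gamma (al + ga) ltac:(lra)) as [Ga Ra].
destruct (lnG_Gamma al Ha) as [G1 R1]; destruct (lnG_Gamma ga Hg) as [G2 R2].
destruct (lnG_Gamma (2 * al) ltac:(lra)) as [G3 R3].
destruct (lnG_Gamma (2 * ga) ltac:(lra)) as [G4 R4].
(* The subtracted term replaces ln (N + 1), present in [lnG], by the ln (N + 2) of [psi]. *)
assert (RX : rate (fun N => lnG (al + ga) N + - ((al + ga) * (ln (INR (S (S N))) - ln (INR (S N)))))
   (- ln (Gamma (al + ga)) + - ((al + ga) * 0))).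
{ apply rate_plus; auto; apply rate_opp, rate_mult; [apply rate_const | apply ln_succ_rate]. }
assert (RY : rate (fun m => lnG al m + - lnG (2 * al) m) (- ln (Gamma al) + - - ln (Gamma (2 * al)))).
{ apply rate_plus; auto; now apply rate_opp. }
(* Differentiation in u raises the Pochhammer index in m only, whereas [lnG] has index n + 1 also in
   n; this ratio, which tends to 1, makes up for it. *)
assert (RL : rate (fun n => ln ((2 * ga + INR n) / (ga + INR n))) 0).
{ exists (1 + ga); intros n; rewrite Rminus_0_r; assert (Hn := pos_INR n).
  replace ((2 * ga + INR n) / (ga + INR n)) with (1 + ga / (ga + INR n)) by (field; lra).
  assert (P : 0 < ga / (ga + INR n)) by (apply Rdiv_lt_0_compat; lra).
  rewrite Rabs_pos_eq.
  - eapply Rle_trans; [apply ln_le_minus_1; lra|].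
    apply Rle_trans with (ga / (ga + INR n)); [lra|].
    apply Rdiv_le_intro; [lra|]; rewrite S_INR.
    replace ((1 + ga) / (INR n + 1) * (ga + INR n)) with ((1 + ga) * (ga + INR n) / (INR n + 1)) by (field; lra).
    apply Rle_div_intro; nra.
  - rewrite <- ln_1; apply ln_le; lra. }
assert (RZ : rate (fun n => (lnG ga n + - lnG (2 * ga) n) + ln ((2 * ga + INR n) / (ga + INR n)))
   ((- ln (Gamma ga) + - - ln (Gamma (2 * ga))) + 0)).
{ apply rate_plus; auto; apply rate_plus; auto; now apply rate_opp. }
destruct (exp_rates _ _ _ _ _ _ RX RY RZ) as [K HK].
exists K; intros m n; specialize (HK m n); cbv beta in HK.
replace (c0F al ga) with (exp (- ln (Gamma (al + ga)) + - ((al + ga) * 0) + (- ln (Gamma al) + - - ln (Gamma (2 * al)))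
   + (- ln (Gamma ga) + - - ln (Gamma (2 * ga)) + 0))).
2:{ rewrite Rmult_0_r, Ropp_0, !Ropp_involutive, !Rplus_0_r, !exp_plus, !exp_Ropp, !exp_ln by auto.
    unfold c0F; field; lra. }
set (Th := exp (lnG (al + ga) (m + n) + _ + _ + _)) in HK.
set (c0 := exp (- ln _ + _ + _ + _)) in *.
assert (E : coefu (cF al ga) m n = Binomial.C (m + n) m * psi al ga m n * Th).
{ unfold Th, psi, lnG, coefu, cF.
  assert (Hn := pos_INR n).
  assert (Hp := fun z k H => poch_pos z k H).
  assert (Hf := INR_fact_lt_0).
  rewrite (Rmult_assoc (Binomial.C _ _)), <- exp_plus.
  replace (ln ((2 * ga + INR n) / (ga + INR n))) with (ln (2 * ga + INR n) - ln (ga + INR n))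
    by (rewrite ln_div; lra).
  match goal with |- _ = _ * exp ?e => replace e with
    (ln (poch (al + ga) (S (m + n))) + - ln (INR (fact (m + n))) + (ln (poch al (S m)) + - ln (poch (2 * al) (S m)))
     + (ln (poch ga (S n)) + - ln (poch (2 * ga) (S n)) + (ln (2 * ga + INR n) + - ln (ga + INR n)))) by ring end.
  rewrite !exp_plus, !exp_Ropp, !exp_ln; try (apply Hp; lra); try apply Hf; try lra.
  rewrite C_sum_l; replace (S m + n)%nat with (S (m + n)) by lia.
  pose proof (Hp (2 * al) (S m) ltac:(lra)); pose proof (Hp (2 * ga) n ltac:(lra)).
  change (poch ga (S n)) with (poch ga n * (ga + INR n)).
  change (poch (2 * ga) (S n)) with (poch (2 * ga) n * (2 * ga + INR n)).
  rewrite (fact_simpl m), mult_INR.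
  pose proof (INR_S_pos m).
  field; repeat split; try apply INR_fact_neq_0; lra. }
rewrite E, <- Rmult_minus_distr_l, Rabs_mult, Rabs_pos_eq.
- replace (K * Binomial.C (m + n) m * psi al ga m n * (/ INR (S m) + / INR (S n))) with
    (Binomial.C (m + n) m * psi al ga m n * (K * (/ INR (S m) + / INR (S n)))) by ring.
  apply Rmult_le_compat_l; auto.
  apply Rmult_le_pos; left; [apply C_pos | apply exp_pos].
- apply Rmult_le_pos; left; [apply C_pos | apply exp_pos].
Qed.

Lemma C_add_sym m n : Binomial.C (m + n) m = Binomial.C (n + m) n.
Proof. rewrite !C_sum_l, (Nat.add_comm n m); f_equal; ring. Qed.

Lemma coefv_cF_regular al ga : 0 < al -> 0 < ga ->
  regular_coef al ga (c0F al ga) (coefv (cF al ga)).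
Proof.
intros Ha Hg; destruct (coefu_cF_regular ga al Hg Ha) as [K HK].
exists K; intros m n; specialize (HK n m).
assert (E : psi al ga m n = psi ga al n m).
{ unfold psi; rewrite (Nat.add_comm m n); f_equal; ring. }
assert (E2 : c0F al ga = c0F ga al).
{ unfold c0F; rewrite (Rplus_comm al ga); f_equal; ring. }
now rewrite coefv_cF, E, E2, C_add_sym, (Rplus_comm (/ INR (S m))).
Qed.

(** Taylor coefficients of (1 - z)^(-a). They majorise the double series because (al)_m <= (2 al)_m
    and likewise for ga. *)
Definition kapF (a : R) (N : nat) : R := poch a N / INR (fact N).

Lemma cF_pos al ga m n : 0 < al -> 0 < ga -> 0 < cF al ga m n.
Proof.
intros Ha Hg; unfold cF.
apply Rdiv_lt_0_compat; repeat apply Rmult_lt_0_compat;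
  try apply INR_fact_lt_0; apply poch_pos; lra.
Qed.

Lemma poch_le_double z n : 0 < z -> poch z n <= poch (2 * z) n.
Proof.
intros Hz; induction n; simpl; [lra|].
pose proof (pos_INR n); pose proof (poch_pos z n Hz).
apply Rmult_le_compat; lra.
Qed.

Lemma cF_dominated al ga : 0 < al -> 0 < ga -> dominated (kapF (al + ga)) (cF al ga).
Proof.
intros Ha Hg m n; rewrite Rabs_pos_eq by (left; now apply cF_pos).
rewrite C_sum_l; unfold cF, kapF.
assert (P1 := poch_pos (2 * al) m ltac:(lra)); assert (P2 := poch_pos (2 * ga) n ltac:(lra)).
assert (P3 := poch_pos (al + ga) (m + n) ltac:(lra)).
assert (Q1 := poch_le_double al m Ha); assert (Q2 := poch_le_double ga n Hg).
assert (P4 := poch_pos al m Ha); assert (P5 := poch_pos ga n Hg).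
assert (F1 := INR_fact_lt_0 m); assert (F2 := INR_fact_lt_0 n); assert (F3 := INR_fact_lt_0 (m + n)).
replace (poch (al + ga) (m + n) / INR (fact (m + n)) * (INR (fact (m + n)) / (INR (fact m) * INR (fact n))))
  with (poch (al + ga) (m + n) / (INR (fact m) * INR (fact n)) * 1) by (field; lra).
replace (poch (al + ga) (m + n) * poch al m * poch ga n / _) with
  (poch (al + ga) (m + n) / (INR (fact m) * INR (fact n)) * ((poch al m / poch (2 * al) m) * (poch ga n / poch (2 * ga) n)))
  by (field; lra).
apply Rmult_le_compat_l; [apply Rdiv_le_0_compat; [lra | nra]|].
replace 1 with (1 * 1) by ring.
apply Rmult_le_compat; try (apply Rdiv_le_0_compat; lra); apply Rdiv_le_intro; lra.
Qed.

Lemma kapF_radius a : 0 < a -> Rbar_le 1 (CV_radius (kapF a)).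
Proof.
intros Ha.
rewrite (CV_radius_finite_DAlembert (kapF a) 1).
- rewrite Rinv_1; simpl; lra.
- intros n; unfold kapF; apply Rgt_not_eq, Rdiv_lt_0_compat; [now apply poch_pos | apply INR_fact_lt_0].
- lra.
- assert (H : rate (fun n => 1 + (a - 1) / INR (S n)) (1 + 0)).
  { apply rate_plus; [apply rate_const|].
    exists (Rabs (a - 1)); intros n; rewrite Rminus_0_r; unfold Rdiv.
    rewrite Rabs_mult, (Rabs_pos_eq (/ _)); [lra|].
    left; apply Rinv_0_lt_compat, INR_S_pos. }
  apply rate_cv, is_lim_seq_Reals in H; rewrite Rplus_0_r in H.
  apply is_lim_seq_ext with (2 := H); intros n; unfold kapF.
  assert (P := poch_pos a n Ha); assert (F := INR_fact_lt_0 n); assert (Hn := INR_S_pos n).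
  assert (Hn0 := pos_INR n).
  rewrite fact_simpl, mult_INR; simpl poch.
  assert (E : (poch a n * (a + INR n) / (INR (S n) * INR (fact n))) / (poch a n / INR (fact n)) = 1 + (a - 1) / INR (S n)).
  { replace (INR n) with (INR (S n) - 1) by (rewrite S_INR; ring); field; lra. }
  rewrite E, Rabs_pos_eq; auto.
  rewrite <- E; apply Rdiv_le_0_compat.
  + apply Rdiv_le_0_compat; [apply Rmult_le_pos; lra | nra].
  + now apply Rdiv_lt_0_compat.
Qed.

Lemma mean_power_bound al ga p0 u v : 0 <= al -> 0 <= ga -> 0 < p0 -> 0 < u + v ->
  p0 * (u + v) <= u -> p0 * (u + v) <= v ->
  exp (- al * ln (u / (u + v)) - ga * ln (v / (u + v))) <= exp (- (al + ga) * ln p0).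
Proof.
intros Ha Hg H0 Hs Hu Hv; apply exp_le_mono.
assert (ln p0 <= ln (u / (u + v))) by (apply ln_le; [lra | now apply Rle_div_intro]).
assert (ln p0 <= ln (v / (u + v))) by (apply ln_le; [lra | now apply Rle_div_intro]).
nra.
Qed.

(** In degree N the derivative in u multiplies a coefficient by at least (al + ga + N) / 2, since
    (al + m) / (2 al + m) >= 1/2. The series itself is therefore one factor 1/N better than its
    derivative: logarithmic instead of 1 / (1 - s). *)
Lemma dser_cF_bound al ga p0 : 0 < al <= 1 -> 0 < ga <= 1 -> 0 < p0 ->
  exists K, 0 <= K /\ forall u v, 0 < u + v < 1 -> p0 * (u + v) <= u -> p0 * (u + v) <= v ->
    Rabs (dser (cF al ga) u v) <= K * Rpower (1 - (u + v)) (- / 4).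
Proof.
intros Ha Hg H0.
destruct (diag_asymptotics al ga (c0F al ga) (coefu (cF al ga)) p0) as [K [HK H]]; try lra.
{ apply coefu_cF_regular; lra. }
set (E0 := exp (- (al + ga) * ln p0)).
set (B := Rabs (c0F al ga) * E0 + K).
assert (HB : 0 <= B).
{ apply Rplus_le_le_0_compat; auto; apply Rmult_le_pos; [apply Rabs_pos | left; apply exp_pos]. }
set (D := 2 * B * (1 + / (al + ga))).
assert (Hi : 0 < / (al + ga)) by (apply Rinv_0_lt_compat; lra).
assert (HD : 0 <= D) by (unfold D; apply Rmult_le_pos; lra).
exists (5 * D); split; [lra|].
intros u v Hs Hu Hv.
assert (Hu0 : 0 <= u) by nra; assert (Hv0 : 0 <= v) by nra.
set (s := u + v) in *.
assert (bd : forall N, Rabs (diag (cF al ga) u v N) <= D * (s ^ N / INR (S N))).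
{ intros N.
  assert (HN := INR_S_pos N); assert (HN0 := pos_INR N).
  assert (Hsn : 0 <= s ^ N) by (apply pow_le; lra).
  rewrite Rabs_pos_eq.
  2:{ apply cond_pos_sum; intros m; apply Rmult_le_pos; [apply Rmult_le_pos|]; try (now apply pow_le).
      left; apply cF_pos; lra. }
  assert (A1 : diag (cF al ga) u v N <= 2 / (al + ga + INR N) * diag (coefu (cF al ga)) u v N).
  { unfold diag; rewrite scal_sum; apply sum_Rle; intros m Hm.
    replace (coefu (cF al ga) m (N - m) * u ^ m * v ^ (N - m) * (2 / (al + ga + INR N))) with
      (2 / (al + ga + INR N) * coefu (cF al ga) m (N - m) * u ^ m * v ^ (N - m)) by ring.
    do 2 (apply Rmult_le_compat_r; [now apply pow_le|]).
    rewrite coefu_cF by lra; replace (m + (N - m))%nat with N by lia.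
    assert (P := cF_pos al ga m (N - m) ltac:(lra) ltac:(lra)); assert (Hm0 := pos_INR m).
    replace (2 / (al + ga + INR N) * _) with (cF al ga m (N - m) * (2 * ((al + INR m) / (2 * al + INR m)))) by (field; lra).
    assert (/ 2 <= (al + INR m) / (2 * al + INR m)) by (apply Rle_div_intro; lra).
    rewrite <- (Rmult_1_r (cF al ga m (N - m))) at 1; apply Rmult_le_compat_l; lra. }
  assert (A2 : diag (coefu (cF al ga)) u v N <= B * s ^ N).
  { specialize (H u v N (proj1 Hs) Hu Hv); fold s in H.
    set (P := exp (- al * ln (u / s) - ga * ln (v / s))) in H.
    assert (HP : P <= E0) by (apply mean_power_bound; unfold s in *; lra).
    assert (HP0 : 0 < P) by apply exp_pos.
    apply Rabs_le_between in H.
    assert (K * s ^ N / INR (S N) <= K * s ^ N).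
    { apply div_S_le; now apply Rmult_le_pos. }
    assert (c0F al ga * P * s ^ N <= Rabs (c0F al ga) * E0 * s ^ N).
    { apply Rmult_le_compat_r; auto.
      apply Rle_trans with (Rabs (c0F al ga) * P).
      - apply Rmult_le_compat_r; [lra | apply Rle_abs].
      - apply Rmult_le_compat_l; [apply Rabs_pos | lra]. }
    unfold B; lra. }
  assert (A3 : 2 / (al + ga + INR N) <= 2 * (1 + / (al + ga)) / INR (S N)).
  { apply Rdiv_le_intro; [lra|]; rewrite S_INR.
    replace (2 * (1 + / (al + ga)) / (INR N + 1) * (al + ga + INR N)) with
      (2 * (1 + / (al + ga)) * (al + ga + INR N) / (INR N + 1)) by (field; lra).
    apply Rle_div_intro; [lra|].
    replace (2 * (1 + / (al + ga)) * (al + ga + INR N)) with (2 * (al + ga + INR N + 1 + INR N * / (al + ga)))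
      by (field; lra).
    assert (0 <= INR N * / (al + ga)) by (apply Rmult_le_pos; lra). lra. }
  assert (0 < 2 / (al + ga + INR N)) by (apply Rdiv_lt_0_compat; lra).
  eapply Rle_trans; [apply A1|].
  apply Rle_trans with (2 / (al + ga + INR N) * (B * s ^ N)); [apply Rmult_le_compat_l; lra|].
  apply Rle_trans with (2 * (1 + / (al + ga)) / INR (S N) * (B * s ^ N)).
  - apply Rmult_le_compat_r; auto; now apply Rmult_le_pos.
  - right; unfold D; field; lra. }
destruct (log_series s) as [Hex Hle]; [lra|].
assert (HexD : ex_series (fun N => D * (s ^ N / INR (S N))))
  by now apply (ex_series_scal_l D (fun N => s ^ N / INR (S N))).
unfold dser; eapply Rle_trans.
{ apply Series_Rabs; apply ex_series_le_R with (2 := HexD); intros N; rewrite Rabs_Rabsolu; apply bd. }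
eapply Rle_trans; [apply (Series_le _ (fun N => D * (s ^ N / INR (S N)))); auto|].
{ intros N; split; [apply Rabs_pos | apply bd]. }
rewrite Series_scal_l; apply Rle_trans with (D * (5 * Rpower (1 - s) (- / 4))); [|lra].
now apply Rmult_le_compat_l.
Qed.

(** * The kernel in closed form *)

Definition dist2 (x y x0 y0 : R) : R := (x - x0) ^ 2 + (y - y0) ^ 2.
Definition refl2 (x y x0 y0 : R) : R := (x + x0) ^ 2 + (y + y0) ^ 2.
Definition uvar (x y x0 y0 : R) : R := 4 * x * x0 / refl2 x y x0 y0.
Definition vvar (x y x0 y0 : R) : R := 4 * y * y0 / refl2 x y x0 y0.

Lemma refl2_pos x y x0 y0 : 0 < x -> 0 < y -> 0 < x0 -> 0 < y0 -> 0 < refl2 x y x0 y0.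
Proof. intros; unfold refl2; nra. Qed.

Lemma uv_sum x y x0 y0 : 0 < refl2 x y x0 y0 ->
  uvar x y x0 y0 + vvar x y x0 y0 = 1 - dist2 x y x0 y0 / refl2 x y x0 y0.
Proof.
intros H; unfold uvar, vvar.
replace (dist2 x y x0 y0) with (refl2 x y x0 y0 - 4 * x * x0 - 4 * y * y0)
  by (unfold dist2, refl2; ring).
field; lra.
Qed.

Lemma uv_abs_lt_1 x y x0 y0 : 0 < x -> 0 < y -> 0 < x0 -> 0 < y0 -> 0 < dist2 x y x0 y0 ->
  Rabs (uvar x y x0 y0) + Rabs (vvar x y x0 y0) < 1.
Proof.
intros Hx Hy Hx0 Hy0 Hr; assert (H := refl2_pos _ _ _ _ Hx Hy Hx0 Hy0).
rewrite !Rabs_pos_eq; try (apply Rdiv_le_0_compat; [nra | auto]).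
rewrite uv_sum by auto.
assert (0 < dist2 x y x0 y0 / refl2 x y x0 y0) by now apply Rdiv_lt_0_compat.
lra.
Qed.

Lemma F2series_dser al be u v : 0 < al -> 0 < 1 - be -> Rabs u + Rabs v < 1 ->
  F2series (1 + al - be) (2 * al - al) (2 - 2 * be - (1 - be)) (2 * al) (2 - 2 * be) u v
  = dser (cF al (1 - be)) u v.
Proof.
intros Ha Hb Huv; unfold F2series; apply lim_seq_eq.
assert (Hex : ex_series (diag (cF al (1 - be)) u v)).
{ apply ex_series_diag with (kapF (al + (1 - be))); auto using cF_dominated.
  apply kapF_radius; lra. }
apply Series_correct in Hex.
assert (Hl : is_lim_seq (sum_n (diag (cF al (1 - be)) u v)) (dser (cF al (1 - be)) u v)) by exact Hex.
apply is_lim_seq_Reals.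
apply is_lim_seq_ext with (2 := Hl); intros N; rewrite sum_n_Reals.
apply sum_eq; intros k _; unfold diag; apply sum_eq; intros m Hm; unfold F2term, cF.
replace (1 + al - be) with (al + (1 - be)) by ring.
replace (2 * al - al) with al by ring.
replace (2 - 2 * be - (1 - be)) with (1 - be) by ring.
now replace (2 - 2 * be) with (2 * (1 - be)) by ring.
Qed.

(** Here 1 - xi - eta = R2 / r^2, so the powers of r^2 in [q3] and in the transformation cancel; the
    singularity sits entirely in the series, at u + v = 1. *)
Lemma q3_series al be x y x0 y0 : 0 < al -> 0 < 1 - be ->
  0 < x -> 0 < y -> 0 < x0 -> 0 < y0 -> 0 < dist2 x y x0 y0 ->
  q3 al be x y x0 y0 = k3 al be * Rpower y0 (1 - 2 * be) *
    (Rpower y (1 - 2 * be) * Rpower (refl2 x y x0 y0) (- (1 + al - be)) *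
     dser (cF al (1 - be)) (uvar x y x0 y0) (vvar x y x0 y0)).
Proof.
intros Ha Hb Hx Hy Hx0 Hy0 Hr.
assert (HR := refl2_pos _ _ _ _ Hx Hy Hx0 Hy0).
rewrite <- F2series_dser by auto using uv_abs_lt_1.
unfold q3, F2; cbv zeta.
set (r2 := (x - x0) ^ 2 + (y - y0) ^ 2) in *.
assert (Hr2 : 0 < r2) by exact Hr.
assert (ER : refl2 x y x0 y0 = r2 + 4 * x * x0 + 4 * y * y0) by (unfold refl2, r2; ring).
set (xi := (r2 - ((x + x0) ^ 2 + (y - y0) ^ 2)) / r2).
set (eta := (r2 - ((x - x0) ^ 2 + (y + y0) ^ 2)) / r2).
assert (E1 : xi = - (4 * x * x0) / r2) by (unfold xi; f_equal; unfold r2; ring).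
assert (E2 : eta = - (4 * y * y0) / r2) by (unfold eta; f_equal; unfold r2; ring).
assert (E3 : 1 - xi - eta = refl2 x y x0 y0 / r2) by (rewrite E1, E2, ER; field; lra).
assert (E4 : xi / (xi + eta - 1) = uvar x y x0 y0).
{ replace (xi + eta - 1) with (- (refl2 x y x0 y0 / r2)) by (rewrite <- E3; ring).
  unfold uvar; rewrite E1; field; lra. }
assert (E5 : eta / (xi + eta - 1) = vvar x y x0 y0).
{ replace (xi + eta - 1) with (- (refl2 x y x0 y0 / r2)) by (rewrite <- E3; ring).
  unfold vvar; rewrite E2; field; lra. }
rewrite E3, E4, E5.
replace (Rpower (refl2 x y x0 y0) (- (1 + al - be))) with
  (Rpower r2 (- al + be - 1) * Rpower (refl2 x y x0 y0 / r2) (- (1 + al - be))); [ring|].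
replace (- al + be - 1) with (- (1 + al - be)) by ring.
rewrite Rpower_mult_distr; [|auto | now apply Rdiv_lt_0_compat].
f_equal; field; lra.
Qed.

Definition drefl2 (x y n1 n2 x0 y0 : R) : R := 2 * ((x + x0) * n1 + (y + y0) * n2).
Definition duvar (x y n1 n2 x0 y0 : R) : R :=
  (4 * x0 * n1 - uvar x y x0 y0 * drefl2 x y n1 n2 x0 y0) / refl2 x y x0 y0.
Definition dvvar (x y n1 n2 x0 y0 : R) : R :=
  (4 * y0 * n2 - vvar x y x0 y0 * drefl2 x y n1 n2 x0 y0) / refl2 x y x0 y0.

(** No power of y appears: y^(2 be) from the weight and y^(1 - 2 be) from [q3] multiply to y, which
    [kern] carries explicitly. *)
Definition pref (al be x y x0 y0 : R) : R :=
  k3 al be * Rpower y0 (1 - 2 * be) * Rpower x (2 * al) * Rpower (refl2 x y x0 y0) (- (1 + al - be)).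

(* Closed form of [x^(2 al) y^(2 be)] times the derivative of [q3] in the direction [(n1, n2)]. *)
Definition kern (al be x y n1 n2 x0 y0 : R) : R :=
  let u := uvar x y x0 y0 in let v := vvar x y x0 y0 in
  pref al be x y x0 y0 *
  (((1 - 2 * be) * n2 - (1 + al - be) * y * (drefl2 x y n1 n2 x0 y0 / refl2 x y x0 y0))
     * dser (cF al (1 - be)) u v
   + y * (dser (coefu (cF al (1 - be))) u v * duvar x y n1 n2 x0 y0
        + dser (coefv (cF al (1 - be))) u v * dvvar x y n1 n2 x0 y0)).

Lemma q3_directional_derivative al be x y n1 n2 x0 y0 : 0 < al -> 0 < 1 - be ->
  0 < x -> 0 < y -> 0 < x0 -> 0 < y0 -> 0 < dist2 x y x0 y0 ->
  exists D, derivable_pt_lim (fun h => q3 al be (x + h * n1) (y + h * n2) x0 y0) 0 D /\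
    Rpower x (2 * al) * Rpower y (2 * be) * D = kern al be x y n1 n2 x0 y0.
Proof.
intros Ha Hb Hx Hy Hx0 Hy0 Hr.
assert (HR := refl2_pos _ _ _ _ Hx Hy Hx0 Hy0).
set (xh := fun h => x + h * n1); set (yh := fun h => y + h * n2).
assert (Ex0 : xh 0 = x) by (unfold xh; ring); assert (Ey0 : yh 0 = y) by (unfold yh; ring).
assert (pos : forall G : R -> R, (forall h, ex_derive G h) -> 0 < G 0 -> locally 0 (fun h => 0 < G h)).
{ intros G HG H0.
  assert (C : continuous G 0) by (apply (ex_derive_continuous G); auto).
  apply (C (fun z => 0 < z)), open_gt; exact H0. }
assert (Lx : locally 0 (fun h => 0 < xh h)).
{ apply pos; [intros h; unfold xh; auto_derive; auto | now rewrite Ex0]. }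
assert (Ly : locally 0 (fun h => 0 < yh h)).
{ apply pos; [intros h; unfold yh; auto_derive; auto | now rewrite Ey0]. }
assert (Lr : locally 0 (fun h => 0 < dist2 (xh h) (yh h) x0 y0)).
{ apply (pos (fun h => dist2 (xh h) (yh h) x0 y0)); [intros h; unfold dist2, xh, yh; auto_derive; auto|].
  now rewrite Ex0, Ey0. }
set (U := fun h => uvar (xh h) (yh h) x0 y0); set (V := fun h => vvar (xh h) (yh h) x0 y0).
set (U' := fun h => duvar (xh h) (yh h) n1 n2 x0 y0); set (V' := fun h => dvvar (xh h) (yh h) n1 n2 x0 y0).
assert (LRp : locally 0 (fun h => 0 < refl2 (xh h) (yh h) x0 y0)).
{ apply filter_imp with (2 := filter_and _ _ Lx Ly); intros h [H1 H2]; now apply refl2_pos. }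
assert (LU : locally 0 (fun h => is_derive U h (U' h))).
{ apply filter_imp with (2 := LRp); intros h H; unfold U, U', duvar, drefl2, uvar, refl2 in *.
  unfold xh, yh in *; auto_derive; [simpl in *; lra | simpl in *; field; simpl; lra]. }
assert (LV : locally 0 (fun h => is_derive V h (V' h))).
{ apply filter_imp with (2 := LRp); intros h H; unfold V, V', dvvar, drefl2, vvar, refl2 in *.
  unfold xh, yh in *; auto_derive; [simpl in *; lra | simpl in *; field; simpl; lra]. }
assert (HR0 : 0 < refl2 (xh 0) (yh 0) x0 y0) by now rewrite Ex0, Ey0.
assert (CU : continuous U' 0).
{ apply (ex_derive_continuous U'); unfold U', duvar, drefl2, uvar, refl2 in *.
  unfold xh, yh in *; auto_derive; simpl in *; repeat split; lra. }
assert (CV : continuous V' 0).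
{ apply (ex_derive_continuous V'); unfold V', dvvar, drefl2, vvar, refl2 in *.
  unfold xh, yh in *; auto_derive; simpl in *; repeat split; lra. }
assert (Hs : Rabs (U 0) + Rabs (V 0) < 1).
{ unfold U, V; rewrite Ex0, Ey0; now apply uv_abs_lt_1. }
assert (HS := is_derive_dser (kapF (al + (1 - be))) (cF al (1 - be)) U V U' V' 0
  (kapF_radius (al + (1 - be)) ltac:(lra)) (cF_dominated _ _ Ha Hb) LU LV CU CV Hs).
set (A := fun h => Rpower (yh h) (1 - 2 * be) * Rpower (refl2 (xh h) (yh h) x0 y0) (- (1 + al - be))).
set (A' := Rpower y (1 - 2 * be) * Rpower (refl2 x y x0 y0) (- (1 + al - be)) *
   ((1 - 2 * be) * n2 / y - (1 + al - be) * drefl2 x y n1 n2 x0 y0 / refl2 x y x0 y0)).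
assert (HA : is_derive A 0 A').
{ unfold A, A', drefl2, Rpower, refl2 in *; rewrite Ex0, Ey0 in HR0.
  unfold xh, yh in *; auto_derive.
  - rewrite !Rmult_0_l, !Rplus_0_r; simpl in *; repeat split; lra.
  - rewrite !Rmult_0_l, !Rplus_0_r; simpl in *; field; simpl in *; lra. }
set (k0 := k3 al be * Rpower y0 (1 - 2 * be)).
assert (HP := is_derive_scal _ 0 k0 _ (is_derive_mult A (fun h => dser (cF al (1 - be)) (U h) (V h)) 0 _ _ HA HS
   ltac:(intros; apply Rmult_comm))).
eexists; split.
- apply is_derive_Reals.
  eapply is_derive_ext_loc; [|apply HP].
  apply filter_imp with (2 := filter_and _ _ Lx (filter_and _ _ Ly Lr)).
  intros h (H1 & H2 & H3); rewrite q3_series by auto; reflexivity.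
- change (Rpower x (2 * al) * Rpower y (2 * be) * (k0 * (A' * dser (cF al (1 - be)) (U 0) (V 0) + A 0 *
    (dser (coefu (cF al (1 - be))) (U 0) (V 0) * U' 0 + dser (coefv (cF al (1 - be))) (U 0) (V 0) * V' 0)))
    = kern al be x y n1 n2 x0 y0).
  unfold A, U, V, U', V', kern, pref, A', k0; rewrite Ex0, Ey0; cbv zeta.
  assert (Ey : Rpower y (2 * be) * Rpower y (1 - 2 * be) = y).
  { rewrite <- Rpower_plus; replace (2 * be + (1 - 2 * be)) with 1 by ring; now apply Rpower_1. }
  set (Y1 := Rpower y (2 * be)) in *; set (Y2 := Rpower y (1 - 2 * be)) in *.
  set (S0 := dser (cF al (1 - be)) _ _); set (S1 := dser (coefu _) _ _); set (S2 := dser (coefv _) _ _).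
  transitivity (k3 al be * Rpower y0 (1 - 2 * be) * Rpower x (2 * al) * Rpower (refl2 x y x0 y0) (- (1 + al - be)) *
    ((Y1 * Y2) * (((1 - 2 * be) * n2 / y - (1 + al - be) * drefl2 x y n1 n2 x0 y0 / refl2 x y x0 y0) * S0 +
     (S1 * duvar x y n1 n2 x0 y0 + S2 * dvvar x y n1 n2 x0 y0)))); [ring|].
  rewrite Ey; field; lra.
Qed.

(** * Bounds and asymptotics of the kernel *)

Lemma Rabs_mult_le a b A B : Rabs a <= A -> Rabs b <= B -> Rabs (a * b) <= A * B.
Proof. intros; rewrite Rabs_mult; apply Rmult_le_compat; auto using Rabs_pos. Qed.

Lemma Rabs_plus_le a b A B : Rabs a <= A -> Rabs b <= B -> Rabs (a + b) <= A + B.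
Proof. intros; eapply Rle_trans; [apply Rabs_triang | lra]. Qed.

Lemma Rabs_minus_le a b A B : Rabs a <= A -> Rabs b <= B -> Rabs (a - b) <= A + B.
Proof. intros; apply Rabs_plus_le; auto; now rewrite Rabs_Ropp. Qed.

Lemma Rabs_div_le a b A B : Rabs a <= A -> 0 < B -> B <= b -> Rabs (a / b) <= A / B.
Proof.
intros Ha HB Hb; apply Rabs_mult_le; auto.
rewrite Rabs_pos_eq; [now apply Rinv_le_contravar | left; apply Rinv_0_lt_compat; lra].
Qed.

Lemma Rpower_pos x y : 0 < Rpower x y.
Proof. apply exp_pos. Qed.

Lemma Rpower_opp_le x y e : 0 <= e -> 0 < x <= y -> Rpower y (- e) <= Rpower x (- e).
Proof.
intros He H; rewrite !Rpower_Ropp; apply Rinv_le_contravar; [apply Rpower_pos|].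
now apply Rle_Rpower_l.
Qed.

Section KernelBounds.
Variables (al be c M : R).
Hypotheses (Hal : 0 < 2 * al < 1) (Hbe : 0 < 2 * be < 1) (Hc : 0 < c) (HM : 0 < M).

Lemma refl2_box x y x0 y0 : 0 < x <= M -> 0 < y <= M -> c <= x0 <= M -> c <= y0 <= M ->
  c ^ 2 <= refl2 x y x0 y0 <= 8 * M ^ 2.
Proof. intros; unfold refl2; nra. Qed.

Lemma drefl2_box x y n1 n2 x0 y0 : 0 < x <= M -> 0 < y <= M -> c <= x0 <= M -> c <= y0 <= M ->
  Rabs n1 <= 1 -> Rabs n2 <= 1 -> Rabs (drefl2 x y n1 n2 x0 y0) <= 8 * M.
Proof.
intros Hx Hy Hx0 Hy0 H1 H2; unfold drefl2.
replace (8 * M) with (2 * ((M + M) * 1 + (M + M) * 1)) by ring.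
apply Rabs_mult_le; [rewrite Rabs_pos_eq; lra|].
apply Rabs_plus_le; apply Rabs_mult_le; auto; rewrite Rabs_pos_eq; lra.
Qed.

Lemma duv_box x y n1 n2 x0 y0 : 0 < x <= M -> 0 < y <= M -> c <= x0 <= M -> c <= y0 <= M ->
  Rabs n1 <= 1 -> Rabs n2 <= 1 -> 0 < dist2 x y x0 y0 ->
  Rabs (duvar x y n1 n2 x0 y0) <= 12 * M / c ^ 2 /\ Rabs (dvvar x y n1 n2 x0 y0) <= 12 * M / c ^ 2.
Proof.
intros Hx Hy Hx0 Hy0 H1 H2 Hr; unfold duvar, dvvar.
assert (HR := refl2_box x y x0 y0 Hx Hy Hx0 Hy0).
assert (Huv := uv_abs_lt_1 x y x0 y0 ltac:(lra) ltac:(lra) ltac:(lra) ltac:(lra) Hr).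
assert (Hd := drefl2_box x y n1 n2 x0 y0 Hx Hy Hx0 Hy0 H1 H2).
pose proof (Rabs_pos (uvar x y x0 y0)); pose proof (Rabs_pos (vvar x y x0 y0)).
assert (0 < c ^ 2) by now apply pow_lt.
replace (12 * M) with (4 * M * 1 + 1 * (8 * M)) by ring.
split; (apply Rabs_div_le; [|auto|lra]); apply Rabs_minus_le; apply Rabs_mult_le; try lra;
  rewrite Rabs_pos_eq; lra.
Qed.

Definition pref_max : R :=
  Rabs (k3 al be) * Rpower M (1 - 2 * be) * Rpower M (2 * al) * Rpower (c ^ 2) (- (1 + al - be)).

Lemma pref_box x y x0 y0 : 0 < x <= M -> 0 < y <= M -> c <= x0 <= M -> c <= y0 <= M ->
  Rabs (pref al be x y x0 y0) <= pref_max.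
Proof.
intros Hx Hy Hx0 Hy0; assert (HR := refl2_box x y x0 y0 Hx Hy Hx0 Hy0).
assert (0 < c ^ 2) by now apply pow_lt.
unfold pref, pref_max; repeat apply Rabs_mult_le.
- lra.
- rewrite Rabs_pos_eq by (left; apply Rpower_pos); apply Rle_Rpower_l; lra.
- rewrite Rabs_pos_eq by (left; apply Rpower_pos); apply Rle_Rpower_l; lra.
- rewrite Rabs_pos_eq by (left; apply Rpower_pos); apply Rpower_opp_le; lra.
Qed.

Lemma factor_box x y n1 n2 x0 y0 : 0 < x <= M -> 0 < y <= M -> c <= x0 <= M -> c <= y0 <= M ->
  Rabs n1 <= 1 -> Rabs n2 <= 1 ->
  Rabs ((1 - 2 * be) * n2 - (1 + al - be) * y * (drefl2 x y n1 n2 x0 y0 / refl2 x y x0 y0))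
    <= 1 * 1 + 2 * M * (8 * M / c ^ 2).
Proof.
intros Hx Hy Hx0 Hy0 H1 H2.
assert (HR := refl2_box x y x0 y0 Hx Hy Hx0 Hy0).
assert (Hd := drefl2_box x y n1 n2 x0 y0 Hx Hy Hx0 Hy0 H1 H2).
assert (0 < c ^ 2) by now apply pow_lt.
apply Rabs_minus_le; apply Rabs_mult_le; auto; try (rewrite Rabs_pos_eq; lra).
- apply Rabs_mult_le; rewrite Rabs_pos_eq; lra.
- apply Rabs_div_le; lra.
Qed.

(** The integration point (x, y) may approach the axes, which covers the ends of the curve. A
    distance from the target keeps u + v below [rho] < 1, where the three series are bounded by
    their majorants. *)
Lemma kern_bounded c1 : 0 < c1 -> exists B, 0 <= B /\ forall x y n1 n2 x0 y0,
  0 < x <= M -> 0 < y <= M -> c <= x0 <= M -> c <= y0 <= M ->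
  Rabs n1 <= 1 -> Rabs n2 <= 1 -> c1 <= dist2 x y x0 y0 ->
  Rabs (kern al be x y n1 n2 x0 y0) <= B.
Proof.
intros Hc1.
set (rho := 1 - c1 / (8 * M ^ 2)).
assert (HM2 : 0 < 8 * M ^ 2) by (assert (0 < M ^ 2) by (now apply pow_lt); lra).
assert (Hrho : rho < 1) by (unfold rho; assert (0 < c1 / (8 * M ^ 2)) by (now apply Rdiv_lt_0_compat); lra).
set (S0 := Rabs (PSeries (kapF (al + (1 - be))) rho)).
set (S1 := Rabs (PSeries (PS_derive (kapF (al + (1 - be)))) rho)).
assert (Hc2 : 0 < c ^ 2) by now apply pow_lt.
exists (pref_max * ((1 * 1 + 2 * M * (8 * M / c ^ 2)) * S0 + M * (S1 * (12 * M / c ^ 2) + S1 * (12 * M / c ^ 2)))).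
assert (Hi : 0 <= 12 * M / c ^ 2) by (apply Rdiv_le_0_compat; lra).
assert (Hi2 : 0 <= 8 * M / c ^ 2) by (apply Rdiv_le_0_compat; lra).
assert (P0 : 0 <= S0) by apply Rabs_pos; assert (P1 : 0 <= S1) by apply Rabs_pos.
split.
{ apply Rmult_le_pos.
  - unfold pref_max; repeat apply Rmult_le_pos; try (left; apply Rpower_pos); apply Rabs_pos.
  - assert (0 <= S1 * (12 * M / c ^ 2)) by now apply Rmult_le_pos.
    apply Rplus_le_le_0_compat; apply Rmult_le_pos; auto; try lra.
    assert (0 <= 2 * M * (8 * M / c ^ 2)) by (apply Rmult_le_pos; lra); lra. }
intros x y n1 n2 x0 y0 Hx Hy Hx0 Hy0 H1 H2 Hr.
assert (Hr0 : 0 < dist2 x y x0 y0) by lra.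
assert (HR := refl2_box x y x0 y0 Hx Hy Hx0 Hy0).
assert (Huv : Rabs (uvar x y x0 y0) + Rabs (vvar x y x0 y0) <= rho).
{ rewrite !Rabs_pos_eq; try (apply Rdiv_le_0_compat; [nra | lra]).
  rewrite uv_sum by lra; unfold rho.
  assert (c1 / (8 * M ^ 2) <= dist2 x y x0 y0 / refl2 x y x0 y0); [|lra].
  apply Rmult_le_compat; try lra; [left; now apply Rinv_0_lt_compat | apply Rinv_le_contravar; lra]. }
destruct (duv_box x y n1 n2 x0 y0) as [Hdu Hdv]; auto.
assert (HK : Rbar_le 1 (CV_radius (kapF (al + (1 - be))))) by (apply kapF_radius; lra).
assert (HD : dominated (kapF (al + (1 - be))) (cF al (1 - be))) by (apply cF_dominated; lra).
unfold kern; cbv zeta; apply Rabs_mult_le; [now apply pref_box|].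
apply Rabs_plus_le.
- apply Rabs_mult_le; [now apply factor_box|].
  eapply Rle_trans; [|apply Rle_abs]; now apply dser_bound.
- apply Rabs_mult_le; [rewrite Rabs_pos_eq; lra|].
  apply Rabs_plus_le; apply Rabs_mult_le; auto;
  (eapply Rle_trans; [|apply Rle_abs]); apply dser_bound; auto using CV_radius_PS_derive, coefu_dominated, coefv_dominated.
Qed.

Lemma Rabs_ln_diff x x0 : c <= x -> c <= x0 -> Rabs (ln x - ln x0) <= Rabs (x - x0) / c.
Proof.
assert (P : forall a b, c <= a -> c <= b -> ln a - ln b <= Rabs (a - b) / c).
{ intros a b Ha Hb; rewrite <- ln_div by lra.
  eapply Rle_trans; [apply ln_le_minus_1, Rdiv_lt_0_compat; lra|].
  replace (a / b - 1) with ((a - b) / b) by (field; lra).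
  eapply Rle_trans; [apply Rle_abs|]; apply Rabs_div_le; lra. }
intros Hx Hx0; apply Rabs_le; split.
- assert (H := P x0 x Hx0 Hx); rewrite Rabs_minus_sym in H; lra.
- now apply P.
Qed.

Lemma k3_c0F : k3 al be * c0F al (1 - be) = exp ((1 + al - be) * ln 4) / (4 * PI).
Proof.
unfold k3, c0F.
replace (2 - 2 * be) with (2 * (1 - be)) by ring.
replace (1 + al - be) with (al + (1 - be)) by ring.
destruct (lnG_Gamma al ltac:(lra)) as [G1 _].
destruct (lnG_Gamma (1 - be) ltac:(lra)) as [G2 _].
destruct (lnG_Gamma (2 * al) ltac:(lra)) as [G3 _].
destruct (lnG_Gamma (2 * (1 - be)) ltac:(lra)) as [G4 _].
destruct (lnG_Gamma (al + (1 - be)) ltac:(lra)) as [G5 _].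
replace (Rpower 2 (2 + 2 * al - 2 * be)) with (exp ((al + (1 - be)) * ln 4)).
- field; pose proof PI_RGT_0; repeat split; lra.
- unfold Rpower; f_equal; replace 4 with (2 * 2) by ring; rewrite ln_mult by lra; ring.
Qed.

(** Logarithm of the exact leading coefficient relative to 1 / (2 pi); it vanishes when the two
    points coincide, as then u + v = 1. *)
Definition logdefect (x y x0 y0 : R) : R :=
  al * (ln x - ln x0) + be * (ln y - ln y0)
  + (1 + al - be) * ln (uvar x y x0 y0 + vvar x y x0 y0).

Lemma main_coefficient x y x0 y0 : 0 < x -> 0 < y -> 0 < x0 -> 0 < y0 ->
  let u := uvar x y x0 y0 in let v := vvar x y x0 y0 in
  2 * pref al be x y x0 y0 * y *
    (c0F al (1 - be) * exp (- al * ln (u / (u + v)) - (1 - be) * ln (v / (u + v))))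
  = / (2 * PI) * exp (logdefect x y x0 y0).
Proof.
intros Hx Hy Hx0 Hy0 u v.
assert (HR := refl2_pos _ _ _ _ Hx Hy Hx0 Hy0).
assert (HT : 0 < x * x0 + y * y0) by nra.
assert (Es : u + v = 4 * (x * x0 + y * y0) / refl2 x y x0 y0) by (unfold u, v, uvar, vvar; field; lra).
assert (Ep : u / (u + v) = x * x0 / (x * x0 + y * y0)) by (rewrite Es; unfold u, uvar; field; lra).
assert (Eq : v / (u + v) = y * y0 / (x * x0 + y * y0)) by (rewrite Es; unfold v, vvar; field; lra).
unfold logdefect; fold u v; rewrite Ep, Eq, Es; unfold pref.
set (T := x * x0 + y * y0) in *; set (R2 := refl2 x y x0 y0) in *.
rewrite !ln_div, !ln_mult by (auto; nra); unfold Rpower.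
transitivity (2 * (k3 al be * c0F al (1 - be)) * (exp ((1 - 2 * be) * ln y0) * exp (2 * al * ln x) * exp (- (1 + al - be) * ln R2) *
  y * exp (- al * (ln x + ln x0 - ln T) - (1 - be) * (ln y + ln y0 - ln T)))); [ring|].
rewrite k3_c0F.
rewrite <- (exp_ln y) at 1 by auto.
replace (2 * (exp ((1 + al - be) * ln 4) / (4 * PI))) with (/ (2 * PI) * exp ((1 + al - be) * ln 4))
  by (field; pose proof PI_RGT_0; lra).
rewrite Rmult_assoc, <- !exp_plus; f_equal; f_equal; ring.
Qed.

(** Order r is what is needed to compensate n.(x - x0) / r^2 = O(1/r). The term ln (u + v) is even
    quadratic: 1 / (u + v) - 1 = r^2 / (4 (x x0 + y y0)). *)
Lemma logdefect_bound x y x0 y0 : c <= x <= M -> c <= y <= M -> c <= x0 <= M -> c <= y0 <= M ->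
  0 < dist2 x y x0 y0 ->
  Rabs (logdefect x y x0 y0) <= (2 / c + 4 * M / c ^ 2) * sqrt (dist2 x y x0 y0).
Proof.
intros Hx Hy Hx0 Hy0 Hr.
assert (HR := refl2_box x y x0 y0 ltac:(lra) ltac:(lra) Hx0 Hy0).
assert (Hc2 : 0 < c ^ 2) by now apply pow_lt.
set (d := sqrt (dist2 x y x0 y0)).
assert (Hd : 0 < d) by now apply sqrt_lt_R0.
assert (Hdd : d * d = dist2 x y x0 y0) by (apply sqrt_sqrt; lra).
assert (D1 : Rabs (x - x0) <= d).
{ rewrite <- (Rabs_pos_eq d) by lra; apply Rsqr_le_abs_0; unfold Rsqr.
  rewrite Hdd; unfold dist2; pose proof (pow2_ge_0 (y - y0)); pose proof (pow2_ge_0 (x - x0)); lra. }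
assert (D2 : Rabs (y - y0) <= d).
{ rewrite <- (Rabs_pos_eq d) by lra; apply Rsqr_le_abs_0; unfold Rsqr.
  rewrite Hdd; unfold dist2; pose proof (pow2_ge_0 (y - y0)); pose proof (pow2_ge_0 (x - x0)); lra. }
assert (L1 := Rabs_ln_diff x x0 ltac:(lra) ltac:(lra)).
assert (L2 := Rabs_ln_diff y y0 ltac:(lra) ltac:(lra)).
assert (Es : uvar x y x0 y0 + vvar x y x0 y0 = 4 * (x * x0 + y * y0) / refl2 x y x0 y0)
  by (unfold uvar, vvar; field; lra).
assert (HT : c ^ 2 <= x * x0 + y * y0) by nra.
set (s := uvar x y x0 y0 + vvar x y x0 y0) in *.
assert (Hs0 : 0 < s) by (rewrite Es; apply Rdiv_lt_0_compat; lra).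
assert (Hs1 : s < 1).
{ unfold s; rewrite uv_sum by lra.
  assert (0 < dist2 x y x0 y0 / refl2 x y x0 y0) by (apply Rdiv_lt_0_compat; lra); lra. }
assert (L3 : Rabs (ln s) <= (2 * M / c ^ 2) * d).
{ rewrite Rabs_left by (rewrite <- ln_1; apply ln_increasing; lra).
  rewrite <- ln_Rinv by auto.
  eapply Rle_trans; [apply ln_le_minus_1, Rinv_0_lt_compat; auto|].
  replace (/ s - 1) with (dist2 x y x0 y0 / (4 * (x * x0 + y * y0))).
  - rewrite <- Hdd; apply Rdiv_le_intro; [lra|].
    assert (d <= 2 * M).
    { apply Rsqr_incr_0_var; [|lra]; unfold Rsqr; rewrite Hdd; unfold dist2; nra. }
    replace (2 * M / c ^ 2 * d * (4 * (x * x0 + y * y0))) with (d * (2 * M * (4 * ((x * x0 + y * y0) / c ^ 2)))) by (field; lra).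
    apply Rmult_le_compat_l; [lra|].
    assert (1 <= (x * x0 + y * y0) / c ^ 2) by (apply Rle_div_intro; lra).
    nra.
  - rewrite Es; unfold dist2 in *; unfold refl2 in *; field; nra. }
unfold logdefect; fold s.
replace ((2 / c + 4 * M / c ^ 2) * d) with (1 * (d / c) + 1 * (d / c) + 2 * (2 * M / c ^ 2 * d)) by (field; lra).
assert (Hdc : forall z, z <= d -> z / c <= d / c).
{ intros z Hz; apply Rmult_le_compat_r; auto; left; now apply Rinv_0_lt_compat. }
apply Rabs_plus_le; [apply Rabs_plus_le|]; apply Rabs_mult_le; auto; try (rewrite Rabs_pos_eq; lra);
  (eapply Rle_trans; [eassumption|]); auto.
Qed.
Lemma kern_asymptotics : exists K, 0 <= K /\ forall x y n1 n2 x0 y0,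
  c <= x <= M -> c <= y <= M -> c <= x0 <= M -> c <= y0 <= M ->
  Rabs n1 <= 1 -> Rabs n2 <= 1 -> 0 < dist2 x y x0 y0 ->
  Rabs (kern al be x y n1 n2 x0 y0
        + / (2 * PI) * ((n1 * (x - x0) + n2 * (y - y0)) / dist2 x y x0 y0))
    <= K * Rpower (dist2 x y x0 y0) (- / 4).
Proof.
assert (Hc2 : 0 < c ^ 2) by now apply pow_lt.
assert (HM2 : 0 < M ^ 2) by now apply pow_lt.
(* A lower bound of p = x x0 / (x x0 + y y0) and of q on the box. *)
set (p0 := c ^ 2 / (2 * M ^ 2)).
assert (Hp0 : 0 < p0) by (apply Rdiv_lt_0_compat; lra).
destruct (dser_cF_bound al (1 - be) p0) as [K0 [HK0 B0]]; try lra.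
destruct (dser_asymptotics al (1 - be) (c0F al (1 - be)) (coefu (cF al (1 - be))) p0) as [K1 [HK1 B1]]; try lra.
{ apply coefu_cF_regular; lra. }
destruct (dser_asymptotics al (1 - be) (c0F al (1 - be)) (coefv (cF al (1 - be))) p0) as [K2 [HK2 B2]]; try lra.
{ apply coefv_cF_regular; lra. }
set (E0 := exp (- (al + (1 - be)) * ln p0)).
set (Fm := 1 * 1 + 2 * M * (8 * M / c ^ 2)).
set (D := 12 * M / c ^ 2).
set (Cw := 2 / c + 4 * M / c ^ 2).
(* Since R2 <= 8 M^2, this factor converts the power -1/4 of r^2 / R2 into that of r^2. *)
set (W := Rpower (8 * M ^ 2) (/ 4)).
set (Q1 := pref_max * (Fm * K0 + M * (K1 * D + K2 * D) + M * (Rabs (c0F al (1 - be)) * E0) * (8 * M / c ^ 2))).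
set (Q2 := / (2 * PI) * ((Cw * exp (Cw * (2 * M))) * 2)).
assert (HPI := PI_RGT_0).
assert (Hi : 0 <= 8 * M / c ^ 2) by (apply Rdiv_le_0_compat; lra).
assert (HD : 0 <= D) by (apply Rdiv_le_0_compat; lra).
assert (HE0 : 0 < E0) by apply exp_pos.
assert (HCw : 0 < Cw).
{ apply Rplus_lt_0_compat; apply Rdiv_lt_0_compat; lra. }
assert (HFm : 0 <= Fm) by (unfold Fm; assert (0 <= 2 * M * (8 * M / c ^ 2)) by (apply Rmult_le_pos; lra); lra).
assert (Hpm : 0 <= pref_max)
  by (unfold pref_max; repeat apply Rmult_le_pos; try (left; apply Rpower_pos); apply Rabs_pos).
assert (HT : 0 <= M * (Rabs (c0F al (1 - be)) * E0) * (8 * M / c ^ 2)).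
{ apply Rmult_le_pos; auto; apply Rmult_le_pos; [lra|]; apply Rmult_le_pos; [apply Rabs_pos | lra]. }
assert (HQ1 : 0 <= Q1).
{ assert (0 <= M * (K1 * D + K2 * D)).
  { apply Rmult_le_pos; [lra | apply Rplus_le_le_0_compat; now apply Rmult_le_pos]. }
  assert (0 <= Fm * K0) by now apply Rmult_le_pos.
  apply Rmult_le_pos; [auto | lra]. }
assert (HQ2 : 0 <= Q2).
{ unfold Q2; apply Rmult_le_pos; [left; apply Rinv_0_lt_compat; lra|].
  pose proof (exp_pos (Cw * (2 * M))); nra. }
assert (HW : 0 < W) by apply Rpower_pos.
exists ((Q1 + Q2) * W); split; [apply Rmult_le_pos; lra|].
intros x y n1 n2 x0 y0 Hx Hy Hx0 Hy0 H1 H2 Hr.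
assert (HR := refl2_box x y x0 y0 ltac:(lra) ltac:(lra) Hx0 Hy0).
set (r2 := dist2 x y x0 y0) in *; set (R2 := refl2 x y x0 y0) in *.
assert (Huv := uv_sum x y x0 y0 ltac:(fold R2; lra)); fold r2 R2 in Huv.
assert (Hq : 0 < r2 / R2) by (apply Rdiv_lt_0_compat; lra).
set (u := uvar x y x0 y0) in *; set (v := vvar x y x0 y0) in *.
assert (Hbox : forall z z', c <= z <= M -> c <= z' <= M -> c ^ 2 <= z * z' <= M ^ 2).
{ intros z z' Hz Hz'; rewrite <- !Rsqr_pow2; split; apply Rmult_le_compat; lra. }
assert (Hxx := Hbox x x0 Hx Hx0); assert (Hyy := Hbox y y0 Hy Hy0).
assert (Eu : u = 4 * (x * x0) / R2) by (unfold u, uvar, R2; f_equal; ring).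
assert (Ev : v = 4 * (y * y0) / R2) by (unfold v, vvar, R2; f_equal; ring).
assert (Hs : 0 < u + v < 1).
{ split; [|lra]; rewrite Eu, Ev; apply Rplus_lt_0_compat; apply Rdiv_lt_0_compat; lra. }
assert (Hcone : p0 * (x * x0 + y * y0) <= c ^ 2).
{ unfold p0; apply Rle_trans with (c ^ 2 / (2 * M ^ 2) * (2 * M ^ 2)).
  - apply Rmult_le_compat_l; [left; exact Hp0 | lra].
  - right; field; lra. }
assert (Hu : p0 * (u + v) <= u).
{ rewrite Eu, Ev; replace (p0 * (4 * (x * x0) / R2 + 4 * (y * y0) / R2)) with
    (4 * (p0 * (x * x0 + y * y0)) / R2) by (field; lra).
  apply Rmult_le_compat_r; [left; apply Rinv_0_lt_compat; lra | lra]. }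
assert (Hv : p0 * (u + v) <= v).
{ rewrite Eu, Ev; replace (p0 * (4 * (x * x0) / R2 + 4 * (y * y0) / R2)) with
    (4 * (p0 * (x * x0 + y * y0)) / R2) by (field; lra).
  apply Rmult_le_compat_r; [left; apply Rinv_0_lt_compat; lra | lra]. }
specialize (B0 u v Hs Hu Hv); specialize (B1 u v Hs Hu Hv); specialize (B2 u v Hs Hu Hv).
assert (HP := mean_power_bound al (1 - be) p0 u v ltac:(lra) ltac:(lra) Hp0 (proj1 Hs) Hu Hv); fold E0 in HP.
assert (Emain := main_coefficient x y x0 y0 ltac:(lra) ltac:(lra) ltac:(lra) ltac:(lra)); cbv zeta in Emain.
fold u v in Emain.
set (P := exp (- al * ln (u / (u + v)) - (1 - be) * ln (v / (u + v)))) in *.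
assert (HP0 : 0 < P) by apply exp_pos.
replace (1 - (u + v)) with (r2 / R2) in B0, B1, B2 by lra.
set (La := Rpower (r2 / R2) (- / 4)) in *.
assert (HLa1 : 1 <= La).
{ unfold La, Rpower; rewrite <- exp_0; apply exp_le_mono.
  assert (ln (r2 / R2) <= 0) by (rewrite <- ln_1; apply ln_le; lra); lra. }
assert (HLaW : La <= W * Rpower r2 (- / 4)).
{ unfold La, Rdiv; rewrite <- Rpower_mult_distr; [|auto | apply Rinv_0_lt_compat; lra].
  rewrite Rmult_comm; apply Rmult_le_compat_r; [left; apply Rpower_pos|].
  replace (Rpower (/ R2) (- / 4)) with (Rpower R2 (/ 4)).
  - apply Rle_Rpower_l; lra.
  - unfold Rpower; rewrite ln_Rinv by lra; f_equal; ring. }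
set (S0 := dser (cF al (1 - be)) u v) in *.
set (Su := dser (coefu (cF al (1 - be))) u v) in *; set (Sv := dser (coefv (cF al (1 - be))) u v) in *.
set (m := c0F al (1 - be) * P) in *.
(* The same leading part is removed from both partials, so that it multiplies only the sum
   [du + dv]. *)
set (eu := Su - m / (r2 / R2)) in *; set (ev := Sv - m / (r2 / R2)) in *.
destruct (duv_box x y n1 n2 x0 y0) as [Hdu Hdv]; auto; try lra; fold D in Hdu, Hdv.
set (du := duvar x y n1 n2 x0 y0) in *; set (dv := dvvar x y n1 n2 x0 y0) in *.
assert (HdR := drefl2_box x y n1 n2 x0 y0 ltac:(lra) ltac:(lra) Hx0 Hy0 H1 H2).
set (dR := drefl2 x y n1 n2 x0 y0) in *.
set (nd := n1 * (x - x0) + n2 * (y - y0)).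
(* As u + v = 1 - r^2 / R2, this quotient is minus the logarithmic derivative of r^2 / R2; it splits
   into the singular term and a bounded one. *)
assert (Eduv : (du + dv) / (r2 / R2) = - 2 * (nd / r2) + dR / R2).
{ unfold du, dv, duvar, dvvar; fold u v R2 dR.
  replace ((4 * x0 * n1 - u * dR) / R2 + (4 * y0 * n2 - v * dR) / R2) with
    ((4 * x0 * n1 + 4 * y0 * n2 - (u + v) * dR) / R2) by (field; lra).
  rewrite Huv; unfold nd, dR, drefl2; field; lra. }
set (Fa := (1 - 2 * be) * n2 - (1 + al - be) * y * (dR / R2)).
assert (HFa : Rabs Fa <= Fm) by (apply factor_box; auto; lra).
assert (Hpf := pref_box x y x0 y0 ltac:(lra) ltac:(lra) Hx0 Hy0).
set (pf := pref al be x y x0 y0) in *.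
assert (Ek : kern al be x y n1 n2 x0 y0 =
  pf * (Fa * S0 + y * (eu * du + ev * dv) + y * m * (dR / R2)) - (2 * pf * y * m) * (nd / r2)).
{ unfold kern; cbv zeta; fold u v pf S0 Su Sv du dv dR R2 Fa.
  replace Su with (m / (r2 / R2) + eu) by (unfold eu; ring).
  replace Sv with (m / (r2 / R2) + ev) by (unfold ev; ring).
  replace ((m / (r2 / R2) + eu) * du + (m / (r2 / R2) + ev) * dv) with
    (m * ((du + dv) / (r2 / R2)) + (eu * du + ev * dv)) by (field; lra).
  rewrite Eduv; ring. }
rewrite Ek, Emain.
(* What the exact coefficient adds to 1 / (2 pi) is (exp w - 1) nd / r^2, bounded because w is O(r)
   and nd / r^2 is O(1/r). *)
set (w := logdefect x y x0 y0).
replace (_ - / (2 * PI) * exp w * (nd / r2) + / (2 * PI) * (nd / r2)) with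
  (pf * (Fa * S0 + y * (eu * du + ev * dv) + y * m * (dR / R2)) - / (2 * PI) * ((exp w - 1) * (nd / r2))) by ring.
apply Rle_trans with ((Q1 + Q2) * La).
2:{ rewrite Rmult_assoc; apply Rmult_le_compat_l; lra. }
rewrite Rmult_plus_distr_r; apply Rabs_minus_le.
- replace (Q1 * La) with (pref_max * (Fm * (K0 * La) + M * (K1 * La * D + K2 * La * D)
    + M * (Rabs (c0F al (1 - be)) * E0) * (8 * M / c ^ 2) * La)) by (unfold Q1; ring).
  apply Rabs_mult_le; auto; apply Rabs_plus_le; [apply Rabs_plus_le|].
  + now apply Rabs_mult_le.
  + apply Rabs_mult_le; [rewrite Rabs_pos_eq; lra|].
    apply Rabs_plus_le; now apply Rabs_mult_le.
  + apply Rle_trans with (M * (Rabs (c0F al (1 - be)) * E0) * (8 * M / c ^ 2) * 1).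
    * rewrite Rmult_1_r; apply Rabs_mult_le; [apply Rabs_mult_le; [rewrite Rabs_pos_eq; lra|]|apply Rabs_div_le; lra].
      unfold m; apply Rabs_mult_le; [lra | rewrite Rabs_pos_eq; lra].
    * now apply Rmult_le_compat_l.
- apply Rle_trans with (Q2 * 1).
  2:{ apply Rmult_le_compat_l; lra. }
  rewrite Rmult_1_r; unfold Q2; apply Rabs_mult_le.
  { rewrite Rabs_pos_eq; [lra | left; apply Rinv_0_lt_compat; lra]. }
  assert (Hw := logdefect_bound x y x0 y0 Hx Hy Hx0 Hy0 Hr); fold w Cw r2 in Hw.
  set (d := sqrt r2) in *.
  assert (Hd : 0 < d) by now apply sqrt_lt_R0.
  assert (Hdd : d * d = r2) by (apply sqrt_sqrt; lra).
  assert (Hsq := pow2_ge_0 (y - y0)); assert (Hsq' := pow2_ge_0 (x - x0)).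
  assert (D1 : Rabs (x - x0) <= d).
  { rewrite <- (Rabs_pos_eq d) by lra; apply Rsqr_le_abs_0; unfold Rsqr.
    rewrite Hdd; unfold r2, dist2; lra. }
  assert (D2 : Rabs (y - y0) <= d).
  { rewrite <- (Rabs_pos_eq d) by lra; apply Rsqr_le_abs_0; unfold Rsqr.
    rewrite Hdd; unfold r2, dist2; lra. }
  assert (HdM : d <= 2 * M).
  { apply Rsqr_incr_0_var; [|lra]; unfold Rsqr; rewrite Hdd; unfold r2, dist2; nra. }
  assert (Hnd : Rabs nd <= 2 * d).
  { replace (2 * d) with (1 * d + 1 * d) by ring; apply Rabs_plus_le; now apply Rabs_mult_le. }
  replace (Cw * exp (Cw * (2 * M)) * 2) with ((Cw * d * exp (Cw * (2 * M))) * (2 * d / r2))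
    by (rewrite <- Hdd; field; lra).
  apply Rabs_mult_le; [|apply Rabs_div_le; lra].
  eapply Rle_trans; [apply Rabs_exp_minus_1|].
  apply Rmult_le_compat; auto using Rabs_pos; [left; apply exp_pos|].
  apply exp_le_mono; eapply Rle_trans; [apply Hw|]; apply Rmult_le_compat_l; lra.
Qed.

End KernelBounds.

(** * Limits along filters and joint continuity of the kernel *)

Section Limits.
Context {T : Type} {F : (T -> Prop) -> Prop} {FF : Filter F}.
Implicit Types f g : T -> R.

Lemma lim_plus f g a b : filterlim f F (locally a) -> filterlim g F (locally b) ->
  filterlim (fun t => f t + g t) F (locally (a + b)).
Proof. intros Hf Hg; exact (filterlim_comp_2 _ _ Rplus Hf Hg (filterlim_plus a b)). Qed.

Lemma lim_mult f g a b : filterlim f F (locally a) -> filterlim g F (locally b) ->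
  filterlim (fun t => f t * g t) F (locally (a * b)).
Proof. intros Hf Hg; exact (filterlim_comp_2 _ _ Rmult Hf Hg (filterlim_mult a b)). Qed.

Lemma lim_opp f a : filterlim f F (locally a) -> filterlim (fun t => - f t) F (locally (- a)).
Proof. intros Hf; exact (filterlim_comp _ _ _ _ _ _ _ _ Hf (filterlim_opp a)). Qed.

Lemma lim_const (a : R) : filterlim (fun _ : T => a) F (locally a).
Proof. apply filterlim_const. Qed.

Lemma lim_minus f g a b : filterlim f F (locally a) -> filterlim g F (locally b) ->
  filterlim (fun t => f t - g t) F (locally (a - b)).
Proof. intros Hf Hg; apply lim_plus; auto; now apply lim_opp. Qed.

Lemma lim_comp (h : R -> R) f a : continuous h a -> filterlim f F (locally a) ->
  filterlim (fun t => h (f t)) F (locally (h a)).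
Proof. intros Hh Hf; exact (filterlim_comp _ _ _ _ _ _ _ _ Hf Hh). Qed.

Lemma lim_inv f a : a <> 0 -> filterlim f F (locally a) ->
  filterlim (fun t => / f t) F (locally (/ a)).
Proof.
intros Ha; apply (lim_comp Rinv).
apply (ex_derive_continuous Rinv); exists (- / a ^ 2); auto_derive; auto; field; auto.
Qed.

Lemma lim_div f g a b : b <> 0 -> filterlim f F (locally a) -> filterlim g F (locally b) ->
  filterlim (fun t => f t / g t) F (locally (a / b)).
Proof. intros Hb Hf Hg; apply lim_mult; auto; now apply lim_inv. Qed.

Lemma lim_pow f a n : filterlim f F (locally a) -> filterlim (fun t => f t ^ n) F (locally (a ^ n)).
Proof.
intros Hf; induction n; simpl; [apply lim_const | now apply lim_mult].
Qed.

Lemma lim_Rpower f a e : 0 < a -> filterlim f F (locally a) ->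
  filterlim (fun t => Rpower (f t) e) F (locally (Rpower a e)).
Proof.
intros Ha; apply (lim_comp (fun z => Rpower z e)).
apply (ex_derive_continuous (fun z => Rpower z e)); unfold Rpower; auto_derive; auto.
Qed.

Lemma lim_le f a b : a < b -> filterlim f F (locally a) -> F (fun t => f t < b).
Proof. intros Hab Hf; apply (Hf (fun z => z < b)), open_lt; exact Hab. Qed.

Lemma lim_by_bound f g a : filterlim g F (locally 0) -> F (fun t => Rabs (f t - a) <= g t) ->
  filterlim f F (locally a).
Proof.
intros Hg Hb; apply filterlim_locally; intros e.
assert (He : F (fun t => g t < e)) by (apply (lim_le g 0); auto; apply cond_pos).
apply filter_imp with (2 := filter_and _ _ Hb He); intros t [H1 H2].
change (Rabs (f t - a) < e); lra.
Qed.

Lemma lim_dser kap c f g u v : Rbar_le 1 (CV_radius kap) -> dominated kap c ->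
  Rabs u + Rabs v < 1 -> filterlim f F (locally u) -> filterlim g F (locally v) ->
  filterlim (fun t => dser c (f t) (g t)) F (locally (dser c u v)).
Proof.
intros Hk Hd Huv Hf Hg.
set (rho := (1 + (Rabs u + Rabs v)) / 2).
destruct (dser_lipschitz kap c rho Hk Hd) as [K [HK HL]]; [unfold rho; lra|].
assert (A : F (fun t => Rabs (f t) + Rabs (g t) < rho)).
{ apply (lim_le _ (Rabs u + Rabs v)); [unfold rho; lra|].
  apply lim_plus; apply (lim_comp Rabs); auto; apply continuous_Rabs. }
apply (lim_by_bound _ (fun t => K * (Rabs (f t - u) + Rabs (g t - v)))).
- replace (locally 0) with (locally (K * (Rabs (u - u) + Rabs (v - v))))
    by (rewrite !Rminus_diag, Rabs_R0; f_equal; ring).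
  apply lim_mult; [apply lim_const|].
  apply lim_plus; apply (lim_comp Rabs); try apply continuous_Rabs;
  apply lim_minus; auto; apply lim_const.
- apply filter_imp with (2 := A); intros t Ht; apply HL; [unfold rho; lra | lra].
Qed.

(** An arbitrary filter lets one statement serve for continuity in arc length and for joint
    continuity in arc length and target point. *)
Lemma lim_kern al be (fx fy f1 f2 fx0 fy0 : T -> R) (x y n1 n2 x0 y0 : R) :
  0 < al -> 0 < 1 - be -> 0 < x -> 0 < y -> 0 < x0 -> 0 < y0 -> 0 < dist2 x y x0 y0 ->
  filterlim fx F (locally x) -> filterlim fy F (locally y) ->
  filterlim f1 F (locally n1) -> filterlim f2 F (locally n2) ->
  filterlim fx0 F (locally x0) -> filterlim fy0 F (locally y0) ->
  filterlim (fun t => kern al be (fx t) (fy t) (f1 t) (f2 t) (fx0 t) (fy0 t)) F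
    (locally (kern al be x y n1 n2 x0 y0)).
Proof.
intros Ha Hb Hx Hy Hx0 Hy0 Hr Lx Ly L1 L2 Lx0 Ly0.
assert (HR := refl2_pos _ _ _ _ Hx Hy Hx0 Hy0).
assert (HK : Rbar_le 1 (CV_radius (kapF (al + (1 - be))))) by (apply kapF_radius; lra).
assert (HD : dominated (kapF (al + (1 - be))) (cF al (1 - be))) by (apply cF_dominated; lra).
assert (Huv := uv_abs_lt_1 _ _ _ _ Hx Hy Hx0 Hy0 Hr).
assert (LR : filterlim (fun t => refl2 (fx t) (fy t) (fx0 t) (fy0 t)) F (locally (refl2 x y x0 y0))).
{ unfold refl2; apply lim_plus; apply lim_pow; now apply lim_plus. }
assert (LdR : filterlim (fun t => drefl2 (fx t) (fy t) (f1 t) (f2 t) (fx0 t) (fy0 t)) F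
  (locally (drefl2 x y n1 n2 x0 y0))).
{ unfold drefl2; apply lim_mult; [apply lim_const|]; apply lim_plus; apply lim_mult; auto; now apply lim_plus. }
assert (Lu : filterlim (fun t => uvar (fx t) (fy t) (fx0 t) (fy0 t)) F (locally (uvar x y x0 y0))).
{ unfold uvar; apply lim_div; [lra | | exact LR].
  apply lim_mult; [apply lim_mult; [apply lim_const | exact Lx] | exact Lx0]. }
assert (Lv : filterlim (fun t => vvar (fx t) (fy t) (fx0 t) (fy0 t)) F (locally (vvar x y x0 y0))).
{ unfold vvar; apply lim_div; [lra | | exact LR].
  apply lim_mult; [apply lim_mult; [apply lim_const | exact Ly] | exact Ly0]. }
unfold kern; cbv zeta; apply lim_mult.
- unfold pref; apply lim_mult; [apply lim_mult; [apply lim_mult; [apply lim_const|]|]|];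
  now apply lim_Rpower.
- apply lim_plus; apply lim_mult.
  + apply lim_minus; [apply lim_mult; [apply lim_const | exact L2]|].
    apply lim_mult; [apply lim_mult; [apply lim_const | exact Ly]|].
    apply lim_div; [lra | exact LdR | exact LR].
  + apply lim_dser with (kapF (al + (1 - be))); auto.
  + auto.
  + apply lim_plus; apply lim_mult.
    * apply lim_dser with (PS_derive (kapF (al + (1 - be)))); auto using CV_radius_PS_derive, coefu_dominated.
    * unfold duvar; apply lim_div; auto; [lra|].
      apply lim_minus; apply lim_mult; [|exact L1 | exact Lu | exact LdR].
      apply lim_mult; [apply lim_const | exact Lx0].
    * apply lim_dser with (PS_derive (kapF (al + (1 - be)))); auto using CV_radius_PS_derive, coefv_dominated.
    * unfold dvvar; apply lim_div; auto; [lra|].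
      apply lim_minus; apply lim_mult; [|exact L2 | exact Lv | exact LdR].
      apply lim_mult; [apply lim_const | exact Ly0].
Qed.
End Limits.

(** * Geometry near a point of the curve *)

(** The hypotheses on the curve in the form in which the geometry consumes them: a Lipschitz tangent
    comes from bounded second derivatives, and [cv_end] is the linear consequence, at B, of the
    condition with exponent 1 + eps. *)
Record curve (a b l : R) (X Y dX dY : R -> R) : Prop := {
  cv_a : 0 < a; cv_b : 0 < b; cv_l : 0 < l;
  cv_B : X 0 = 0 /\ Y 0 = b;
  cv_A : X l = a /\ Y l = 0;
  cv_quad : forall s, 0 < s < l -> 0 < X s /\ 0 < Y s;
  cv_simple : forall s s', 0 <= s <= l -> 0 <= s' <= l -> X s = X s' -> Y s = Y s' -> s = s';
  cv_X : cont_on X 0 l; cv_Y : cont_on Y 0 l;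
  cv_dX : forall s, 0 < s < l -> is_derive X s (dX s);
  cv_dY : forall s, 0 < s < l -> is_derive Y s (dY s);
  cv_dXc : cont_on dX 0 l; cv_dYc : cont_on dY 0 l;
  cv_arc : forall s, 0 < s < l -> dX s ^ 2 + dY s ^ 2 = 1;
  cv_lip : exists L, 0 < L /\ forall s s', 0 < s < l -> 0 < s' < l ->
    Rabs (dX s - dX s') <= L * Rabs (s - s') /\ Rabs (dY s - dY s') <= L * Rabs (s - s');
  cv_end : exists C del, 0 <= C /\ 0 < del /\ forall s, 0 < s < l -> s < del -> Rabs (dY s) <= C * X s
}.
Arguments cv_A {a b l X Y dX dY}.
Arguments cv_B {a b l X Y dX dY}.
Arguments cv_X {a b l X Y dX dY}.
Arguments cv_Y {a b l X Y dX dY}.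
Arguments cv_a {a b l X Y dX dY}.
Arguments cv_arc {a b l X Y dX dY}.
Arguments cv_b {a b l X Y dX dY}.
Arguments cv_dX {a b l X Y dX dY}.
Arguments cv_dXc {a b l X Y dX dY}.
Arguments cv_dY {a b l X Y dX dY}.
Arguments cv_dYc {a b l X Y dX dY}.
Arguments cv_end {a b l X Y dX dY}.
Arguments cv_l {a b l X Y dX dY}.
Arguments cv_lip {a b l X Y dX dY}.
Arguments cv_quad {a b l X Y dX dY}.
Arguments cv_simple {a b l X Y dX dY}.

Lemma sqrt_dominates z w : Rabs z <= sqrt (z ^ 2 + w ^ 2) /\ Rabs w <= sqrt (z ^ 2 + w ^ 2).
Proof.
pose proof (pow2_ge_0 z); pose proof (pow2_ge_0 w).
split; rewrite <- sqrt_Rsqr_abs; apply sqrt_le_1_alt; unfold Rsqr; lra.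
Qed.

(* Coordinates relative to the orthonormal frame at a point of the curve: [k] is the arc length
   increment, [de] the signed distance, [e1 e2] and [f1 f2] the Taylor remainders of position
   and tangent. *)
Lemma frame_estimate L h p q k de e1 e2 f1 f2 :
  0 < L -> 0 < h -> L * h <= / 100 -> p ^ 2 + q ^ 2 = 1 -> Rabs k <= 2 * h -> Rabs de <= h ->
  Rabs e1 <= L * k ^ 2 -> Rabs e2 <= L * k ^ 2 -> Rabs f1 <= L * Rabs k -> Rabs f2 <= L * Rabs k ->
  let A := k * p + de * q + e1 in let B := k * q - de * p + e2 in
  let r2 := A ^ 2 + B ^ 2 in let rho2 := k ^ 2 + de ^ 2 in
  rho2 / 2 <= r2 /\
  (0 < rho2 -> Rabs ((- (q + f2) * A + (p + f1) * B) / r2 + de / rho2) <= 32 * L).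
Proof.
intros HL Hh HLh Hpq Hk Hde He1 He2 Hf1 Hf2 A B r2 rho2.
set (rho := sqrt rho2).
destruct (sqrt_dominates k de) as [Rk Rd]; fold rho2 in Rk, Rd; fold rho in Rk, Rd.
assert (Hrho2 : 0 <= rho2) by (unfold rho2; pose proof (pow2_ge_0 k); pose proof (pow2_ge_0 de); lra).
assert (Hrho : 0 <= rho) by apply sqrt_pos.
assert (Err : rho * rho = rho2) by now apply sqrt_sqrt.
assert (Hrh : rho <= 3 * h).
{ apply Rsqr_incr_0_var; [|lra]; unfold Rsqr; rewrite Err; unfold rho2.
  assert (k ^ 2 <= (2 * h) ^ 2) by (rewrite <- (pow2_abs k); apply pow_incr; split; [apply Rabs_pos | auto]).
  assert (de ^ 2 <= h ^ 2) by (rewrite <- (pow2_abs de); apply pow_incr; split; [apply Rabs_pos | auto]).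
  assert (0 <= h * h) by nra. lra. }
assert (Hkk : 0 <= k ^ 2 <= rho2) by (unfold rho2; pose proof (pow2_ge_0 k); pose proof (pow2_ge_0 de); lra).
assert (Hp : Rabs p <= 1) by (apply Rabs_le; pose proof (pow2_ge_0 q); nra).
assert (Hq : Rabs q <= 1) by (apply Rabs_le; pose proof (pow2_ge_0 p); nra).
set (a0 := k * p + de * q); set (b0 := k * q - de * p).
assert (Ha0 : Rabs a0 <= 2 * rho).
{ replace (2 * rho) with (rho * 1 + rho * 1) by ring; apply Rabs_plus_le; now apply Rabs_mult_le. }
assert (Hb0 : Rabs b0 <= 2 * rho).
{ replace (2 * rho) with (rho * 1 + rho * 1) by ring; apply Rabs_minus_le; now apply Rabs_mult_le. }
(* The smallness of [L * h] enters here: it makes |r^2 - rho^2| at most 27/100 of rho^2. *)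
assert (HLrho : 0 <= L * rho <= 3 / 100) by (split; nra).
assert (Er : r2 - rho2 = (2 * e1 * a0 + 2 * e2 * b0) + (e1 * e1 + e2 * e2)).
{ assert (r2 = a0 ^ 2 + b0 ^ 2 + ((2 * e1 * a0 + 2 * e2 * b0) + (e1 * e1 + e2 * e2)))
    by (unfold r2, A, B, a0, b0; ring).
  assert (a0 ^ 2 + b0 ^ 2 = rho2 * (p ^ 2 + q ^ 2)) by (unfold a0, b0, rho2; ring).
  rewrite Hpq in *; lra. }
assert (HLk : 0 <= L * k ^ 2) by (apply Rmult_le_pos; lra).
assert (HLk2 : L * k ^ 2 <= (L * rho) * rho) by (rewrite Rmult_assoc, Err; apply Rmult_le_compat_l; lra).
assert (B1 : Rabs (r2 - rho2) <= 9 * (L * k ^ 2) * rho).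
{ rewrite Er.
  apply Rle_trans with ((2 * (L * k ^ 2) * (2 * rho) + 2 * (L * k ^ 2) * (2 * rho)) +
     ((L * k ^ 2) * (L * k ^ 2) + (L * k ^ 2) * (L * k ^ 2))).
  - apply Rabs_plus_le; apply Rabs_plus_le; repeat apply Rabs_mult_le; auto; rewrite Rabs_pos_eq; lra.
  - assert ((L * k ^ 2) * (L * k ^ 2) <= (L * k ^ 2) * (rho / 2)); [apply Rmult_le_compat_l; auto; nra | lra]. }
assert (B2 : Rabs (r2 - rho2) <= rho2 / 2).
{ eapply Rle_trans; [apply B1|].
  replace (9 * (L * k ^ 2) * rho) with (9 * (L * rho) * k ^ 2) by ring.
  apply Rle_trans with (9 * (3 / 100) * rho2); [|lra].
  apply Rmult_le_compat; lra. }
assert (Hr2 : rho2 / 2 <= r2) by (apply Rabs_le_between in B2; lra).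
split; auto; intros Hpos.
set (Nn := - (q + f2) * A + (p + f1) * B).
(* The linear parts contribute -de (p^2 + q^2) = -de, so every remaining term is quadratic in rho
   and stays bounded after division by r^2. *)
assert (EN : Nn + de = (- q * e1 + p * e2) + (f1 * B - f2 * A)).
{ unfold Nn, A, B; fold a0 b0.
  replace de with (de * (p ^ 2 + q ^ 2)) at 1 by (rewrite Hpq; ring).
  unfold a0, b0; ring. }
assert (HA : Rabs A <= 2 * rho + (L * rho) * rho) by (apply Rabs_plus_le; [exact Ha0 | lra]).
assert (HB : Rabs B <= 2 * rho + (L * rho) * rho) by (apply Rabs_plus_le; [exact Hb0 | lra]).
assert (B3 : Rabs (Nn + de) <= 7 * L * rho2).
{ rewrite EN.
  assert (Hfr : L * Rabs k <= L * rho) by (apply Rmult_le_compat_l; lra).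
  apply Rle_trans with ((1 * (L * rho * rho) + 1 * (L * rho * rho)) +
    ((L * rho) * (2 * rho + (L * rho) * rho) + (L * rho) * (2 * rho + (L * rho) * rho))).
  - apply Rabs_plus_le; [apply Rabs_plus_le | apply Rabs_minus_le]; apply Rabs_mult_le; auto; try lra.
    now rewrite Rabs_Ropp.
  - rewrite <- Err.
    assert (L * rho * (L * rho * rho) <= / 2 * (L * rho * rho)).
    { apply Rmult_le_compat_r; [|lra]; repeat apply Rmult_le_pos; lra. }
    lra. }
replace (Nn / r2 + de / rho2) with ((Nn + de) / r2 + de * (r2 - rho2) / (rho2 * r2)) by (field; lra).
replace (32 * L) with (7 * L * rho2 / (rho2 / 2) + (9 * L * (rho2 * rho2)) / (rho2 * (rho2 / 2))) by (field; lra).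
apply Rabs_plus_le; apply Rabs_div_le; auto; try lra.
- apply Rle_trans with (rho * (9 * (L * k ^ 2) * rho)); [now apply Rabs_mult_le|].
  replace (rho * (9 * (L * k ^ 2) * rho)) with (9 * L * (rho2 * k ^ 2)) by (rewrite <- Err; ring).
  apply Rmult_le_compat_l; [lra|]; apply Rmult_le_compat_l; lra.
- apply Rmult_lt_0_compat; lra.
- apply Rmult_le_compat_l; lra.
Qed.

Section Geometry.
Variables (a b l : R) (X Y dX dY : R -> R).
Hypothesis cv : curve a b l X Y dX dY.

Definition offx (s de : R) : R := X s - de * dY s.
Definition offy (s de : R) : R := Y s + de * dX s.

Lemma taylor_curve : exists L, 0 < L /\ forall s s', 0 < s < l -> 0 < s' < l ->
  (Rabs (dX s - dX s') <= L * Rabs (s - s') /\ Rabs (dY s - dY s') <= L * Rabs (s - s')) /\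
  (Rabs (X s - X s' - (s - s') * dX s') <= L * (s - s') ^ 2 /\
   Rabs (Y s - Y s' - (s - s') * dY s') <= L * (s - s') ^ 2).
Proof.
destruct (cv_lip cv) as [L [HL Lip]].
exists L; split; auto; intros s s' Hs Hs'; split; [now apply Lip|].
assert (T : forall f df, (forall z, 0 < z < l -> is_derive f z (df z)) ->
  (forall z z', 0 < z < l -> 0 < z' < l -> Rabs (df z - df z') <= L * Rabs (z - z')) ->
  Rabs (f s - f s' - (s - s') * df s') <= L * (s - s') ^ 2).
{ intros f df Hf Hdf.
  assert (In : forall z, Rmin s' s <= z <= Rmax s' s -> 0 < z < l)
    by (intros z; unfold Rmin, Rmax; destruct Rle_dec; lra).
  destruct (MVT_gen f s' s df) as [z [Hz E]].
  - intros z Hz; apply Hf, In; lra.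
  - intros z Hz; apply continuity_pt_filterlim, (ex_derive_continuous f); exists (df z); now apply Hf, In.
  - rewrite E; replace (df z * (s - s') - (s - s') * df s') with ((df z - df s') * (s - s')) by ring.
    rewrite <- (pow2_abs (s - s')), Rabs_mult.
    replace (L * Rabs (s - s') ^ 2) with (L * Rabs (s - s') * Rabs (s - s')) by ring.
    apply Rmult_le_compat_r; [apply Rabs_pos|].
    eapply Rle_trans; [apply Hdf; auto|].
    apply Rmult_le_compat_l; [lra|].
    revert Hz; unfold Rmin, Rmax, Rabs; repeat destruct Rle_dec; repeat destruct Rcase_abs; lra. }
split; apply T; intros; try apply (cv_dX cv); try apply (cv_dY cv); auto; now apply Lip.
Qed.

Lemma local_geometry t : 0 < t < l -> exists h C, 0 < h /\ 0 <= C /\ 0 < t - h /\ t + h < l /\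
  forall s sg de, Rabs (s - t) < h -> Rabs (sg - t) < h -> Rabs de < h ->
  let x0 := offx sg de in let y0 := offy sg de in
  let r2 := dist2 (X s) (Y s) x0 y0 in let rho2 := (s - sg) ^ 2 + de ^ 2 in
  rho2 / 2 <= r2 /\
  (0 < rho2 -> Rabs ((- dY s * (X s - x0) + dX s * (Y s - y0)) / r2 + de / rho2) <= C).
Proof.
intros Ht; destruct taylor_curve as [L [HL HT]].
set (h := Rmin (/ (100 * L)) (Rmin (t / 2) ((l - t) / 2))).
assert (Hh : 0 < h).
{ unfold h; repeat apply Rmin_pos; try lra; apply Rinv_0_lt_compat; lra. }
assert (h1 : h <= / (100 * L)) by apply Rmin_l.
assert (h2 : h <= t / 2) by (eapply Rle_trans; [apply Rmin_r | apply Rmin_l]).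
assert (h3 : h <= (l - t) / 2) by (eapply Rle_trans; [apply Rmin_r | apply Rmin_r]).
assert (HLh : L * h <= / 100).
{ apply Rle_trans with (L * / (100 * L)); [apply Rmult_le_compat_l; lra | right; field; lra]. }
exists h, (32 * L); do 4 (split; [lra|]).
intros s sg de H H0 H1 x0 y0 r2 rho2.
apply Rabs_lt_between in H, H0.
assert (Hs : 0 < s < l) by lra; assert (Hsg : 0 < sg < l) by lra.
destruct (HT s sg Hs Hsg) as [[D1 D2] [E1 E2]].
destruct (frame_estimate L h (dX sg) (dY sg) (s - sg) de (X s - X sg - (s - sg) * dX sg)
  (Y s - Y sg - (s - sg) * dY sg) (dX s - dX sg) (dY s - dY sg)) as [F1 F2]; auto; try lra.
- apply (cv_arc cv); auto.
- apply Rabs_le; lra.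
- split.
  + unfold rho2, r2, dist2, x0, y0, offx, offy.
    eapply Rle_trans; [apply F1|]; right; ring.
  + intros Hpos; eapply Rle_trans; [|apply F2, Hpos]; right.
    unfold r2, rho2, dist2, x0, y0, offx, offy; f_equal; f_equal; f_equal; ring.
Qed.

Lemma unit_speed s : 0 < s < l -> Rabs (dX s) <= 1 /\ Rabs (dY s) <= 1.
Proof.
intros Hs; pose proof (cv_arc cv s Hs) as E.
pose proof (pow2_ge_0 (dX s)); pose proof (pow2_ge_0 (dY s)).
split; apply Rabs_le; nra.
Qed.

Lemma curve_lipschitz s s' : 0 < s < l -> 0 < s' < l ->
  Rabs (X s - X s') <= Rabs (s - s') /\ Rabs (Y s - Y s') <= Rabs (s - s').
Proof.
intros Hs Hs'.
assert (In : forall z, Rmin s' s <= z <= Rmax s' s -> 0 < z < l)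
  by (intros z; unfold Rmin, Rmax; destruct Rle_dec; lra).
rewrite <- (Rmult_1_l (Rabs (s - s'))).
split; [apply (MVT_bound X dX) | apply (MVT_bound Y dY)]; intros z Hz; apply In in Hz;
  try apply (cv_dX cv); try apply (cv_dY cv); auto; now apply unit_speed.
Qed.

Lemma offset_near s t de : 0 < s < l -> 0 < t < l ->
  Rabs (offx s de - X t) <= Rabs (s - t) + Rabs de /\
  Rabs (offy s de - Y t) <= Rabs (s - t) + Rabs de.
Proof.
intros Hs Ht; destruct (curve_lipschitz s t Hs Ht); destruct (unit_speed s Hs); unfold offx, offy.
replace (Rabs de) with (Rabs de * 1) by ring.
split.
- replace (X s - de * dY s - X t) with ((X s - X t) - de * dY s) by ring.
  apply Rabs_minus_le; auto; apply Rabs_mult_le; auto; lra.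
- replace (Y s + de * dX s - Y t) with ((Y s - Y t) + de * dX s) by ring.
  apply Rabs_plus_le; auto; apply Rabs_mult_le; auto; lra.
Qed.

End Geometry.
Arguments unit_speed {a b l X Y dX dY}.
Arguments offset_near {a b l X Y dX dY}.
Arguments local_geometry {a b l X Y dX dY}.
Arguments curve_lipschitz {a b l X Y dX dY}.

Lemma Dlim_eq f x d : derivable_pt_lim f x d -> Dlim f x = d.
Proof.
intros H; unfold Dlim; apply (uniqueness_limite f x); auto.
apply (epsilon_spec (inhabits 0) (fun d => derivable_pt_lim f x d)); now exists d.
Qed.

Lemma dn_q3_kern al be (X Y dX dY : R -> R) s x0 y0 : 0 < al -> 0 < 1 - be ->
  0 < X s -> 0 < Y s -> 0 < x0 -> 0 < y0 -> 0 < dist2 (X s) (Y s) x0 y0 ->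
  Rpower (X s) (2 * al) * Rpower (Y s) (2 * be) * dn_q3 al be X Y dX dY s x0 y0
  = kern al be (X s) (Y s) (- dY s) (dX s) x0 y0.
Proof.
intros Ha Hb Hx Hy Hx0 Hy0 Hr.
destruct (q3_directional_derivative al be (X s) (Y s) (- dY s) (dX s) x0 y0) as [D [HD E]]; auto.
rewrite <- E; f_equal; unfold dn_q3; apply Dlim_eq.
apply is_derive_Reals; apply is_derive_Reals in HD.
apply is_derive_ext with (2 := HD); intros h; f_equal; ring.
Qed.

Section NearKernel.
Variables (al be a b l : R) (X Y dX dY : R -> R).
Hypotheses (Hal : 0 < 2 * al < 1) (Hbe : 0 < 2 * be < 1).
Hypothesis cv : curve a b l X Y dX dY.

Definition kernG (s x0 y0 : R) : R := kern al be (X s) (Y s) (- dY s) (dX s) x0 y0.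

(** The constants are uniform in sg and de. For de = 0 the Poisson term is zero, and the estimate
    makes the kernel on the curve integrable at s = t. *)
Lemma kernel_near t : 0 < t < l -> exists h C, 0 < h /\ 0 <= C /\ 0 < t - h /\ t + h < l /\
  forall s sg de, Rabs (s - t) < h -> Rabs (sg - t) < h -> Rabs de < h ->
  0 < offx X dY sg de /\ 0 < offy Y dX sg de /\
  ((s - sg) ^ 2 + de ^ 2) / 2 <= dist2 (X s) (Y s) (offx X dY sg de) (offy Y dX sg de) /\
  (s <> sg -> Rabs (kernG s (offx X dY sg de) (offy Y dX sg de)
     - / (2 * PI) * (de / ((s - sg) ^ 2 + de ^ 2))) <= C / sqrt (Rabs (s - sg))).
Proof.
intros Ht.
destruct (local_geometry cv t Ht) as (h0 & C0 & Hh0 & HC0 & Hl & Hr & HG).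
destruct (cv_quad cv t Ht) as [HXt HYt].
set (m := Rmin (X t) (Y t)).
assert (Hm : 0 < m) by now apply Rmin_pos.
assert (m1 : m <= X t) by apply Rmin_l; assert (m2 : m <= Y t) by apply Rmin_r.
set (c := m / 2); set (M := X t + Y t + 1).
assert (Hc : 0 < c) by (unfold c; lra).
assert (HM : 0 < M) by (unfold M; lra).
destruct (kern_asymptotics al be c M Hal Hbe Hc HM) as [K [HK HA]].
(* The bound m / 8 keeps all points in the box [c, M]; the bound 1/2 gives |s - sg| <= 1, so that
   bounded errors are dominated by 1 / sqrt |s - sg|. *)
set (h := Rmin (Rmin h0 (/ 2)) (m / 8)).
assert (Hh : 0 < h) by (unfold h; repeat apply Rmin_pos; lra).
assert (h1 : h <= h0) by (eapply Rle_trans; [apply Rmin_l | apply Rmin_l]).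
assert (h2 : h <= / 2) by (eapply Rle_trans; [apply Rmin_l | apply Rmin_r]).
assert (h3 : h <= m / 8) by apply Rmin_r.
assert (HPI := PI_RGT_0).
assert (HiPI : 0 < / (2 * PI)) by (apply Rinv_0_lt_compat; lra).
exists h, (K * 2 + / (2 * PI) * C0); split; auto; split.
{ apply Rplus_le_le_0_compat; apply Rmult_le_pos; lra. }
do 2 (split; [lra|]).
intros s sg de Hs Hsg Hde.
destruct (HG s sg de) as [G1 G2]; try lra; cbv zeta in G1, G2.
assert (Bs := Hs); assert (Bsg := Hsg); apply Rabs_lt_between in Bs, Bsg.
assert (Is : 0 < s < l) by lra; assert (Isg : 0 < sg < l) by lra.
destruct (offset_near cv sg t de Isg Ht) as [O1 O2].
destruct (curve_lipschitz cv s t Is Ht) as [L1 L2].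
destruct (unit_speed cv s Is) as [U1 U2].
set (x0 := offx X dY sg de) in *; set (y0 := offy Y dX sg de) in *.
apply Rabs_le_between in O1, O2, L1, L2.
assert (Bx0 : c <= x0 <= M) by (unfold c, M; lra).
assert (By0 : c <= y0 <= M) by (unfold c, M; lra).
assert (Bx : c <= X s <= M) by (unfold c, M; lra).
assert (By : c <= Y s <= M) by (unfold c, M; lra).
do 2 (split; [lra|]); split; auto.
intros Hne.
set (k := s - sg) in *.
assert (Hk : 0 < Rabs k) by (apply Rabs_pos_lt; unfold k; lra).
assert (Hk2 : 0 < k ^ 2) by (rewrite <- (pow2_abs k); now apply pow_lt).
assert (Hd2 := pow2_ge_0 de).
assert (Hr2 : 0 < dist2 (X s) (Y s) x0 y0) by lra.
specialize (G2 ltac:(lra)).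
assert (A := HA (X s) (Y s) (- dY s) (dX s) x0 y0 Bx By Bx0 By0 ltac:(now rewrite Rabs_Ropp) U1 Hr2).
fold (kernG s x0 y0) in A.
set (q := (- dY s * (X s - x0) + dX s * (Y s - y0)) / dist2 (X s) (Y s) x0 y0) in *.
replace (kernG s x0 y0 - / (2 * PI) * (de / (k ^ 2 + de ^ 2))) with
  ((kernG s x0 y0 + / (2 * PI) * q) - / (2 * PI) * (q + de / (k ^ 2 + de ^ 2))) by ring.
assert (Hsq : 0 < sqrt (Rabs k)) by now apply sqrt_lt_R0.
assert (Hkh : Rabs k <= 1) by (apply Rabs_le; unfold k; lra).
assert (Hsq1 : 1 <= / sqrt (Rabs k)).
{ rewrite <- Rinv_1; apply Rinv_le_contravar; auto; rewrite <- sqrt_1; now apply sqrt_le_1_alt. }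
assert (HP : Rpower (dist2 (X s) (Y s) x0 y0) (- / 4) <= 2 * / sqrt (Rabs k)).
{ apply Rle_trans with (Rpower (k ^ 2 / 2) (- / 4)).
  - apply Rpower_opp_le; lra.
  - rewrite <- (pow2_abs k); set (z := Rabs k) in *.
    rewrite <- Rpower_sqrt by auto; rewrite <- Rpower_Ropp.
    unfold Rpower; rewrite ln_div by (try apply pow_lt; lra).
    replace (ln (z ^ 2)) with (2 * ln z) by (simpl; rewrite Rmult_1_r, ln_mult by auto; ring).
    replace (- / 4 * (2 * ln z - ln 2)) with (/ 4 * ln 2 + - / 2 * ln z) by field.
    rewrite exp_plus; apply Rmult_le_compat_r; [left; apply exp_pos|].
    rewrite <- (exp_ln 2) at 2 by lra; apply exp_le_mono.
    assert (0 < ln 2) by (rewrite <- ln_1; apply ln_increasing; lra); lra. }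
replace ((K * 2 + / (2 * PI) * C0) / sqrt (Rabs k)) with
  (K * (2 * / sqrt (Rabs k)) + / (2 * PI) * (C0 * / sqrt (Rabs k))) by (field; lra).
apply Rabs_minus_le.
- eapply Rle_trans; [apply A|]; now apply Rmult_le_compat_l.
- apply Rabs_mult_le; [rewrite Rabs_pos_eq; lra|].
  eapply Rle_trans; [apply G2|]; rewrite <- (Rmult_1_r C0) at 1; now apply Rmult_le_compat_l.
Qed.

End NearKernel.

(** * Compactness and nearest points *)

(** A Lebesgue number argument: radii valid near each point are chosen classically, and compactness
    of the square gives a common lower bound. *)
Lemma compact_uniform_2d (P : R -> R -> R -> Prop) (a b : R) :
  (forall x y d d', 0 < d' <= d -> P x y d -> P x y d') ->
  (forall u v, a <= u <= b -> a <= v <= b -> exists d, 0 < d /\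
     forall x y, a <= x <= b -> a <= y <= b -> Rabs (x - u) < d -> Rabs (y - v) < d -> P x y d) ->
  exists d, 0 < d /\ forall x y, a <= x <= b -> a <= y <= b -> P x y d.
Proof.
intros Hmon Hloc.
assert (Hex : forall uv : R * R, exists d : posreal,
  a <= fst uv <= b -> a <= snd uv <= b ->
  forall x y, a <= x <= b -> a <= y <= b -> Rabs (x - fst uv) < d -> Rabs (y - snd uv) < d -> P x y d).
{ intros [u v]; simpl; destruct (classic (a <= u <= b /\ a <= v <= b)) as [[Hu Hv]|Hn].
  - destruct (Hloc u v Hu Hv) as [d [Hd H]]; exists (mkposreal d Hd); intros _ _; exact H.
  - exists (mkposreal 1 Rlt_0_1); intros Hu Hv; tauto. }
set (delta := fun u v => proj1_sig (constructive_indefinite_description _ (Hex (u, v)))).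
assert (Hdelta : forall u v, a <= u <= b -> a <= v <= b -> forall x y, a <= x <= b -> a <= y <= b ->
  Rabs (x - u) < delta u v -> Rabs (y - v) < delta u v -> P x y (delta u v)).
{ intros u v; unfold delta; destruct constructive_indefinite_description as [d Hd]; exact Hd. }
destruct (compactness_value_2d a b a b delta) as [d Hd].
exists d; split; [apply cond_pos|]; intros x y Hx Hy.
(* The covering statement is available only under a double negation, which classical logic
   removes. *)
apply NNPP; intros Hn; apply (Hd x y Hx Hy); intros (u & v & Hu & Hv & H1 & H2 & H3).
apply Hn, Hmon with (delta u v); [split; [apply cond_pos | auto]|].
now apply Hdelta.
Qed.

Lemma compact_uniform_1d (P : R -> R -> Prop) (a b : R) :
  (forall x d d', 0 < d' <= d -> P x d -> P x d') ->
  (forall u, a <= u <= b -> exists d, 0 < d /\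
     forall x, a <= x <= b -> Rabs (x - u) < d -> P x d) ->
  exists d, 0 < d /\ forall x, a <= x <= b -> P x d.
Proof.
intros Hmon Hloc.
destruct (compact_uniform_2d (fun x _ => P x) a b) as [d [Hd H]].
- intros x y; apply Hmon.
- intros u v Hu _; destruct (Hloc u Hu) as [d [Hd H]]; exists d; split; auto.
- exists d; split; auto; intros x Hx; now apply (H x x).
Qed.

(** Retraction of the line onto [0, l]: composition with it turns [cont_on] into continuity at every
    real, as the extremum and mean value theorems ask. *)
Definition clamp (l s : R) : R := Rmax 0 (Rmin s l).

Lemma clamp_in l s : 0 < l -> 0 <= clamp l s <= l.
Proof. intros Hl; unfold clamp, Rmax, Rmin; repeat destruct Rle_dec; lra. Qed.

Lemma clamp_id l s : 0 <= s <= l -> clamp l s = s.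
Proof. intros Hs; unfold clamp, Rmax, Rmin; repeat destruct Rle_dec; lra. Qed.

Lemma clamp_contract l s s' : 0 < l -> Rabs (clamp l s - clamp l s') <= Rabs (s - s').
Proof.
intros Hl; unfold clamp, Rmax, Rmin, Rabs; repeat destruct Rle_dec; repeat destruct Rcase_abs; lra.
Qed.

Lemma continuous_eps (f : R -> R) x : continuous f x <->
  forall e, 0 < e -> exists d, 0 < d /\ forall y, Rabs (y - x) < d -> Rabs (f y - f x) < e.
Proof.
split.
- intros H e He.
  destruct (proj1 (filterlim_locally f (f x)) H (mkposreal e He)) as [d Hd].
  exists d; split; [apply cond_pos|]; intros y Hy; apply Hd, Hy.
- intros H; apply filterlim_locally; intros e.
  destruct (H e (cond_pos e)) as [d [Hd H']]; exists (mkposreal d Hd); intros y Hy; apply H', Hy.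
Qed.

Lemma cont_on_clamp f l s : 0 < l -> cont_on f 0 l -> continuous (fun s => f (clamp l s)) s.
Proof.
intros Hl Hf; apply continuous_eps; intros e He.
destruct (Hf (clamp l s) (clamp_in l s Hl) e He) as [d [Hd H]].
exists d; split; auto; intros y Hy; apply H; [now apply clamp_in|].
eapply Rle_lt_trans; [now apply clamp_contract | exact Hy].
Qed.

Lemma cont_on_interior f l s : cont_on f 0 l -> 0 < s < l -> continuous f s.
Proof.
intros Hf Hs; apply continuous_eps; intros e He.
destruct (Hf s ltac:(lra) e He) as [d [Hd H]].
exists (Rmin d (Rmin s (l - s))); split; [repeat apply Rmin_pos; lra|].
intros y Hy.
assert (Rabs (y - s) < d) by (eapply Rlt_le_trans; [apply Hy | apply Rmin_l]).
assert (H1 : Rabs (y - s) < Rmin s (l - s)) by (eapply Rlt_le_trans; [apply Hy | apply Rmin_r]).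
assert (Rabs (y - s) < s) by (eapply Rlt_le_trans; [apply H1 | apply Rmin_l]).
assert (Rabs (y - s) < l - s) by (eapply Rlt_le_trans; [apply H1 | apply Rmin_r]).
apply H; auto; apply Rabs_lt_between in H2, H3; lra.
Qed.

Lemma continuous_cont_on f a b : (forall x, a <= x <= b -> continuous f x) -> cont_on f a b.
Proof.
intros H x Hx e He.
destruct (proj1 (continuous_eps f x) (H x Hx) e He) as [d [Hd H']].
exists d; split; auto.
Qed.

Lemma cont_on_bounded f l : 0 < l -> cont_on f 0 l ->
  exists B, 0 <= B /\ forall s, 0 <= s <= l -> Rabs (f s) <= B.
Proof.
intros Hl Hf.
destruct (continuity_ab_maj (fun s => Rabs (f (clamp l s))) 0 l) as [m [Hm _]]; [lra| |].
- intros s _; apply continuity_pt_filterlim.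
  apply (lim_comp Rabs (fun s => f (clamp l s))); [apply continuous_Rabs | now apply cont_on_clamp].
- exists (Rabs (f (clamp l m))); split; [apply Rabs_pos|].
  intros s Hs; rewrite <- (clamp_id l s) at 1 by auto; now apply Hm.
Qed.

Lemma compact_pos_min (f : R -> R) a b : a <= b -> (forall s, a <= s <= b -> continuous f s) ->
  (forall s, a <= s <= b -> 0 < f s) -> exists c, 0 < c /\ forall s, a <= s <= b -> c <= f s.
Proof.
intros Hab Hc Hp.
destruct (continuity_ab_min f a b) as [m [Hm Im]]; auto.
- intros s Hs; apply continuity_pt_filterlim; now apply Hc.
- exists (f m); split; auto.
Qed.

Lemma cont_on_closed_le g l : 0 < l -> cont_on g 0 l -> (forall s, 0 < s < l -> g s <= 0) ->
  forall s, 0 <= s <= l -> g s <= 0.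
Proof.
intros Hl Hg H s Hs; apply Rnot_lt_le; intros Hpos.
destruct (Hg s Hs (g s) Hpos) as [d [Hd Hc]].
set (m := Rmin (d / 2) (l / 2)).
assert (m1 : m <= d / 2) by apply Rmin_l; assert (m2 : m <= l / 2) by apply Rmin_r.
assert (m0 : 0 < m) by (apply Rmin_pos; lra).
set (y := if Rle_dec s (l / 2) then s + m / 2 else s - m / 2).
assert (Hy : 0 < y < l /\ Rabs (y - s) < d).
{ unfold y; destruct Rle_dec; (split; [lra | apply Rabs_def1; lra]). }
specialize (Hc y ltac:(lra) (proj2 Hy)); specialize (H y (proj1 Hy)).
apply Rabs_lt_between in Hc; lra.
Qed.

Section CurveTopology.
Variables (a b l : R) (X Y dX dY : R -> R).
Hypothesis cv : curve a b l X Y dX dY.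

Lemma cv_l_pos : 0 < l. Proof. apply (cv_l cv). Qed.

Lemma clamp_X s : continuous (fun s => X (clamp l s)) s.
Proof. apply cont_on_clamp; [apply cv_l_pos | apply (cv_X cv)]. Qed.
Lemma clamp_Y s : continuous (fun s => Y (clamp l s)) s.
Proof. apply cont_on_clamp; [apply cv_l_pos | apply (cv_Y cv)]. Qed.
Lemma clamp_dX s : continuous (fun s => dX (clamp l s)) s.
Proof. apply cont_on_clamp; [apply cv_l_pos | apply (cv_dXc cv)]. Qed.
Lemma clamp_dY s : continuous (fun s => dY (clamp l s)) s.
Proof. apply cont_on_clamp; [apply cv_l_pos | apply (cv_dYc cv)]. Qed.

Lemma dist2_tri x y x1 y1 x2 y2 : dist2 x y x2 y2 <= 2 * dist2 x y x1 y1 + 2 * dist2 x1 y1 x2 y2.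
Proof.
unfold dist2.
pose proof (pow2_ge_0 (x - x1 - (x1 - x2))); pose proof (pow2_ge_0 (y - y1 - (y1 - y2))); nra.
Qed.

Lemma dist2_sym x y x1 y1 : dist2 x y x1 y1 = dist2 x1 y1 x y.
Proof. unfold dist2; ring. Qed.

Lemma dist2_pos x y x1 y1 : ~ (x = x1 /\ y = y1) -> 0 < dist2 x y x1 y1.
Proof.
intros H; unfold dist2; pose proof (pow2_ge_0 (x - x1)); pose proof (pow2_ge_0 (y - y1)).
destruct (Req_dec x x1) as [E|E].
- assert (y - y1 <> 0) by (intros E'; apply H; split; lra).
  pose proof (pow2_gt_0 (y - y1) H2); lra.
- assert (x - x1 <> 0) by lra; pose proof (pow2_gt_0 (x - x1) H2); lra.
Qed.

(** Simplicity made quantitative by compactness of the set of pairs of parameters. *)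
Lemma curve_separation h : 0 < h -> exists c, 0 < c /\ forall s s', 0 <= s <= l -> 0 <= s' <= l ->
  h <= Rabs (s - s') -> c <= dist2 (X s) (Y s) (X s') (Y s').
Proof.
intros Hh.
destruct (compact_uniform_2d (fun s s' d => h <= Rabs (s - s') -> d <= dist2 (X s) (Y s) (X s') (Y s')) 0 l)
  as [c [Hc H]].
- intros x y d d' Hd HP Hxy; specialize (HP Hxy); lra.
- intros u v Hu Hv.
  destruct (Req_dec u v) as [<-|Hne].
  (* Around the diagonal the claim is vacuous: both parameters lie within h / 2 of u, hence closer
     than h to each other. *)
  + exists (h / 2); split; [lra|]; intros x y _ _ H1 H2 H3.
    apply Rabs_lt_between in H1, H2; exfalso; revert H3; apply Rlt_not_le, Rabs_def1; lra.
  + set (D := dist2 (X u) (Y u) (X v) (Y v)).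
    assert (HD : 0 < D).
    { apply dist2_pos; intros [E1 E2]; apply Hne; now apply (cv_simple cv). }
    set (e := Rmin 1 (D / 16)).
    assert (He : 0 < e) by (apply Rmin_pos; lra).
    assert (e1 : e <= 1) by apply Rmin_l; assert (e2 : e <= D / 16) by apply Rmin_r.
    destruct (cv_X cv u Hu e He) as [d1 [Hd1 H1]].
    destruct (cv_Y cv u Hu e He) as [d2 [Hd2 H2]].
    destruct (cv_X cv v Hv e He) as [d3 [Hd3 H3]].
    destruct (cv_Y cv v Hv e He) as [d4 [Hd4 H4]].
    set (d := Rmin (Rmin (Rmin d1 d2) (Rmin d3 d4)) (D / 16)).
    assert (Hd : d <= d1 /\ d <= d2 /\ d <= d3 /\ d <= d4 /\ d <= D / 16).
    { unfold d, Rmin; repeat destruct Rle_dec; lra. }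
    exists d; split; [unfold d; repeat apply Rmin_pos; lra|].
    intros x y Hx Hy Dx Dy _.
    specialize (H1 x Hx ltac:(lra)); specialize (H2 x Hx ltac:(lra)).
    specialize (H3 y Hy ltac:(lra)); specialize (H4 y Hy ltac:(lra)).
    assert (T1 := dist2_tri (X u) (Y u) (X x) (Y x) (X v) (Y v)).
    assert (T2 := dist2_tri (X x) (Y x) (X y) (Y y) (X v) (Y v)).
    assert (Sm : forall p q p' q', Rabs (p - p') < e -> Rabs (q - q') < e -> dist2 p q p' q' <= D / 8).
    { intros p q p' q' E1 E2; unfold dist2.
      assert ((p - p') ^ 2 <= e ^ 2) by (rewrite <- pow2_abs; apply pow_incr; split; [apply Rabs_pos | lra]).
      assert ((q - q') ^ 2 <= e ^ 2) by (rewrite <- pow2_abs; apply pow_incr; split; [apply Rabs_pos | lra]).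
      assert (e ^ 2 <= e) by nra. lra. }
    assert (S1 := Sm _ _ _ _ H1 H2); rewrite dist2_sym in S1.
    assert (S2 := Sm _ _ _ _ H3 H4).
    fold D in T1; lra.
- exists c; split; auto.
Qed.

Lemma arc_closed s : 0 <= s <= l -> dX s ^ 2 + dY s ^ 2 = 1.
Proof.
intros Hs.
(* The equality passes to the end points as two inequalities, for the signs 1 and -1. *)
assert (Cg : forall sgn : R, cont_on (fun s => sgn * (dX s ^ 2 + dY s ^ 2 - 1)) 0 l).
{ intros sgn.
  assert (C : forall s, continuous (fun s => sgn * (dX (clamp l s) ^ 2 + dY (clamp l s) ^ 2 - 1)) s).
  { intros z; apply (lim_mult (fun _ => sgn)); [apply lim_const|].
    apply lim_minus; [|apply lim_const].
    apply lim_plus; apply lim_pow; [apply clamp_dX | apply clamp_dY]. }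
  intros x Hx e He.
  destruct (proj1 (continuous_eps _ x) (C x) e He) as [d [Hd H]].
  exists d; split; auto; intros y Hy Hxy; specialize (H y Hxy); simpl in H.
  now rewrite !clamp_id in H by auto. }
assert (P := cv_arc cv).
assert (A1 := cont_on_closed_le _ l cv_l_pos (Cg 1) ltac:(intros z Hz; specialize (P z Hz); cbv beta; lra) s Hs).
assert (A2 := cont_on_closed_le _ l cv_l_pos (Cg (-1)) ltac:(intros z Hz; specialize (P z Hz); cbv beta; lra) s Hs).
simpl in A1, A2; simpl; lra.
Qed.

Lemma unit_speed_closed s : 0 <= s <= l -> Rabs (dX s) <= 1 /\ Rabs (dY s) <= 1.
Proof.
intros Hs; pose proof (arc_closed s Hs) as E.
pose proof (pow2_ge_0 (dX s)); pose proof (pow2_ge_0 (dY s)).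
split; apply Rabs_le; nra.
Qed.

Lemma clamp_is_derive (f df : R -> R) : (forall s, 0 < s < l -> is_derive f s (df s)) ->
  forall s, 0 < s < l -> is_derive (fun s => f (clamp l s)) s (df s).
Proof.
intros H s Hs; apply is_derive_ext_loc with f; [|auto].
assert (Hm : 0 < Rmin s (l - s)) by (apply Rmin_pos; lra).
exists (mkposreal _ Hm); intros y Hy; rewrite clamp_id; auto.
assert (Hy' : Rabs (y - s) < Rmin s (l - s)) by exact Hy.
pose proof (Rmin_l s (l - s)); pose proof (Rmin_r s (l - s)); apply Rabs_lt_between in Hy'; lra.
Qed.

(** A minimiser of the distance over the whole curve lies near t, so it is interior; the derivative
    vanishes there and the displacement is normal, which defines [de]. *)
Lemma nearest_point t h : 0 < t < l -> 0 < h -> exists eta, 0 < eta /\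
  forall x0 y0, dist2 x0 y0 (X t) (Y t) < eta ->
  exists sg de, Rabs (sg - t) < h /\ Rabs de < h /\ x0 = offx X dY sg de /\ y0 = offy Y dX sg de.
Proof.
intros Ht Hh.
set (h1 := Rmin h (Rmin t (l - t))).
assert (Hh1 : 0 < h1) by (unfold h1; repeat apply Rmin_pos; lra).
assert (k1 : h1 <= h) by apply Rmin_l.
assert (k2 : h1 <= t) by (eapply Rle_trans; [apply Rmin_r | apply Rmin_l]).
assert (k3' : h1 <= l - t) by (eapply Rle_trans; [apply Rmin_r | apply Rmin_r]).
destruct (curve_separation h1 Hh1) as [c [Hc Hsep]].
(* If the minimiser had parameter distance at least h1 from t, separation would give c <= 2 f sg + 2
   f t < c. The bound h^2 gives |de| < h. *)
exists (Rmin (c / 4) (h ^ 2)); split; [apply Rmin_pos; [lra | now apply pow_lt]|].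
intros x0 y0 Hd.
assert (E1 : dist2 x0 y0 (X t) (Y t) < c / 4) by (eapply Rlt_le_trans; [apply Hd | apply Rmin_l]).
assert (E2 : dist2 x0 y0 (X t) (Y t) < h ^ 2) by (eapply Rlt_le_trans; [apply Hd | apply Rmin_r]).
set (f := fun s => dist2 (X (clamp l s)) (Y (clamp l s)) x0 y0).
destruct (continuity_ab_min f 0 l) as [sg [Hmin Isg]]; [pose proof cv_l_pos; lra| |].
{ intros s _; apply continuity_pt_filterlim; unfold f, dist2.
  apply lim_plus; apply lim_pow; apply lim_minus; try apply lim_const; [apply clamp_X | apply clamp_Y]. }
assert (Hft : f t = dist2 x0 y0 (X t) (Y t)).
{ unfold f; rewrite clamp_id by lra; apply dist2_sym. }
assert (Hfs : f sg <= f t) by (apply Hmin; lra).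
assert (Hfsg : f sg = dist2 (X sg) (Y sg) x0 y0) by (unfold f; now rewrite clamp_id).
assert (Hsg : Rabs (sg - t) < h1).
{ apply Rnot_le_lt; intros Hle.
  assert (S := Hsep sg t Isg ltac:(lra) Hle).
  assert (T := dist2_tri (X sg) (Y sg) x0 y0 (X t) (Y t)); lra. }
assert (Bsg := Hsg); apply Rabs_lt_between in Bsg.
assert (Isg' : 0 < sg < l) by lra.
set (p := dX sg); set (q := dY sg).
assert (Hder : is_derive f sg (2 * ((X sg - x0) * p + (Y sg - y0) * q))).
{ unfold f, dist2.
  assert (D1 := clamp_is_derive X dX (cv_dX cv) sg Isg').
  assert (D2 := clamp_is_derive Y dY (cv_dY cv) sg Isg').
  set (XX := fun s => X (clamp l s)) in *; set (YY := fun s => Y (clamp l s)) in *.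
  change (is_derive (fun s => (XX s - x0) ^ 2 + (YY s - y0) ^ 2) sg (2 * ((X sg - x0) * p + (Y sg - y0) * q))).
  auto_derive; [split; [now exists (dX sg) | split; auto; now exists (dY sg)]|].
  replace (Derive (fun x => XX x) sg) with p by (symmetry; now apply is_derive_unique).
  replace (Derive (fun x => YY x) sg) with q by (symmetry; now apply is_derive_unique).
  unfold XX, YY; rewrite clamp_id by lra; ring. }
assert (H0 : (X sg - x0) * p + (Y sg - y0) * q = 0).
{ assert (pr : derivable_pt f sg).
  { exists (2 * ((X sg - x0) * p + (Y sg - y0) * q)); now apply is_derive_Reals. }
  assert (E := deriv_minimum f 0 l sg pr (proj1 Isg') (proj2 Isg') ltac:(intros x Hx1 Hx2; apply Hmin; lra)).
  rewrite (derive_pt_eq_0 f sg _ pr (proj1 (is_derive_Reals _ _ _) Hder)) in E; lra. }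
assert (Harc : p ^ 2 + q ^ 2 = 1) by (apply arc_closed; lra).
set (de := (x0 - X sg) * - q + (y0 - Y sg) * p).
assert (Ex : x0 - X sg = - de * q).
{ replace (x0 - X sg) with ((x0 - X sg) * (p ^ 2 + q ^ 2)) by (rewrite Harc; ring).
  assert (Hh2 : (x0 - X sg) * p = - ((y0 - Y sg) * q)) by lra.
  unfold de; replace ((x0 - X sg) * (p ^ 2 + q ^ 2)) with (((x0 - X sg) * p) * p + (x0 - X sg) * q ^ 2) by ring.
  rewrite Hh2; ring. }
assert (Ey : y0 - Y sg = de * p).
{ replace (y0 - Y sg) with ((y0 - Y sg) * (p ^ 2 + q ^ 2)) by (rewrite Harc; ring).
  assert (Hh2 : (y0 - Y sg) * q = - ((x0 - X sg) * p)) by lra.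
  unfold de; replace ((y0 - Y sg) * (p ^ 2 + q ^ 2)) with (((y0 - Y sg) * q) * q + (y0 - Y sg) * p ^ 2) by ring.
  rewrite Hh2; ring. }
exists sg, de; repeat split; try lra.
- assert (Hde2 : de ^ 2 = f sg).
  { rewrite Hfsg; unfold dist2.
    replace (X sg - x0) with (de * q) by lra; replace (Y sg - y0) with (- (de * p)) by lra.
    replace ((de * q) ^ 2 + (- (de * p)) ^ 2) with (de ^ 2 * (p ^ 2 + q ^ 2)) by ring.
    rewrite Harc; ring. }
  apply Rnot_le_lt; intros Hle.
  assert (h ^ 2 <= Rabs de ^ 2) by (apply pow_incr; lra).
  rewrite pow2_abs in H; lra.
- unfold offx; fold q; lra.
- unfold offy; fold p; lra.
Qed.

End CurveTopology.
Arguments unit_speed_closed {a b l X Y dX dY}.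
Arguments nearest_point {a b l X Y dX dY}.
Arguments cv_l_pos {a b l X Y dX dY}.
Arguments curve_separation {a b l X Y dX dY}.
Arguments clamp_dY {a b l X Y dX dY}.
Arguments clamp_dX {a b l X Y dX dY}.
Arguments clamp_Y {a b l X Y dX dY}.
Arguments clamp_X {a b l X Y dX dY}.
Arguments arc_closed {a b l X Y dX dY}.

(** * Escaping from the outer side *)

Section Escape.
Variables (a b l : R) (X Y dX dY : R -> R).
Hypothesis cv : curve a b l X Y dX dY.

Lemma X_nonneg s : 0 <= s <= l -> 0 <= X s.
Proof.
intros Hs; destruct (cv_B cv) as [E0 _]; destruct (cv_A cv) as [El _].
pose proof (cv_a cv).
destruct (Req_dec s 0) as [->|H0]; [lra|]; destruct (Req_dec s l) as [->|H1]; [lra|].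
left; apply (cv_quad cv); lra.
Qed.

Lemma dY_0 : dY 0 = 0.
Proof.
assert (Hl := cv_l_pos cv).
destruct (cv_end cv) as (C & del & HC & Hdel & H).
destruct (Req_dec (dY 0) 0) as [E|E]; auto; exfalso.
assert (He : 0 < Rabs (dY 0)) by now apply Rabs_pos_lt.
destruct (cv_dYc cv 0 ltac:(lra) (Rabs (dY 0) / 2) ltac:(lra)) as [d1 [Hd1 H1]].
assert (He2 : 0 < Rabs (dY 0) / (2 * (C + 1))) by (apply Rdiv_lt_0_compat; lra).
destruct (cv_X cv 0 ltac:(lra) _ He2) as [d2 [Hd2 H2]].
set (s := Rmin (Rmin d1 d2) (Rmin del l) / 2).
assert (Hs : 0 < s /\ s < d1 /\ s < d2 /\ s < del /\ s < l).
{ unfold s, Rmin; repeat destruct Rle_dec; lra. }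
assert (Hs0 : Rabs (s - 0) = s) by (rewrite Rminus_0_r; apply Rabs_pos_eq; lra).
specialize (H s ltac:(lra) ltac:(lra)).
specialize (H1 s ltac:(lra) ltac:(lra)); specialize (H2 s ltac:(lra) ltac:(lra)).
destruct (cv_B cv) as [E0 _]; rewrite E0, Rminus_0_r in H2.
pose proof (X_nonneg s ltac:(lra)) as HX; rewrite Rabs_pos_eq in H2 by auto.
assert (C * X s <= Rabs (dY 0) / 2).
{ apply Rle_trans with ((C + 1) * (Rabs (dY 0) / (2 * (C + 1)))); [apply Rmult_le_compat; lra | right; field; lra]. }
assert (T := Rabs_triang (dY 0 - dY s) (dY s)).
rewrite (Rabs_minus_sym (dY 0)) in T; replace (dY 0 - dY s + dY s) with (dY 0) in T by ring.
lra.
Qed.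

(** The tangent at B is a horizontal unit vector, and -1 would make X negative just after B. *)
Lemma dX_0 : dX 0 = 1.
Proof.
assert (Hl := cv_l_pos cv).
assert (E := arc_closed cv 0 ltac:(lra)); rewrite dY_0 in E.
assert (F : (dX 0 - 1) * (dX 0 + 1) = 0) by (simpl in E; lra).
apply Rmult_integral in F; destruct F as [F|F]; [lra|exfalso].
destruct (cv_dXc cv 0 ltac:(lra) (/ 2) ltac:(lra)) as [d [Hd H]].
set (s := Rmin d l / 2).
assert (Hs : 0 < s /\ s < d /\ s < l) by (unfold s, Rmin; destruct Rle_dec; lra).
destruct (MVT_gen (fun z => X (clamp l z)) 0 s dX) as [c [Hc Ec]].
- rewrite Rmin_left, Rmax_right by lra; intros z Hz.
  apply clamp_is_derive; [apply (cv_dX cv) | lra].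
- intros z _; apply continuity_pt_filterlim, (clamp_X cv).
- rewrite Rmin_left, Rmax_right in Hc by lra; rewrite !clamp_id in Ec by lra.
  destruct (cv_B cv) as [E0 _].
  destruct (cv_quad cv s ltac:(lra)) as [HX _].
  assert (Hcd : Rabs (c - 0) < d) by (rewrite Rminus_0_r, Rabs_pos_eq; lra).
  specialize (H c ltac:(lra) Hcd); apply Rabs_lt_between in H.
  assert (dX c * (s - 0) < 0) by nra. lra.
Qed.

Lemma tangents_close : exists h, 0 < h /\ forall s s', 0 <= s <= l -> 0 <= s' <= l ->
  Rabs (s - s') < h -> 0 < dX s * dX s' + dY s * dY s'.
Proof.
apply (compact_uniform_2d (fun s s' h => Rabs (s - s') < h -> 0 < dX s * dX s' + dY s * dY s') 0 l).
- intros x y d d' Hd H Hx; apply H; lra.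
- intros u v Hu Hv; destruct (Req_dec u v) as [<-|Hne].
  + destruct (cv_dXc cv u Hu (/ 4) ltac:(lra)) as [d1 [Hd1 H1]].
    destruct (cv_dYc cv u Hu (/ 4) ltac:(lra)) as [d2 [Hd2 H2]].
    exists (Rmin d1 d2); split; [apply Rmin_pos; lra|].
    intros x y Hx Hy Hxu Hyu _.
    assert (m1 := Rmin_l d1 d2); assert (m2 := Rmin_r d1 d2).
    assert (A1 := H1 x Hx ltac:(lra)); assert (A2 := H1 y Hy ltac:(lra)).
    assert (B1 := H2 x Hx ltac:(lra)); assert (B2 := H2 y Hy ltac:(lra)).
    assert (Ex := arc_closed cv x Hx); assert (Ey := arc_closed cv y Hy).
    apply Rabs_lt_between in A1, A2, B1, B2.
    assert ((dX x - dX y) ^ 2 <= / 4) by nra.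
    assert ((dY x - dY y) ^ 2 <= / 4) by nra.
    nra.
  + exists (Rabs (u - v) / 3); assert (0 < Rabs (u - v)) by (apply Rabs_pos_lt; lra).
    split; [lra|]; intros x y _ _ H1 H2 H3; exfalso.
    assert (T := Rabs_triang (u - x) ((x - y) + (y - v))).
    assert (T' := Rabs_triang (x - y) (y - v)).
    rewrite (Rabs_minus_sym u x) in T.
    replace (u - x + (x - y + (y - v))) with (u - v) in T by ring. lra.
Qed.

(** For s' near s, project on the tangent at s: the offset point has the projection of s, and the
    projection is strictly monotone along the arc, so s' = s and then de = 0. For s' far from s,
    separation gives c <= de^2, which fails for de < min (1, c). *)
Lemma offset_off_curve : exists d0, 0 < d0 /\ forall s s' de, 0 <= s <= l -> 0 <= s' <= l ->
  0 < de < d0 -> ~ (offx X dY s de = X s' /\ offy Y dX s de = Y s').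
Proof.
destruct tangents_close as [h [Hh HT]].
destruct (curve_separation cv h Hh) as [c [Hc Hsep]].
exists (Rmin 1 c); split; [apply Rmin_pos; lra|].
intros s s' de Hs Hs' Hde [E1 E2].
assert (m1 := Rmin_l 1 c); assert (m2 := Rmin_r 1 c).
assert (Ea := arc_closed cv s Hs).
unfold offx, offy in *.
destruct (Rlt_le_dec (Rabs (s - s')) h) as [Hlt|Hge].
- set (phi := fun z => dX s * X (clamp l z) + dY s * Y (clamp l z)).
  destruct (MVT_gen phi s s' (fun z => dX s * dX z + dY s * dY z)) as [z [Hz Ez]].
  + intros z Hz.
    assert (Iz : 0 < z < l) by (revert Hz; unfold Rmin, Rmax; destruct Rle_dec; lra).
    assert (D1 := clamp_is_derive l X dX (cv_dX cv) z Iz).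
    assert (D2 := clamp_is_derive l Y dY (cv_dY cv) z Iz).
    unfold phi; apply (is_derive_plus (fun z => dX s * X (clamp l z)) (fun z => dY s * Y (clamp l z)));
    now apply is_derive_scal.
  + intros z _; apply continuity_pt_filterlim; unfold phi.
    apply lim_plus; apply lim_mult; try apply lim_const;
    [apply (clamp_X cv) | apply (clamp_Y cv)].
  + unfold phi in Ez; rewrite !clamp_id in Ez by auto; rewrite <- E1, <- E2 in Ez.
    replace (dX s * (X s - de * dY s) + dY s * (Y s + de * dX s) - (dX s * X s + dY s * Y s)) with 0 in Ez by ring.
    assert (Iz : 0 <= z <= l) by (revert Hz; unfold Rmin, Rmax; destruct Rle_dec; lra).
    assert (Hzs : Rabs (s - z) < h).
    { eapply Rle_lt_trans; [|apply Hlt]; revert Hz; unfold Rmin, Rmax, Rabs;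
      repeat destruct Rle_dec; repeat destruct Rcase_abs; lra. }
    assert (P := HT s z Hs Iz Hzs).
    symmetry in Ez; apply Rmult_integral in Ez; destruct Ez as [Ez|Ez]; [lra|].
    assert (s' = s) by lra; subst s'.
    assert (de * dY s = 0) by lra; assert (de * dX s = 0) by lra.
    apply Rmult_integral in H, H0; destruct H as [H|H]; [lra|]; destruct H0 as [H0|H0]; [lra|].
    rewrite H, H0 in Ea; simpl in Ea; lra.
- assert (S := Hsep s s' Hs Hs' Hge); rewrite <- E1, <- E2 in S; unfold dist2 in S.
  replace ((X s - (X s - de * dY s)) ^ 2 + (Y s - (Y s + de * dX s)) ^ 2) with
    (de ^ 2 * (dX s ^ 2 + dY s ^ 2)) in S by ring.
  rewrite Ea in S; nra.
Qed.

(** The delicate place is B, where the parallel curve might cross the y-axis. There |dY| <= C X, so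
    for de C < 1 the shift de dY is smaller than X; at s = 0 the point is (0, b + de), above the
    segment. *)
Lemma offset_off_bdry t1 : 0 < t1 < l -> exists d0, 0 < d0 /\ forall s de, 0 <= s <= t1 -> 0 < de < d0 ->
  ~ bdry a b l X Y (offx X dY s de) (offy Y dX s de).
Proof.
intros Ht1.
assert (Hb := cv_b cv).
destruct offset_off_curve as [d1 [Hd1 H1]].
destruct (cv_end cv) as (C & del & HC & Hdel & HE).
destruct (cv_B cv) as [EX0 EY0].
destruct (compact_pos_min (fun s => Y (clamp l s)) 0 t1) as [y0 [Hy0 Hy]]; [lra| | |].
{ intros s _; apply (clamp_Y cv). }
{ intros s Hs; rewrite clamp_id by lra; destruct (Req_dec s 0) as [->|Hn]; [lra|].
  apply (cv_quad cv); lra. }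
set (e1 := Rmin (del / 2) t1).
assert (He1 : 0 < e1 /\ e1 <= t1 /\ e1 < del) by (unfold e1, Rmin; destruct Rle_dec; lra).
destruct (compact_pos_min (fun s => X (clamp l s)) e1 t1) as [x0 [Hx0 Hx]]; [lra| | |].
{ intros s _; apply (clamp_X cv). }
{ intros s Hs; rewrite clamp_id by lra; apply (cv_quad cv); lra. }
set (d0 := Rmin (Rmin d1 y0) (Rmin x0 (/ (C + 1)))).
assert (HC1 : 0 < / (C + 1)) by (apply Rinv_0_lt_compat; lra).
assert (Hd0 : 0 < d0 /\ d0 <= d1 /\ d0 <= y0 /\ d0 <= x0 /\ d0 <= / (C + 1)).
{ unfold d0, Rmin; repeat destruct Rle_dec; lra. }
exists d0; split; [lra|]; intros s de Hs Hde.
assert (Is : 0 <= s <= l) by lra.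
destruct (unit_speed_closed cv s Is) as [U1 U2]; apply Rabs_le_between in U1, U2.
intros [[Ey _]|[[Ex Ey]|(s' & Is' & Ex & Ey)]].
- specialize (Hy s Hs); rewrite clamp_id in Hy by auto; unfold offy in Ey; nra.
- unfold offx, offy in *.
  destruct (Req_dec s 0) as [->|Hn].
  + rewrite dX_0, EY0 in Ey; lra.
  + destruct (Rle_dec e1 s) as [Hle|Hgt].
    * specialize (Hx s ltac:(lra)); rewrite clamp_id in Hx by auto; nra.
    * specialize (HE s ltac:(lra) ltac:(lra)).
      destruct (cv_quad cv s ltac:(lra)) as [HX _].
      apply Rabs_le_between in HE.
      assert (de * (C + 1) < 1).
      { apply Rlt_le_trans with (/ (C + 1) * (C + 1)); [apply Rmult_lt_compat_r; lra | right; field; lra]. }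
      assert (de * dY s <= de * (C * X s)) by (apply Rmult_le_compat_l; lra).
      assert (de * C < 1) by nra.
      assert ((de * C) * X s < 1 * X s) by (apply Rmult_lt_compat_r; lra). lra.
- apply (H1 s s' de Is Is'); [lra | now split].
Qed.

Lemma offset_escapes t1 : 0 < t1 < l -> exists d0, 0 < d0 /\ forall s de, 0 <= s <= t1 -> 0 < de < d0 ->
  escapes a b l X Y (offx X dY s de) (offy Y dX s de).
Proof.
intros Ht1; assert (Hb := cv_b cv).
destruct (offset_off_bdry t1 Ht1) as [d0 [Hd0 H0]].
destruct (cv_B cv) as [EX0 EY0].
exists d0; split; auto; intros s de Hs Hde M.
set (Mm := Rabs M + 1).
assert (HMm : 1 <= Mm) by (unfold Mm; pose proof (Rabs_pos M); lra).
(* Up to u = 1/2 [par] brings the parameter to 0 while the shift [sh] is zero; afterwards the point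
   moves left from (0, b + de), and x < 0 excludes the boundary. *)
set (par := fun u => s * Rmax 0 (1 - 2 * u)).
set (sh := fun u => Mm * Rmax 0 (2 * u - 1)).
assert (Cmax : forall z, continuous (Rmax 0) z).
{ intros z; apply continuous_eps; intros e He; exists e; split; auto; intros y Hy.
  eapply Rle_lt_trans; [|apply Hy]; unfold Rmax, Rabs; repeat destruct Rle_dec; repeat destruct Rcase_abs; lra. }
assert (Cid : forall z : R, continuous (fun u : R => u) z) by (intros z; apply continuous_id).
assert (Cpar : forall z, continuous par z).
{ intros z; unfold par; apply lim_mult; [apply lim_const|].
  apply (lim_comp (Rmax 0)); [apply Cmax|]; apply lim_minus; [apply lim_const|]; apply lim_mult; [apply lim_const | apply Cid]. }
assert (Csh : forall z, continuous sh z).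
{ intros z; unfold sh; apply lim_mult; [apply lim_const|].
  apply (lim_comp (Rmax 0)); [apply Cmax|]; apply lim_minus; [|apply lim_const]; apply lim_mult; [apply lim_const | apply Cid]. }
assert (Ipar : forall u, 0 <= u <= 1 -> 0 <= par u <= s).
{ intros u Hu; unfold par, Rmax; destruct Rle_dec; nra. }
assert (comp : forall f : R -> R, (forall z, continuous (fun s => f (clamp l s)) z) ->
   forall z, continuous (fun u => f (clamp l (par u))) z).
{ intros f Hf z; apply (lim_comp (fun s => f (clamp l s)) par); [apply Hf | apply Cpar]. }
assert (C1 := comp X (clamp_X cv)); assert (C2 := comp Y (clamp_Y cv)).
assert (C3 := comp dX (clamp_dX cv)); assert (C4 := comp dY (clamp_dY cv)).
set (g1 := fun u => offx X dY (clamp l (par u)) de - sh u).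
set (g2 := fun u => offy Y dX (clamp l (par u)) de).
exists g1, g2.
split; [apply continuous_cont_on; intros u _; unfold g1, offx|].
{ apply lim_minus; [|apply Csh]; apply lim_minus; [apply C1|]; apply lim_mult; [apply lim_const | apply C4]. }
split; [apply continuous_cont_on; intros u _; unfold g2, offy|].
{ apply lim_plus; [apply C2|]; apply lim_mult; [apply lim_const | apply C3]. }
assert (par0 : par 0 = s) by (unfold par; rewrite Rmax_right by lra; ring).
assert (sh0 : sh 0 = 0) by (unfold sh; rewrite Rmax_left by lra; ring).
assert (par1 : forall u, / 2 <= u -> par u = 0) by (intros u Hu; unfold par; rewrite Rmax_left by lra; ring).
unfold g1, g2.
split; [rewrite par0, sh0, clamp_id by lra; ring|].
split; [now rewrite par0, clamp_id by lra|].
split.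
- rewrite par1, clamp_id by lra; unfold offx, offy, sh; rewrite dX_0, dY_0, EX0, EY0, Rmax_right by lra.
  assert (Mm <= Mm ^ 2) by nra.
  pose proof (pow2_ge_0 (b + de * 1)); pose proof (Rle_abs M).
  replace ((0 - de * 0 - Mm * (2 * 1 - 1)) ^ 2) with (Mm ^ 2) by ring.
  unfold Mm in *; lra.
- intros u Hu.
  destruct (Rle_dec u (/ 2)) as [Hle|Hgt].
  + replace (sh u) with 0 by (unfold sh; rewrite Rmax_left by lra; ring).
    rewrite Rminus_0_r, clamp_id by (specialize (Ipar u Hu); lra).
    apply H0; [specialize (Ipar u Hu); lra | auto].
  + rewrite par1, clamp_id by lra.
    assert (Hneg : offx X dY 0 de - sh u < 0).
    { unfold offx, sh; rewrite dY_0, EX0, Rmax_right by lra; nra. }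
    intros [[_ [Hx _]]|[[Hx _]|(s' & Is' & Hx & _)]]; [lra | lra |].
    pose proof (X_nonneg s' Is'); lra.
Qed.

End Escape.
Arguments offset_escapes {a b l X Y dX dY}.

(** * Winding number and the inner side *)

(** [reP] and [imP] are the real and imaginary parts of (z - p) times the conjugate of z - q, so
    [angP] is arg (z - p) - arg (z - q), single-valued as long as [reP] is positive. *)
Definition reP (px py qx qy x y : R) : R := (x - px) * (x - qx) + (y - py) * (y - qy).
Definition imP (px py qx qy x y : R) : R := (y - py) * (x - qx) - (x - px) * (y - qy).
Definition angP (px py qx qy x y : R) : R := atan (imP px py qx qy x y / reP px py qx qy x y).

Record c1path (f g f' g' : R -> R) : Prop := {
  c1_f : forall s, is_derive f s (f' s);
  c1_g : forall s, is_derive g s (g' s);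
  c1_f' : forall s, continuous f' s;
  c1_g' : forall s, continuous g' s }.

(* Minus the derivative of the polar angle of [(f, g)] seen from [(px, py)]. *)
Definition omega (f g f' g' : R -> R) (px py s : R) : R :=
  (- g' s * (f s - px) + f' s * (g s - py)) / dist2 (f s) (g s) px py.

Section Paths.
Variables (f g f' g' : R -> R).
Hypothesis pth : c1path f g f' g'.

Lemma c1_cont_f s : continuous f s.
Proof. apply (ex_derive_continuous f); exists (f' s); apply (c1_f _ _ _ _ pth). Qed.
Lemma c1_cont_g s : continuous g s.
Proof. apply (ex_derive_continuous g); exists (g' s); apply (c1_g _ _ _ _ pth). Qed.

Lemma continuous_dist2 px py s : continuous (fun s => dist2 (f s) (g s) px py) s.
Proof.
unfold dist2; apply lim_plus; apply lim_pow; apply lim_minus; try apply lim_const;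
  [apply c1_cont_f | apply c1_cont_g].
Qed.

Lemma omega_continuous px py s : 0 < dist2 (f s) (g s) px py -> continuous (omega f g f' g' px py) s.
Proof.
intros H; unfold omega; apply lim_div; [lra | | apply continuous_dist2].
apply lim_plus; apply lim_mult.
- apply lim_opp, (c1_g' _ _ _ _ pth).
- apply lim_minus; [apply c1_cont_f | apply lim_const].
- apply (c1_f' _ _ _ _ pth).
- apply lim_minus; [apply c1_cont_g | apply lim_const].
Qed.

Lemma omega_ex_RInt px py c d : c <= d -> (forall s, c <= s <= d -> 0 < dist2 (f s) (g s) px py) ->
  ex_RInt (omega f g f' g' px py) c d.
Proof.
intros Hcd H; apply (ex_RInt_continuous (V := R_CompleteNormedModule)).
intros s Hs; rewrite Rmin_left, Rmax_right in Hs by lra; now apply omega_continuous, H.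
Qed.

Lemma reP_pos_dist2 px py qx qy x y : 0 < reP px py qx qy x y ->
  0 < dist2 x y px py /\ 0 < dist2 x y qx qy.
Proof.
intros H; split; apply dist2_pos; intros [-> ->]; revert H; unfold reP; rewrite !Rminus_diag; lra.
Qed.

Lemma is_derive_ang px py qx qy s : 0 < reP px py qx qy (f s) (g s) ->
  is_derive (fun s => - angP px py qx qy (f s) (g s)) s
    (omega f g f' g' px py s - omega f g f' g' qx qy s).
Proof.
intros H; destruct (reP_pos_dist2 _ _ _ _ _ _ H) as [H1 H2].
assert (Hf := c1_f _ _ _ _ pth s); assert (Hg := c1_g _ _ _ _ pth s).
unfold angP, omega; unfold imP, reP, dist2 in *.
auto_derive.
- repeat split; try (now exists (f' s)); try (now exists (g' s)); lra.
- replace (Derive (fun x => f x) s) with (f' s) by (symmetry; now apply is_derive_unique).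
  replace (Derive (fun x => g x) s) with (g' s) by (symmetry; now apply is_derive_unique).
  field; simpl in *; repeat split; try lra.
  assert (E : forall u v w z : R, (u * w + v * z) * (u * w + v * z) + (v * w - u * z) * (v * w - u * z)
     = (u ^ 2 + v ^ 2) * (w ^ 2 + z ^ 2)) by (intros; ring).
  specialize (E (f s - px) (g s - py) (f s - qx) (g s - qy)).
  apply Rgt_not_eq; simpl in E; nra.
Qed.

(** One winding integrand has no global primitive, but the difference of two has [angP] with a minus
    sign, wherever p and q are seen under an acute angle. *)
Lemma RInt_omega_diff px py qx qy c d : c <= d ->
  (forall s, c <= s <= d -> 0 < reP px py qx qy (f s) (g s)) ->
  RInt (omega f g f' g' px py) c d - RInt (omega f g f' g' qx qy) c d
  = angP px py qx qy (f c) (g c) - angP px py qx qy (f d) (g d).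
Proof.
intros Hcd H.
assert (E1 : ex_RInt (omega f g f' g' px py) c d).
{ apply omega_ex_RInt; auto; intros s Hs; now apply (reP_pos_dist2 px py qx qy), H. }
assert (E2 : ex_RInt (omega f g f' g' qx qy) c d).
{ apply omega_ex_RInt; auto; intros s Hs; now apply (reP_pos_dist2 px py qx qy), H. }
rewrite <- (RInt_minus (V := R_CompleteNormedModule)); auto.
apply is_RInt_unique.
replace (angP _ _ _ _ (f c) _ - _) with
  (minus (- angP px py qx qy (f d) (g d)) (- angP px py qx qy (f c) (g c)))
  by (unfold minus, plus, opp; simpl; ring).
apply (is_RInt_derive (fun s => - angP px py qx qy (f s) (g s))
  (fun s => omega f g f' g' px py s - omega f g f' g' qx qy s)).
- intros s Hs; rewrite Rmin_left, Rmax_right in Hs by lra; now apply is_derive_ang, H.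
- intros s Hs; rewrite Rmin_left, Rmax_right in Hs by lra.
  destruct (reP_pos_dist2 _ _ _ _ _ _ (H s Hs)).
  apply lim_minus; now apply omega_continuous.
Qed.

Lemma omega_small px py s K Q : 0 < Q -> 0 <= K -> Rabs (f' s) <= K -> Rabs (g' s) <= K ->
  Q ^ 2 <= dist2 (f s) (g s) px py -> Rabs (omega f g f' g' px py s) <= 2 * K / Q.
Proof.
intros HQ HK H1 H2 H3; unfold omega.
set (r2 := dist2 (f s) (g s) px py) in *; set (r := sqrt r2).
assert (HQ2 : 0 < Q ^ 2) by now apply pow_lt.
destruct (sqrt_dominates (f s - px) (g s - py)) as [A B].
change ((f s - px) ^ 2 + (g s - py) ^ 2) with r2 in A, B; fold r in A, B.
assert (Hr : Q <= r).
{ unfold r; rewrite <- (sqrt_pow2 Q) by lra; now apply sqrt_le_1_alt. }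
assert (Er : r * r = r2) by (apply sqrt_sqrt; lra).
rewrite <- Er.
apply Rle_trans with ((K * r + K * r) / (r * r)).
- apply Rabs_div_le; [|nra|lra].
  apply Rabs_plus_le; apply Rabs_mult_le; auto; now rewrite Rabs_Ropp.
- replace ((K * r + K * r) / (r * r)) with (2 * K * / r) by (field; lra).
  apply Rmult_le_compat_l; [lra | now apply Rinv_le_contravar].
Qed.
End Paths.

(** Here q is within a quarter of the distance from z to p, so the angle at z is less than pi / 4.
    The numerical bound on the angle serves in the jump of the winding integral. *)
Lemma reP_pos_close px py qx qy x y c : 0 < c -> c <= dist2 x y px py -> dist2 px py qx qy <= c / 16 ->
  0 < reP px py qx qy x y /\ Rabs (angP px py qx qy x y) <= PI / 4.
Proof.
intros Hc H1 H2; unfold dist2, reP, imP, angP in *.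
set (A := x - px) in *; set (B := y - py) in *.
replace (x - qx) with (A + (px - qx)) by (unfold A; ring).
replace (y - qy) with (B + (py - qy)) by (unfold B; ring).
set (D := px - qx) in *; set (E := py - qy) in *.
assert (S : forall u v, - (u ^ 2 / 8 + 2 * v ^ 2) <= u * v <= u ^ 2 / 8 + 2 * v ^ 2).
{ intros u v; pose proof (pow2_ge_0 (u + 4 * v)); pose proof (pow2_ge_0 (u - 4 * v)); nra. }
assert (S1 := S A D); assert (S2 := S B E); assert (S3 := S A E); assert (S4 := S B D).
assert (HR : 0 < A * (A + D) + B * (B + E)) by nra.
split; auto.
unfold imP, reP; fold A B; replace (x - qx) with (A + D) by (unfold A, D; ring).
replace (y - qy) with (B + E) by (unfold B, E; ring).
set (R0 := A * (A + D) + B * (B + E)) in *; set (I0 := B * (A + D) - A * (B + E)).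
assert (HI : - R0 <= I0 <= R0) by (unfold I0, R0; nra).
assert (H01 : -1 <= I0 / R0 <= 1).
{ split; [apply Rle_div_intro; lra | apply Rdiv_le_intro; lra]. }
assert (mono : forall u v, u <= v -> atan u <= atan v).
{ intros u v [Huv| ->]; [left; now apply atan_increasing | lra]. }
rewrite <- atan_1; apply Rabs_le; split; [rewrite <- atan_opp|]; apply mono; lra.
Qed.

Section Winding.
Variables (a b l : R) (X Y dX dY : R -> R).
Hypothesis cv : curve a b l X Y dX dY.

(* C^1 extension to the whole line of a function on [0, l] with derivative [df]. *)
Definition ext (f df : R -> R) (s : R) : R := f 0 + RInt (fun z => df (clamp l z)) 0 s.

Lemma ext_derive f df : (forall s, continuous (fun z => df (clamp l z)) s) ->
  forall s, is_derive (ext f df) s (df (clamp l s)).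
Proof.
intros C s; unfold ext.
replace (df (clamp l s)) with (0 + df (clamp l s)) by ring.
apply (is_derive_plus (fun _ => f 0) (fun s => RInt (fun z => df (clamp l z)) 0 s)).
- apply (is_derive_const (f 0) s).
- apply (is_derive_RInt (fun z => df (clamp l z)) (fun s => RInt (fun z => df (clamp l z)) 0 s) 0 s).
  + apply filter_forall; intros y; apply (RInt_correct (V := R_CompleteNormedModule)).
    apply (ex_RInt_continuous (V := R_CompleteNormedModule)); intros z _; apply C.
  + apply C.
Qed.

Lemma ext_eq f df : 0 < l -> (forall s, continuous (fun z => f (clamp l z)) s) ->
  (forall s, continuous (fun z => df (clamp l z)) s) ->
  (forall s, 0 < s < l -> is_derive f s (df s)) -> forall s, 0 <= s <= l -> ext f df s = f s.
Proof.
intros Hl Cf Cdf Hf s Hs.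
destruct (MVT_gen (fun z => ext f df z - f (clamp l z)) 0 s (fun _ => 0)) as [z [_ E]].
- rewrite Rmin_left, Rmax_right by lra; intros z Hz.
  replace 0 with (df (clamp l z) - df z) by (rewrite clamp_id by lra; ring).
  apply (is_derive_minus (ext f df) (fun z => f (clamp l z))); [now apply ext_derive|].
  apply clamp_is_derive; auto; lra.
- intros z _; apply continuity_pt_filterlim; apply lim_minus; [|apply Cf].
  apply (ex_derive_continuous (ext f df)); exists (df (clamp l z)); now apply ext_derive.
- rewrite !clamp_id in E by lra.
  assert (E0 : ext f df 0 = f 0).
  { unfold ext; rewrite RInt_point; unfold zero; simpl; ring. }
  lra.
Qed.

Definition Xe := ext X dX.
Definition Ye := ext Y dY.
Definition dXe s := dX (clamp l s).
Definition dYe s := dY (clamp l s).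

Lemma gamma_path : c1path Xe Ye dXe dYe.
Proof.
constructor.
- apply ext_derive, (clamp_dX cv).
- apply ext_derive, (clamp_dY cv).
- apply (clamp_dX cv).
- apply (clamp_dY cv).
Qed.

Lemma Xe_eq s : 0 <= s <= l -> Xe s = X s.
Proof.
apply ext_eq; [apply (cv_l_pos cv) | apply (clamp_X cv)
  | apply (clamp_dX cv) | apply (cv_dX cv)].
Qed.
Lemma Ye_eq s : 0 <= s <= l -> Ye s = Y s.
Proof.
apply ext_eq; [apply (cv_l_pos cv) | apply (clamp_Y cv)
  | apply (clamp_dY cv) | apply (cv_dY cv)].
Qed.

(** The axes are run from A to the origin and from the origin to B, closing the arc from B to A. *)
Definition s1f s := a * (1 - s).
Definition s2g s := b * s.
Definition cst (k : R) : R -> R := fun _ => k.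

Lemma seg1_path : c1path s1f (cst 0) (cst (- a)) (cst 0).
Proof.
constructor; intros s; try apply continuous_const.
- unfold s1f, cst; auto_derive; auto; ring.
- apply (is_derive_const 0 s).
Qed.
Lemma seg2_path : c1path (cst 0) s2g (cst 0) (cst b).
Proof.
constructor; intros s; try apply continuous_const.
- apply (is_derive_const 0 s).
- unfold s2g, cst; auto_derive; auto; ring.
Qed.

Definition omG px py := omega Xe Ye dXe dYe px py.
Definition om1 px py := omega s1f (cst 0) (cst (- a)) (cst 0) px py.
Definition om2 px py := omega (cst 0) s2g (cst 0) (cst b) px py.

(* [-2 pi] times the winding number of the closed contour around [(px, py)]. *)
Definition wind (px py : R) : R :=
  RInt (omG px py) 0 l + RInt (om1 px py) 0 1 + RInt (om2 px py) 0 1.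

Lemma bdry_gamma s : 0 <= s <= l -> bdry a b l X Y (Xe s) (Ye s).
Proof. intros Hs; right; right; exists s; rewrite Xe_eq, Ye_eq; auto. Qed.
Lemma bdry_seg1 s : 0 <= s <= 1 -> bdry a b l X Y (s1f s) (cst 0 s).
Proof. intros Hs; left; unfold s1f, cst; pose proof (cv_a cv); split; [auto | nra]. Qed.
Lemma bdry_seg2 s : 0 <= s <= 1 -> bdry a b l X Y (cst 0 s) (s2g s).
Proof. intros Hs; right; left; unfold s2g, cst; pose proof (cv_b cv); split; [auto | nra]. Qed.

Lemma wind_axes_diff px py qx qy :
  (forall s, 0 <= s <= 1 -> 0 < reP px py qx qy (s1f s) (cst 0 s)) ->
  (forall s, 0 <= s <= 1 -> 0 < reP px py qx qy (cst 0 s) (s2g s)) ->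
  (RInt (om1 px py) 0 1 - RInt (om1 qx qy) 0 1) + (RInt (om2 px py) 0 1 - RInt (om2 qx qy) 0 1)
  = angP px py qx qy a 0 - angP px py qx qy 0 b.
Proof.
intros H1 H2.
unfold om1, om2; rewrite (RInt_omega_diff _ _ _ _ seg1_path) by (auto; lra).
rewrite (RInt_omega_diff _ _ _ _ seg2_path) by (auto; lra).
unfold s1f, s2g, cst; replace (a * (1 - 0)) with a by ring; replace (a * (1 - 1)) with 0 by ring.
rewrite Rmult_0_r, Rmult_1_r; ring.
Qed.

(** The values of [angP] at the ends of the pieces cancel around the closed contour. *)
Lemma wind_const_close px py qx qy :
  (forall x y, bdry a b l X Y x y -> 0 < reP px py qx qy x y) -> wind px py = wind qx qy.
Proof.
intros H; assert (Hl := cv_l_pos cv).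
assert (EG : RInt (omG px py) 0 l - RInt (omG qx qy) 0 l = angP px py qx qy 0 b - angP px py qx qy a 0).
{ unfold omG; rewrite (RInt_omega_diff _ _ _ _ gamma_path); [|lra|].
  - rewrite !Xe_eq, !Ye_eq by lra.
    destruct (cv_B cv) as [-> ->]; destruct (cv_A cv) as [-> ->]; auto.
  - intros s Hs; apply H; now apply bdry_gamma. }
assert (EA := wind_axes_diff px py qx qy (fun s Hs => H _ _ (bdry_seg1 s Hs)) (fun s Hs => H _ _ (bdry_seg2 s Hs))).
unfold wind; lra.
Qed.

Lemma bdry_cases (P : R -> R -> Prop) :
  (forall s, 0 <= s <= l -> P (Xe s) (Ye s)) -> (forall s, 0 <= s <= 1 -> P (s1f s) (cst 0 s)) ->
  (forall s, 0 <= s <= 1 -> P (cst 0 s) (s2g s)) -> forall x y, bdry a b l X Y x y -> P x y.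
Proof.
intros H1 H2 H3 x y [[-> Hx]|[[-> Hy]|(s & Hs & -> & ->)]].
- assert (Ha := cv_a cv).
  specialize (H2 (1 - x / a)); unfold s1f, cst in H2.
  replace (a * (1 - (1 - x / a))) with x in H2 by (field; lra); apply H2.
  assert (0 <= x / a <= 1) by (split; [apply Rdiv_le_0_compat; lra | apply Rdiv_le_intro; lra]); lra.
- assert (Hb := cv_b cv).
  specialize (H3 (y / b)); unfold s2g, cst in H3.
  replace (b * (y / b)) with y in H3 by (field; lra); apply H3.
  split; [apply Rdiv_le_0_compat; lra | apply Rdiv_le_intro; lra].
- rewrite <- Xe_eq, <- Ye_eq by auto; now apply H1.
Qed.

Lemma bdry_dist px py : ~ bdry a b l X Y px py ->
  exists c, 0 < c /\ forall x y, bdry a b l X Y x y -> c <= dist2 x y px py.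
Proof.
intros Hn; assert (Hl := cv_l_pos cv).
assert (Hp : forall x y, bdry a b l X Y x y -> 0 < dist2 x y px py).
{ intros x y Hb; apply dist2_pos; intros [-> ->]; now apply Hn. }
destruct (compact_pos_min (fun s => dist2 (Xe s) (Ye s) px py) 0 l) as [c1 [Hc1 H1]]; [lra| | |].
{ intros s _; apply (continuous_dist2 _ _ _ _ gamma_path). }
{ intros s Hs; now apply Hp, bdry_gamma. }
destruct (compact_pos_min (fun s => dist2 (s1f s) (cst 0 s) px py) 0 1) as [c2 [Hc2 H2]]; [lra| | |].
{ intros s _; apply (continuous_dist2 _ _ _ _ seg1_path). }
{ intros s Hs; now apply Hp, bdry_seg1. }
destruct (compact_pos_min (fun s => dist2 (cst 0 s) (s2g s) px py) 0 1) as [c3 [Hc3 H3]]; [lra| | |].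
{ intros s _; apply (continuous_dist2 _ _ _ _ seg2_path). }
{ intros s Hs; now apply Hp, bdry_seg2. }
exists (Rmin c1 (Rmin c2 c3)); split; [repeat apply Rmin_pos; auto|].
assert (m : Rmin c1 (Rmin c2 c3) <= c1 /\ Rmin c1 (Rmin c2 c3) <= c2 /\ Rmin c1 (Rmin c2 c3) <= c3)
  by (unfold Rmin; repeat destruct Rle_dec; lra).
apply bdry_cases; intros s Hs; [specialize (H1 s Hs) | specialize (H2 s Hs) | specialize (H3 s Hs)]; lra.
Qed.

(** The winding integral is locally constant off the boundary, so its composition with the path has
    derivative zero everywhere. *)
Lemma wind_along_path (g1 g2 : R -> R) : cont_on g1 0 1 -> cont_on g2 0 1 ->
  (forall u, 0 <= u <= 1 -> ~ bdry a b l X Y (g1 u) (g2 u)) -> wind (g1 1) (g2 1) = wind (g1 0) (g2 0).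
Proof.
intros C1 C2 Hn.
set (phi := fun u => wind (g1 (clamp 1 u)) (g2 (clamp 1 u))).
assert (D : forall u, is_derive phi u 0).
{ intros u.
  destruct (bdry_dist (g1 (clamp 1 u)) (g2 (clamp 1 u))) as [c [Hc H]].
  { apply Hn, clamp_in; lra. }
  assert (K1 := cont_on_clamp g1 1 u Rlt_0_1 C1); assert (K2 := cont_on_clamp g2 1 u Rlt_0_1 C2).
  set (e := Rmin 1 (c / 32)).
  assert (He : 0 < e) by (apply Rmin_pos; lra).
  assert (e1 : e <= 1) by apply Rmin_l; assert (e2 : e <= c / 32) by apply Rmin_r.
  destruct (proj1 (continuous_eps _ _) K1 e He) as [d1 [Hd1 H1]].
  destruct (proj1 (continuous_eps _ _) K2 e He) as [d2 [Hd2 H2]].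
  apply is_derive_ext_loc with (fun _ => phi u); [|apply (is_derive_const (phi u) u)].
  assert (Hm : 0 < Rmin d1 d2) by (apply Rmin_pos; auto).
  exists (mkposreal _ Hm); intros v Hv.
  assert (Hv' : Rabs (v - u) < Rmin d1 d2) by exact Hv.
  assert (Hv1 := Rlt_le_trans _ _ _ Hv' (Rmin_l _ _)); assert (Hv2 := Rlt_le_trans _ _ _ Hv' (Rmin_r _ _)).
  specialize (H1 v Hv1); specialize (H2 v Hv2).
  change (wind (g1 (clamp 1 u)) (g2 (clamp 1 u)) = wind (g1 (clamp 1 v)) (g2 (clamp 1 v))).
  apply wind_const_close; intros x y Hb.
  apply (reP_pos_close _ _ _ _ _ _ c); auto.
  unfold dist2.
  assert ((g1 (clamp 1 u) - g1 (clamp 1 v)) ^ 2 <= e ^ 2).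
  { rewrite <- pow2_abs, Rabs_minus_sym; apply pow_incr; split; [apply Rabs_pos | lra]. }
  assert ((g2 (clamp 1 u) - g2 (clamp 1 v)) ^ 2 <= e ^ 2).
  { rewrite <- pow2_abs, Rabs_minus_sym; apply pow_incr; split; [apply Rabs_pos | lra]. }
  assert (e ^ 2 <= e) by nra. lra. }
assert (B := MVT_bound phi (fun _ => 0) 0 1 0 (fun x _ => D x) ltac:(intros; cbv beta; rewrite Rabs_R0; lra)).
rewrite Rmult_0_l in B; unfold phi in B; rewrite !clamp_id in B by lra.
pose proof (Rabs_pos (wind (g1 1) (g2 1) - wind (g1 0) (g2 0))).
assert (E : Rabs (wind (g1 1) (g2 1) - wind (g1 0) (g2 0)) = 0) by lra.
apply Rabs_eq_0 in E; lra.
Qed.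

(** At distance Q from the boundary the integrand is O(1/Q). The value being constant along escaping
    paths, it is smaller than every multiple of 1/Q; integrality of the winding number does not
    enter. *)
Lemma wind_escapes px py : escapes a b l X Y px py -> wind px py = 0.
Proof.
intros He; assert (Hl := cv_l_pos cv).
assert (Ha := cv_a cv); assert (Hb := cv_b cv).
destruct (cont_on_bounded X l Hl (cv_X cv)) as [B1 [HB1 HX]].
destruct (cont_on_bounded Y l Hl (cv_Y cv)) as [B2 [HB2 HY]].
set (K := B1 + B2 + a + b + 1).
assert (HK : 0 < K) by (unfold K; lra).
assert (small : forall Q, 0 < Q -> Rabs (wind px py) <= (l + 2) * (2 * K / Q)).
{ intros Q HQ.
  (* By |q|^2 <= 2 |q - z|^2 + 2 |z|^2 and |z|^2 <= 2 K^2 on the boundary, this threshold puts q at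
     distance at least Q. *)
  destruct (He (2 * (Q ^ 2 + 2 * K ^ 2))) as (g1 & g2 & C1 & C2 & E1 & E2 & Hfar & Hn).
  rewrite <- E1, <- E2, <- (wind_along_path g1 g2 C1 C2 Hn).
  set (qx := g1 1) in *; set (qy := g2 1) in *.
  assert (HQ2 : 0 < Q ^ 2) by now apply pow_lt.
  assert (far : forall x y, Rabs x <= K -> Rabs y <= K -> Q ^ 2 <= dist2 x y qx qy).
  { intros x y Hx Hy.
    assert (T := dist2_tri qx qy x y 0 0); rewrite (dist2_sym qx qy x y) in T.
    assert (x ^ 2 <= K ^ 2) by (rewrite <- pow2_abs; apply pow_incr; split; [apply Rabs_pos | lra]).
    assert (y ^ 2 <= K ^ 2) by (rewrite <- pow2_abs; apply pow_incr; split; [apply Rabs_pos | lra]).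
    unfold dist2 at 1 3 in T; rewrite !Rminus_0_r in T; lra. }
  assert (bd : forall f g f' g' c d, c1path f g f' g' -> c <= d ->
    (forall s, c <= s <= d -> Rabs (f s) <= K /\ Rabs (g s) <= K /\ Rabs (f' s) <= K /\ Rabs (g' s) <= K) ->
    Rabs (RInt (omega f g f' g' qx qy) c d) <= (d - c) * (2 * K / Q)).
  { intros f g f' g' c d Hp Hcd Hs.
    apply abs_RInt_le_const; auto.
    - apply omega_ex_RInt; auto; intros s Is; destruct (Hs s Is) as (F1 & F2 & _).
      specialize (far _ _ F1 F2); lra.
    - intros s Is; destruct (Hs s Is) as (F1 & F2 & F3 & F4); apply omega_small; auto; lra. }
  replace ((l + 2) * (2 * K / Q)) with ((l - 0) * (2 * K / Q) + (1 - 0) * (2 * K / Q) + (1 - 0) * (2 * K / Q)) by ring.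
  unfold wind; apply Rabs_plus_le; [apply Rabs_plus_le|].
  - apply (bd _ _ _ _ 0 l gamma_path); [lra|]; intros s Is.
    rewrite Xe_eq, Ye_eq by auto; unfold dXe, dYe; rewrite clamp_id by auto.
    destruct (unit_speed_closed cv s Is); specialize (HX s Is); specialize (HY s Is).
    unfold K; repeat split; lra.
  - apply (bd _ _ _ _ 0 1 seg1_path); [lra|]; intros s Is; unfold s1f, cst.
    rewrite Rabs_R0, Rabs_Ropp, (Rabs_pos_eq a), Rabs_pos_eq by nra; unfold K; repeat split; nra.
  - apply (bd _ _ _ _ 0 1 seg2_path); [lra|]; intros s Is; unfold s2g, cst.
    rewrite Rabs_R0, (Rabs_pos_eq b), Rabs_pos_eq by nra; unfold K; repeat split; nra. }
destruct (Req_dec (wind px py) 0) as [E|E]; auto; exfalso.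
assert (Hw : 0 < Rabs (wind px py)) by now apply Rabs_pos_lt.
specialize (small ((l + 2) * (2 * K) * 2 / Rabs (wind px py))).
assert (P : 0 < (l + 2) * (2 * K) * 2 / Rabs (wind px py)).
{ apply Rdiv_lt_0_compat; auto; nra. }
specialize (small P).
replace ((l + 2) * (2 * K / ((l + 2) * (2 * K) * 2 / Rabs (wind px py)))) with (Rabs (wind px py) / 2) in small
  by (field; repeat split; lra).
lra.
Qed.

End Winding.
Arguments gamma_path {a b l X Y dX dY}.
Arguments Ye_eq {a b l X Y dX dY}.
Arguments Xe_eq {a b l X Y dX dY}.

(** * The Poisson kernel and the two sides of the curve *)

Definition poisson (sg de s : R) : R := de / ((s - sg) ^ 2 + de ^ 2).

Lemma poisson_den_pos sg de s : de <> 0 -> 0 < (s - sg) ^ 2 + de ^ 2.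
Proof. intros H; pose proof (pow2_ge_0 (s - sg)); pose proof (pow2_gt_0 de H); lra. Qed.

Lemma continuous_poisson sg de s : de <> 0 -> continuous (poisson sg de) s.
Proof.
intros H; pose proof (poisson_den_pos sg de s H).
apply (ex_derive_continuous (poisson sg de)); unfold poisson; auto_derive; simpl in *; lra.
Qed.

Lemma is_RInt_poisson sg de c d : de <> 0 ->
  is_RInt (poisson sg de) c d (atan ((d - sg) / de) - atan ((c - sg) / de)).
Proof.
intros H.
apply (is_RInt_derive (fun s => atan ((s - sg) / de)) (poisson sg de)).
- intros s _; pose proof (poisson_den_pos sg de s H).
  unfold poisson; auto_derive; auto; field; simpl in *; repeat split; auto; nra.
- intros s _; now apply continuous_poisson.
Qed.

Lemma atan_le u v : u <= v -> atan u <= atan v.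
Proof. intros [H| ->]; [left; now apply atan_increasing | lra]. Qed.

Section Sides.
Variables (a b l : R) (X Y dX dY : R -> R).
Hypothesis cv : curve a b l X Y dX dY.

Notation Wn := (wind a b l X Y dX dY).

(** Compare the two mirror points. Outside a window around t the angles telescope to the two ends of
    the window, at most pi / 4 each. Inside, the integrands are Poisson kernels of opposite sign up
    to bounded errors, and their integrals differ by at least pi - 1/2. As pi - 1/2 > pi / 2, the
    values differ; the exact jump is not computed. *)
Lemma wind_jump t : 0 < t < l -> exists h, 0 < h /\ forall sg de, Rabs (sg - t) < h -> 0 < de < h ->
  Wn (offx X dY sg de) (offy Y dX sg de) <> Wn (offx X dY sg (- de)) (offy Y dX sg (- de)).
Proof.
intros Ht.
destruct (local_geometry cv t Ht) as (h0 & C0 & Hh0 & HC0 & Hl0 & Hr0 & HG).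
destruct (cv_quad cv t Ht) as [HXt HYt].
assert (Hi : 0 < / (8 * (C0 + 1))) by (apply Rinv_0_lt_compat; lra).
(* The window has length 2 h1, so the two bounded errors together integrate to at most 4 h1 C0 <=
   1/2. *)
set (h1 := Rmin (h0 / 2) (/ (8 * (C0 + 1)))).
assert (Hh1 : 0 < h1 /\ h1 <= h0 / 2 /\ h1 <= / (8 * (C0 + 1))) by (unfold h1, Rmin; destruct Rle_dec; lra).
assert (HhC : 4 * h1 * C0 <= / 2).
{ apply Rle_trans with (4 * / (8 * (C0 + 1)) * (C0 + 1)); [apply Rmult_le_compat; lra | right; field; lra]. }
destruct (curve_separation cv h1 (proj1 Hh1)) as [c1 [Hc1 Hsep]].
assert (HX2 : 0 < X t ^ 2) by now apply pow_lt. assert (HY2 : 0 < Y t ^ 2) by now apply pow_lt.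
set (c := Rmin c1 (Rmin (X t ^ 2) (Y t ^ 2))).
assert (Hc : 0 < c /\ c <= c1 /\ c <= X t ^ 2 /\ c <= Y t ^ 2).
{ unfold c, Rmin; repeat destruct Rle_dec; lra. }
set (h := Rmin (Rmin 1 (h1 / 2)) (c / 256)).
assert (Hh : 0 < h /\ h <= 1 /\ h <= h1 / 2 /\ h <= c / 256) by (unfold h, Rmin; repeat destruct Rle_dec; lra).
exists h; split; [lra|]; intros sg de Hsg Hde.
assert (Bsg := Hsg); apply Rabs_lt_between in Bsg.
assert (Isg : 0 < sg < l) by lra.
assert (Ade : Rabs de < h) by (rewrite Rabs_pos_eq; lra).
destruct (offset_near cv sg t de Isg Ht) as [O1 O2].
set (px := offx X dY sg de) in *; set (py := offy Y dX sg de) in *.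
set (qx := offx X dY sg (- de)); set (qy := offy Y dX sg (- de)).
assert (Hpt : dist2 px py (X t) (Y t) <= c / 4).
{ unfold dist2.
  assert ((px - X t) ^ 2 <= (2 * h) ^ 2) by (rewrite <- pow2_abs; apply pow_incr; split; [apply Rabs_pos | lra]).
  assert ((py - Y t) ^ 2 <= (2 * h) ^ 2) by (rewrite <- pow2_abs; apply pow_incr; split; [apply Rabs_pos | lra]).
  assert (h ^ 2 <= h) by nra. lra. }
assert (Hpq : dist2 px py qx qy <= c / 4 / 16).
{ replace (dist2 px py qx qy) with (4 * de ^ 2 * (dX sg ^ 2 + dY sg ^ 2))
    by (unfold dist2, px, py, qx, qy, offx, offy; ring).
  rewrite (arc_closed cv) by lra.
  assert (de ^ 2 <= h) by nra. lra. }
assert (away : forall x y, c <= dist2 x y (X t) (Y t) ->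
  0 < reP px py qx qy x y /\ Rabs (angP px py qx qy x y) <= PI / 4).
{ intros x y Hxy; apply (reP_pos_close _ _ _ _ _ _ (c / 4)); auto; [lra|].
  assert (T := dist2_tri x y px py (X t) (Y t)); lra. }
assert (awayG : forall s, 0 <= s <= l -> h1 <= Rabs (s - t) ->
  0 < reP px py qx qy (Xe l X dX s) (Ye l Y dY s) /\ Rabs (angP px py qx qy (Xe l X dX s) (Ye l Y dY s)) <= PI / 4).
{ intros s Hs Hst; apply away; rewrite (Xe_eq cv), (Ye_eq cv) by auto.
  specialize (Hsep s t Hs ltac:(lra) Hst); lra. }
intros HW; unfold wind in HW.
assert (EA := wind_axes_diff a b px py qx qy).
lapply EA; [clear EA; intros EA | intros s Hs; apply away; unfold dist2, cst; pose proof (pow2_ge_0 (s1f a s - X t)); rewrite Rminus_0_l; replace ((- Y t) ^ 2) with (Y t ^ 2) by ring; lra].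
lapply EA; [clear EA; intros EA | intros s Hs; apply away; unfold dist2, cst; pose proof (pow2_ge_0 (s2g b s - Y t)); rewrite Rminus_0_l; replace ((- X t) ^ 2) with (X t ^ 2) by ring; lra].
set (om := omG l X Y dX dY) in *.
assert (gp := gamma_path cv).
assert (Abs1 : forall s, s <= t - h1 -> h1 <= Rabs (s - t)).
{ intros s Hs; rewrite Rabs_left1; lra. }
assert (Abs2 : forall s, t + h1 <= s -> h1 <= Rabs (s - t)).
{ intros s Hs; rewrite Rabs_pos_eq; lra. }
assert (D1 : RInt (om px py) 0 (t - h1) - RInt (om qx qy) 0 (t - h1)
  = angP px py qx qy 0 b - angP px py qx qy (Xe l X dX (t - h1)) (Ye l Y dY (t - h1))).
{ unfold om, omG; rewrite (RInt_omega_diff _ _ _ _ gp); [|lra|].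
  - rewrite (Xe_eq cv 0), (Ye_eq cv 0) by lra.
    now destruct (cv_B cv) as [-> ->].
  - intros s Hs; apply awayG; [lra | apply Abs1; lra]. }
assert (D2 : RInt (om px py) (t + h1) l - RInt (om qx qy) (t + h1) l
  = angP px py qx qy (Xe l X dX (t + h1)) (Ye l Y dY (t + h1)) - angP px py qx qy a 0).
{ unfold om, omG; rewrite (RInt_omega_diff _ _ _ _ gp); [|lra|].
  - rewrite (Xe_eq cv l), (Ye_eq cv l) by lra.
    now destruct (cv_A cv) as [-> ->].
  - intros s Hs; apply awayG; [lra | apply Abs2; lra]. }
assert (win : forall s, t - h1 <= s <= t + h1 -> forall d, Rabs d = de ->
  0 < dist2 (Xe l X dX s) (Ye l Y dY s) (offx X dY sg d) (offy Y dX sg d) /\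
  Rabs (om (offx X dY sg d) (offy Y dX sg d) s + poisson sg d s) <= C0).
{ intros s Hs d Hd.
  assert (Hst : Rabs (s - t) < h0) by (apply Rabs_def1; lra).
  destruct (HG s sg d) as [G1 G2]; try lra; cbv zeta in G1, G2.
  assert (Hdn : d <> 0) by (intros ->; rewrite Rabs_R0 in Hd; lra).
  assert (P := poisson_den_pos sg d s Hdn).
  unfold om, omG, omega, dXe, dYe.
  rewrite (Xe_eq cv), (Ye_eq cv), clamp_id by lra.
  split; [lra | now apply G2]. }
assert (win1 := fun s Hs => win s Hs de ltac:(apply Rabs_pos_eq; lra)).
assert (win2 := fun s Hs => win s Hs (- de) ltac:(rewrite Rabs_Ropp; apply Rabs_pos_eq; lra)).
fold px py in win1; fold qx qy in win2.
assert (exA : forall x y c d, c <= d -> (forall s, c <= s <= d -> 0 < dist2 (Xe l X dX s) (Ye l Y dY s) x y) ->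
  ex_RInt (om x y) c d).
{ intros x y c' d' Hcd H; unfold om, omG; now apply (omega_ex_RInt _ _ _ _ gp). }
assert (e1 : ex_RInt (om px py) 0 (t - h1)).
{ apply exA; [lra|]; intros s Hs; apply (reP_pos_dist2 px py qx qy), awayG; [lra | apply Abs1; lra]. }
assert (e2 : ex_RInt (om qx qy) 0 (t - h1)).
{ apply exA; [lra|]; intros s Hs; apply (reP_pos_dist2 px py qx qy), awayG; [lra | apply Abs1; lra]. }
assert (e3 : ex_RInt (om px py) (t + h1) l).
{ apply exA; [lra|]; intros s Hs; apply (reP_pos_dist2 px py qx qy), awayG; [lra | apply Abs2; lra]. }
assert (e4 : ex_RInt (om qx qy) (t + h1) l).
{ apply exA; [lra|]; intros s Hs; apply (reP_pos_dist2 px py qx qy), awayG; [lra | apply Abs2; lra]. }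
assert (e5 : ex_RInt (om px py) (t - h1) (t + h1)) by (apply exA; [lra|]; intros s Hs; now apply win1).
assert (e6 : ex_RInt (om qx qy) (t - h1) (t + h1)) by (apply exA; [lra|]; intros s Hs; now apply win2).
assert (Ch : forall f, ex_RInt f 0 (t - h1) -> ex_RInt f (t - h1) (t + h1) -> ex_RInt f (t + h1) l ->
  RInt f 0 l = RInt f 0 (t - h1) + RInt f (t - h1) (t + h1) + RInt f (t + h1) l).
{ intros f E1 E2 E3.
  rewrite <- (RInt_Chasles (V := R_CompleteNormedModule) f 0 (t + h1) l); auto.
  - rewrite <- (RInt_Chasles (V := R_CompleteNormedModule) f 0 (t - h1) (t + h1)); auto.
  - now apply ex_RInt_Chasles with (t - h1). }
rewrite (Ch (om px py)), (Ch (om qx qy)) in HW by auto.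
assert (nz1 : de <> 0) by lra; assert (nz2 : - de <> 0) by lra.
set (P1 := RInt (om px py) (t - h1) (t + h1)) in *; set (P2 := RInt (om qx qy) (t - h1) (t + h1)) in *.
assert (I1 : Rabs (P1 + (atan ((t + h1 - sg) / de) - atan ((t - h1 - sg) / de))) <= 2 * h1 * C0).
{ rewrite <- (is_RInt_unique _ _ _ _ (is_RInt_poisson sg de (t - h1) (t + h1) nz1)).
  assert (ep : ex_RInt (poisson sg de) (t - h1) (t + h1)) by (eexists; now apply is_RInt_poisson).
  unfold P1; rewrite <- (RInt_plus (V := R_CompleteNormedModule)); auto.
  replace (2 * h1 * C0) with ((t + h1 - (t - h1)) * C0) by ring.
  apply abs_RInt_le_const; [lra | now apply (ex_RInt_plus (V := R_NormedModule)) |].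
  intros s Hs; now apply win1. }
assert (I2 : Rabs (P2 + (atan ((t + h1 - sg) / - de) - atan ((t - h1 - sg) / - de))) <= 2 * h1 * C0).
{ rewrite <- (is_RInt_unique _ _ _ _ (is_RInt_poisson sg (- de) (t - h1) (t + h1) nz2)).
  assert (ep : ex_RInt (poisson sg (- de)) (t - h1) (t + h1)) by (eexists; now apply is_RInt_poisson).
  unfold P2; rewrite <- (RInt_plus (V := R_CompleteNormedModule)); auto.
  replace (2 * h1 * C0) with ((t + h1 - (t - h1)) * C0) by ring.
  apply abs_RInt_le_const; [lra | now apply (ex_RInt_plus (V := R_NormedModule)) |].
  intros s Hs; now apply win2. }
replace ((t + h1 - sg) / - de) with (- ((t + h1 - sg) / de)) in I2 by (field; lra).
replace ((t - h1 - sg) / - de) with (- ((t - h1 - sg) / de)) in I2 by (field; lra).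
rewrite !atan_opp in I2.
assert (T1 : PI / 4 <= atan ((t + h1 - sg) / de)).
{ rewrite <- atan_1; apply atan_le, Rle_div_intro; lra. }
assert (T2 : atan ((t - h1 - sg) / de) <= - (PI / 4)).
{ rewrite <- atan_1, <- atan_opp; apply atan_le, Rdiv_le_intro; lra. }
destruct (awayG (t - h1) ltac:(lra) ltac:(apply Abs1; lra)) as [_ A1].
destruct (awayG (t + h1) ltac:(lra) ltac:(apply Abs2; lra)) as [_ A2].
apply Rabs_le_between in I1, I2, A1, A2.
assert (HPI : 3 < PI) by (pose proof PI2_3_2; unfold PI2 in *; lra).
lra.
Qed.

(** If the inner point escaped, its winding integral and that of its outer mirror image would both
    be zero, against the jump. *)
Lemma sides t : 0 < t < l -> exists h, 0 < h /\ forall sg de, Rabs (sg - t) < h -> Rabs de < h ->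
  (0 < de -> escapes a b l X Y (offx X dY sg de) (offy Y dX sg de)) /\
  (de < 0 -> ~ escapes a b l X Y (offx X dY sg de) (offy Y dX sg de)).
Proof.
intros Ht.
destruct (wind_jump t Ht) as [h1 [Hh1 HJ]].
set (t1 := (t + l) / 2).
destruct (offset_escapes cv t1) as [d0 [Hd0 HE]]; [unfold t1; lra|].
set (h := Rmin (Rmin h1 d0) (Rmin t ((l - t) / 2))).
assert (Hh : 0 < h /\ h <= h1 /\ h <= d0 /\ h <= t /\ h <= (l - t) / 2)
  by (unfold h, Rmin; repeat destruct Rle_dec; lra).
exists h; split; [lra|]; intros sg de Hsg Hde.
assert (Bsg := Hsg); apply Rabs_lt_between in Bsg; apply Rabs_lt_between in Hde.
split; intros Hs.
- apply HE; unfold t1; lra.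
- intros Hesc.
  assert (E1 : Wn (offx X dY sg de) (offy Y dX sg de) = 0) by now apply wind_escapes.
  assert (E2 : Wn (offx X dY sg (- de)) (offy Y dX sg (- de)) = 0).
  { apply wind_escapes; auto; apply HE; unfold t1; lra. }
  apply (HJ sg (- de)); [lra | lra |].
  now rewrite Ropp_involutive, E1, E2.
Qed.

End Sides.
Arguments sides {a b l X Y dX dY}.

(** * Improper integrals *)

Lemma ex_RInt_cont (f : R -> R) c d : c <= d -> (forall s, c <= s <= d -> continuous f s) -> ex_RInt f c d.
Proof.
intros Hcd H; apply (ex_RInt_continuous (V := R_CompleteNormedModule)).
intros s Hs; rewrite Rmin_left, Rmax_right in Hs by lra; now apply H.
Qed.

(** The majorant acts through its continuous primitive G, so g may be infinite at c or d, as 1 /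
    sqrt |s - sg| is. *)
Lemma RInt_le_increment (f G g : R -> R) c d : c <= d ->
  (forall s, c <= s <= d -> continuous f s) -> (forall s, c <= s <= d -> continuous G s) ->
  (forall s, c < s < d -> is_derive G s (g s)) -> (forall s, c < s < d -> f s <= g s) ->
  RInt f c d <= G d - G c.
Proof.
intros Hcd Cf CG HG Hle.
set (cl := fun s => Rmax c (Rmin s d)).
assert (cl_in : forall s, c <= cl s <= d) by (intros s; unfold cl, Rmax, Rmin; repeat destruct Rle_dec; lra).
assert (cl_id : forall s, c <= s <= d -> cl s = s) by (intros s Hs; unfold cl, Rmax, Rmin; repeat destruct Rle_dec; lra).
assert (cl_c : forall s, continuous cl s).
{ intros s; apply continuous_eps; intros e He; exists e; split; auto; intros y Hy.
  eapply Rle_lt_trans; [|apply Hy]; unfold cl, Rmax, Rmin, Rabs;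
  repeat destruct Rle_dec; repeat destruct Rcase_abs; lra. }
set (ft := fun s => f (cl s)).
assert (Cft : forall s, continuous ft s).
{ intros s; apply (lim_comp f cl); [apply Cf, cl_in | apply cl_c]. }
set (F := fun s => RInt ft c s).
assert (HF : forall s, is_derive F s (ft s)).
{ intros s; apply (is_derive_RInt ft F c s); [|apply Cft].
  apply filter_forall; intros y; apply (RInt_correct (V := R_CompleteNormedModule)).
  apply (ex_RInt_continuous (V := R_CompleteNormedModule)); intros z _; apply Cft. }
assert (E : RInt f c d = F d).
{ unfold F; apply RInt_ext; intros s Hs; rewrite Rmin_left, Rmax_right in Hs by lra.
  unfold ft; rewrite cl_id; auto; lra. }
assert (F0 : F c = 0) by (unfold F; rewrite RInt_point; reflexivity).
(* [Rmax 0] makes the derivative nonnegative also at the end points, where [g] may be junk. *)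
destruct (MVT_gen (fun s => G s - F s) c d (fun s => Rmax 0 (g s - f s))) as [z [_ Ez]].
- rewrite Rmin_left, Rmax_right by lra; intros s Hs.
  rewrite Rmax_right by (specialize (Hle s Hs); lra).
  replace (f s) with (ft s) by (unfold ft; rewrite cl_id; auto; lra).
  apply (is_derive_minus G F); auto.
- rewrite Rmin_left, Rmax_right by lra; intros s Hs; apply continuity_pt_filterlim.
  apply lim_minus; [now apply CG|]; apply (ex_derive_continuous F); exists (ft s); apply HF.
- pose proof (Rmax_l 0 (g z - f z)).
  assert (0 <= Rmax 0 (g z - f z) * (d - c)) by (apply Rmult_le_pos; lra).
  rewrite E; lra.
Qed.

Lemma RInt_opp_R (f : R -> R) c d : ex_RInt f c d -> RInt (fun s => - f s) c d = - RInt f c d.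
Proof. intros H; exact (RInt_opp (V := R_CompleteNormedModule) f c d H). Qed.

Lemma RInt_dominated (f G g : R -> R) c d : c <= d ->
  (forall s, c <= s <= d -> continuous f s) -> (forall s, c <= s <= d -> continuous G s) ->
  (forall s, c < s < d -> is_derive G s (g s)) -> (forall s, c < s < d -> Rabs (f s) <= g s) ->
  Rabs (RInt f c d) <= G d - G c.
Proof.
intros Hcd Cf CG HG Hle; apply Rabs_le; split.
- assert (H : RInt (fun s => - f s) c d <= G d - G c).
  { apply RInt_le_increment with g; auto.
    - intros s Hs; apply lim_opp; now apply Cf.
    - intros s Hs; specialize (Hle s Hs); apply Rabs_le_between in Hle; lra. }
  rewrite RInt_opp_R in H by now apply ex_RInt_cont. lra.
- apply RInt_le_increment with g; auto.
  intros s Hs; specialize (Hle s Hs); apply Rabs_le_between in Hle; lra.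
Qed.

Lemma RInt_sqrt_left (f : R -> R) sg B C c d : c <= d <= sg ->
  (forall s, c <= s <= d -> continuous f s) ->
  (forall s, c < s < d -> Rabs (f s) <= B + C / sqrt (Rabs (s - sg))) ->
  Rabs (RInt f c d) <= (B * d - 2 * C * sqrt (sg - d)) - (B * c - 2 * C * sqrt (sg - c)).
Proof.
intros Hcd Cf Hle.
apply (RInt_dominated f (fun s => B * s - 2 * C * sqrt (sg - s)) (fun s => B + C / sqrt (Rabs (s - sg)))); auto; [lra| |].
- intros s _; apply lim_minus; apply lim_mult; try apply lim_const; [apply continuous_id|].
  apply (lim_comp sqrt); [apply continuous_sqrt | apply lim_minus; [apply lim_const | apply continuous_id]].
- intros s Hs; rewrite Rabs_left by lra.
  assert (0 < sqrt (sg - s)) by (apply sqrt_lt_R0; lra).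
  auto_derive; [lra|]; replace (- (s - sg)) with (sg - s) by ring; unfold Rminus in *; field; lra.
Qed.

Lemma RInt_sqrt_right (f : R -> R) sg B C c d : sg <= c <= d ->
  (forall s, c <= s <= d -> continuous f s) ->
  (forall s, c < s < d -> Rabs (f s) <= B + C / sqrt (Rabs (s - sg))) ->
  Rabs (RInt f c d) <= (B * d + 2 * C * sqrt (d - sg)) - (B * c + 2 * C * sqrt (c - sg)).
Proof.
intros Hcd Cf Hle.
apply (RInt_dominated f (fun s => B * s + 2 * C * sqrt (s - sg)) (fun s => B + C / sqrt (Rabs (s - sg)))); auto; [lra| |].
- intros s _; apply lim_plus; apply lim_mult; try apply lim_const; [apply continuous_id|].
  apply (lim_comp sqrt); [apply continuous_sqrt | apply lim_minus; [apply continuous_id | apply lim_const]].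
- intros s Hs; rewrite Rabs_pos_eq by lra.
  assert (0 < sqrt (s - sg)) by (apply sqrt_lt_R0; lra).
  auto_derive; [lra|]; unfold Rminus in *; field; lra.
Qed.

Lemma RInt_Chasles_R (f : R -> R) a b c : ex_RInt f a b -> ex_RInt f b c ->
  RInt f a c = RInt f a b + RInt f b c.
Proof. intros H1 H2; symmetry; exact (RInt_Chasles (V := R_CompleteNormedModule) f a b c H1 H2). Qed.

Definition improper_RInt (f : R -> R) (a b I : R) : Prop :=
  (forall c d, a < c -> c <= d -> d < b -> ex_RInt f c d) /\
  (forall e, e > 0 -> exists del, del > 0 /\
     forall c d, a < c < a + del -> b - del < d < b -> c <= d -> Rabs (RInt f c d - I) < e).

Lemma improper_int_RInt f a b I : improper_int f a b I <-> improper_RInt f a b I.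
Proof.
split; intros [H1 H2]; split.
- intros c d Hc Hcd Hd; destruct (H1 c d Hc Hcd Hd) as [pr]; now apply ex_RInt_Reals_1.
- intros e He; destruct (H2 e He) as [del [Hdel H]]; exists del; split; auto; intros c d Hc Hd Hcd.
  destruct (H1 c d) as [pr]; try lra; rewrite (RInt_Reals f c d pr); now apply H.
- intros c d Hc Hcd Hd; constructor; apply ex_RInt_Reals_0; now apply H1.
- intros e He; destruct (H2 e He) as [del [Hdel H]]; exists del; split; auto; intros c d pr Hc Hd Hcd.
  rewrite <- (RInt_Reals f c d pr); now apply H.
Qed.

Lemma improper_RInt_ext f g a b I : (forall s, a < s < b -> f s = g s) ->
  improper_RInt f a b I -> improper_RInt g a b I.
Proof.
intros E [H1 H2]; split.
- intros c d Hc Hcd Hd; apply ex_RInt_ext with f; [|now apply H1].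
  intros s Hs; rewrite Rmin_left, Rmax_right in Hs by lra; apply E; lra.
- intros e He; destruct (H2 e He) as [del [Hdel H]]; exists del; split; auto; intros c d Hc Hd Hcd.
  rewrite <- (RInt_ext f g); [now apply H|].
  intros s Hs; rewrite Rmin_left, Rmax_right in Hs by lra; apply E; lra.
Qed.

(** G is a modulus for the Cauchy criterion: monotone inside by the bound, continuous at both ends.
    The second conclusion is the explicit truncation error used when the limit is taken. *)
Lemma improper_exists (f G : R -> R) a b : a < b ->
  (forall s, a < s < b -> continuous f s) -> continuous G a -> continuous G b ->
  (forall c d, a < c -> c <= d -> d < b -> Rabs (RInt f c d) <= G d - G c) ->
  exists I, improper_RInt f a b I /\
    forall c d, a < c -> c <= d -> d < b -> Rabs (RInt f c d - I) <= (G c - G a) + (G b - G d).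
Proof.
intros Hab Cf Ga Gb Hdom.
assert (ex : forall c d, a < c -> c <= d -> d < b -> ex_RInt f c d).
{ intros c d Hc Hcd Hd; apply ex_RInt_cont; auto; intros s Hs; apply Cf; lra. }
assert (mono : forall c d, a < c -> c <= d -> d < b -> G c <= G d).
{ intros c d Hc Hcd Hd; specialize (Hdom c d Hc Hcd Hd).
  pose proof (Rabs_pos (RInt f c d)); lra. }
assert (lowA : forall c, a < c < b -> G a <= G c).
{ intros c Hc; apply Rnot_lt_le; intros Hlt.
  destruct (proj1 (continuous_eps G a) Ga (G a - G c) ltac:(lra)) as [d [Hd H]].
  set (y := a + Rmin d (c - a) / 2).
  assert (Hy : a < y /\ y < a + d /\ y <= c) by (unfold y, Rmin; destruct Rle_dec; lra).
  specialize (H y ltac:(rewrite Rabs_pos_eq; lra)); apply Rabs_lt_between in H.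
  specialize (mono y c ltac:(lra) ltac:(lra) ltac:(lra)); lra. }
assert (upB : forall c, a < c < b -> G c <= G b).
{ intros c Hc; apply Rnot_lt_le; intros Hlt.
  destruct (proj1 (continuous_eps G b) Gb (G c - G b) ltac:(lra)) as [d [Hd H]].
  set (y := b - Rmin d (b - c) / 2).
  assert (Hy : y < b /\ b - d < y /\ c <= y) by (unfold y, Rmin; destruct Rle_dec; lra).
  specialize (H y ltac:(rewrite Rabs_left; lra)); apply Rabs_lt_between in H.
  specialize (mono c y ltac:(lra) ltac:(lra) ltac:(lra)); lra. }
assert (nest : forall c d c' d', a < c' -> c' <= c -> c <= d -> d <= d' -> d' < b ->
  Rabs (RInt f c' d' - RInt f c d) <= (G c - G a) + (G b - G d)).
{ intros c d c' d' H1 H2 H3 H4 H5.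
  rewrite (RInt_Chasles_R f c' c d'), (RInt_Chasles_R f c d d'); try (apply ex; lra).
  replace (RInt f c' c + (RInt f c d + RInt f d d') - RInt f c d) with (RInt f c' c + RInt f d d') by ring.
  apply Rabs_plus_le.
  - eapply Rle_trans; [apply Hdom; lra|]; pose proof (lowA c' ltac:(lra)); lra.
  - eapply Rle_trans; [apply Hdom; lra|]; pose proof (upB d' ltac:(lra)); lra. }
set (cn := fun n => a + (b - a) / INR (S (S n))); set (dn := fun n => b - (b - a) / INR (S (S n))).
assert (two : forall n, 2 <= INR (S (S n))) by (intros n; rewrite !S_INR; pose proof (pos_INR n); lra).
assert (Hcn : forall n, a < cn n /\ cn n <= dn n /\ dn n < b).
{ intros n; unfold cn, dn; specialize (two n).
  assert (0 < (b - a) / INR (S (S n))) by (apply Rdiv_lt_0_compat; lra).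
  assert ((b - a) / INR (S (S n)) <= (b - a) / 2).
  { apply Rmult_le_compat_l; [lra | apply Rinv_le_contravar; lra]. }
  lra. }
assert (mon : forall n m, (n <= m)%nat -> cn m <= cn n /\ dn n <= dn m).
{ intros n m Hnm; unfold cn, dn.
  assert ((b - a) / INR (S (S m)) <= (b - a) / INR (S (S n))); [|lra].
  apply Rmult_le_compat_l; [lra | apply Rinv_le_contravar; [specialize (two n); lra | apply le_INR; lia]]. }
assert (tiny : forall r, 0 < r -> exists n, forall m, (n <= m)%nat -> cn m < a + r /\ b - r < dn m).
{ intros r Hr; destruct (archimed_cor1 (r / (b - a))) as [N [HN HN0]].
  { apply Rdiv_lt_0_compat; lra. }
  exists N; intros m Hm; unfold cn, dn.
  assert ((b - a) / INR (S (S m)) < r); [|lra].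
  apply Rle_lt_trans with ((b - a) * / INR N).
  - apply Rmult_le_compat_l; [lra|]; apply Rinv_le_contravar; [now apply lt_0_INR | apply le_INR; lia].
  - apply Rmult_lt_compat_l with (r := b - a) in HN; [|lra].
    replace ((b - a) * (r / (b - a))) with r in HN by (field; lra); exact HN. }
assert (endG : forall e, 0 < e -> exists r, 0 < r /\ (forall c, a < c < b -> c < a + r -> G c - G a < e) /\
   (forall d, a < d < b -> b - r < d -> G b - G d < e)).
{ intros e He.
  destruct (proj1 (continuous_eps G a) Ga e He) as [r1 [Hr1 H1]].
  destruct (proj1 (continuous_eps G b) Gb e He) as [r2 [Hr2 H2]].
  exists (Rmin r1 r2); split; [apply Rmin_pos; auto|].
  pose proof (Rmin_l r1 r2); pose proof (Rmin_r r1 r2); split.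
  - intros c Hc Hca; specialize (H1 c ltac:(rewrite Rabs_pos_eq; lra)); apply Rabs_lt_between in H1; lra.
  - intros d Hd Hdb; specialize (H2 d ltac:(rewrite Rabs_left; lra)); apply Rabs_lt_between in H2; lra. }
set (u := fun n => RInt f (cn n) (dn n)).
assert (HC : Cauchy_crit u).
{ intros e He; destruct (endG (e / 4) ltac:(lra)) as (r & Hr & G1 & G2).
  destruct (tiny r Hr) as [N HN]; exists N.
  assert (W : forall n, (N <= n)%nat -> Rabs (u n - u N) < e / 2).
  { intros n Hn; unfold u; destruct (Hcn n) as (A1 & A2 & A3); destruct (Hcn N) as (B1 & B2 & B3).
    destruct (mon N n Hn); destruct (HN N (Nat.le_refl N)).
    eapply Rle_lt_trans; [apply nest; lra|].
    specialize (G1 (cn N) ltac:(lra) ltac:(lra)); specialize (G2 (dn N) ltac:(lra) ltac:(lra)); lra. }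
  intros n m Hn Hm; unfold Rdist.
  replace (u n - u m) with ((u n - u N) - (u m - u N)) by ring.
  eapply Rle_lt_trans; [apply Rabs_triang|]; rewrite Rabs_Ropp.
  specialize (W n Hn) as W1; specialize (W m Hm) as W2; lra. }
destruct (Rcomplete.R_complete u HC) as [I HI].
assert (main : forall c d, a < c -> c <= d -> d < b -> Rabs (RInt f c d - I) <= (G c - G a) + (G b - G d)).
{ intros c d Hc Hcd Hd.
  destruct (tiny (Rmin (c - a) (b - d))) as [N HN]; [apply Rmin_pos; lra|].
  rewrite Rabs_minus_sym.
  apply Un_cv_Rabs_le with (u := fun n => u n - RInt f c d) (k := N).
  - intros e He; destruct (HI e He) as [N' HN']; exists N'; intros n Hn; specialize (HN' n Hn).
    unfold Rdist in *; now replace (u n - RInt f c d - (I - RInt f c d)) with (u n - I) by ring.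
  - intros n Hn; destruct (HN n Hn); destruct (Hcn n) as (A1 & A2 & A3).
    pose proof (Rmin_l (c - a) (b - d)); pose proof (Rmin_r (c - a) (b - d)).
    unfold u; apply nest; lra. }
exists I; split; auto; split; auto.
intros e He; destruct (endG (e / 2) ltac:(lra)) as (r & Hr & G1 & G2).
exists r; split; auto; intros c d Hc Hd Hcd.
eapply Rle_lt_trans; [apply main; lra|].
specialize (G1 c ltac:(lra) ltac:(lra)); specialize (G2 d ltac:(lra) ltac:(lra)); lra.
Qed.

(** * Limits of the potential *)

Section Potential.
Variables (al be a b l : R) (X Y dX dY mu : R -> R).
Hypotheses (Hal : 0 < 2 * al < 1) (Hbe : 0 < 2 * be < 1).
Hypothesis cv : curve a b l X Y dX dY.
Hypothesis Hmu : cont_on mu 0 l.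
Variable t : R.
Hypothesis Ht : 0 < t < l.

Notation kG := (kernG al be X Y dX dY).

Lemma kernG_continuous s x0 y0 : 0 < s < l -> 0 < x0 -> 0 < y0 -> 0 < dist2 (X s) (Y s) x0 y0 ->
  continuous (fun s => kG s x0 y0) s.
Proof.
intros Hs Hx0 Hy0 Hr; destruct (cv_quad cv s Hs).
unfold kernG; apply lim_kern; auto; try lra; try apply lim_const.
- apply (cont_on_interior X l s); auto; apply (cv_X cv).
- apply (cont_on_interior Y l s); auto; apply (cv_Y cv).
- apply lim_opp, (cont_on_interior dY l s); auto; apply (cv_dYc cv).
- apply (cont_on_interior dX l s); auto; apply (cv_dXc cv).
Qed.

(** Valid up to both ends of the curve, which makes the end contributions uniformly small;
    convergence of the kernel is needed only on compact parts, in the next lemma. *)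
Lemma kernel_away_bound h : 0 < h -> exists B eta, 0 <= B /\ 0 < eta /\
  forall x0 y0, Rabs (x0 - X t) < eta -> Rabs (y0 - Y t) < eta -> 0 < x0 /\ 0 < y0 /\
  forall s, 0 < s < l -> h <= Rabs (s - t) -> 0 < dist2 (X s) (Y s) x0 y0 /\ Rabs (kG s x0 y0) <= B.
Proof.
intros Hh.
destruct (cv_quad cv t Ht) as [HXt HYt].
assert (Hl := cv_l_pos cv).
destruct (curve_separation cv h Hh) as [c1 [Hc1 Hsep]].
destruct (cont_on_bounded X l Hl (cv_X cv)) as [B1 [HB1 HX]].
destruct (cont_on_bounded Y l Hl (cv_Y cv)) as [B2 [HB2 HY]].
set (m := Rmin (X t) (Y t)).
assert (Hm : 0 < m /\ m <= X t /\ m <= Y t) by (unfold m, Rmin; destruct Rle_dec; lra).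
set (M := B1 + B2 + 1).
destruct (kern_bounded al be (m / 2) M Hal Hbe ltac:(lra) ltac:(unfold M; lra) (c1 / 4) ltac:(lra)) as [B [HB HK]].
set (eta := Rmin (Rmin 1 (m / 2)) (c1 / 8)).
assert (He : 0 < eta /\ eta <= 1 /\ eta <= m / 2 /\ eta <= c1 / 8)
  by (unfold eta, Rmin; repeat destruct Rle_dec; lra).
exists B, eta; do 2 (split; [lra|]); intros x0 y0 Ex Ey.
assert (HXt' := HX t ltac:(lra)); assert (HYt' := HY t ltac:(lra)).
assert (Fx := Ex); assert (Fy := Ey).
apply Rabs_lt_between in Fx, Fy; apply Rabs_le_between in HXt', HYt'.
do 2 (split; [lra|]); intros s Hs Hst.
assert (Hd : c1 / 4 <= dist2 (X s) (Y s) x0 y0).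
{ assert (T := dist2_tri (X s) (Y s) x0 y0 (X t) (Y t)).
  assert (S := Hsep s t ltac:(lra) ltac:(lra) Hst).
  assert ((x0 - X t) ^ 2 <= eta ^ 2) by (rewrite <- pow2_abs; apply pow_incr; split; [apply Rabs_pos | lra]).
  assert ((y0 - Y t) ^ 2 <= eta ^ 2) by (rewrite <- pow2_abs; apply pow_incr; split; [apply Rabs_pos | lra]).
  assert (eta ^ 2 <= eta) by nra.
  unfold dist2 at 3 in T; lra. }
split; [lra|].
destruct (cv_quad cv s Hs) as [PX PY].
destruct (unit_speed cv s Hs) as [U1 U2].
assert (A1 := HX s ltac:(lra)); assert (A2 := HY s ltac:(lra)); apply Rabs_le_between in A1, A2.
unfold kernG; apply HK; auto; try (unfold M; lra); now rewrite Rabs_Ropp.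
Qed.

Lemma kernel_away_uniform c d e : 0 < c -> d < l -> (forall s, c <= s <= d -> s <> t) -> 0 < e ->
  exists eta, 0 < eta /\ forall s, c <= s <= d -> forall x0 y0, Rabs (x0 - X t) < eta -> Rabs (y0 - Y t) < eta ->
  Rabs (kG s x0 y0 - kG s (X t) (Y t)) <= e.
Proof.
intros Hc Hd Hst He.
destruct (cv_quad cv t Ht) as [HXt HYt].
apply (compact_uniform_1d (fun s eta => forall x0 y0, Rabs (x0 - X t) < eta -> Rabs (y0 - Y t) < eta ->
  Rabs (kG s x0 y0 - kG s (X t) (Y t)) <= e) c d).
- intros s eta eta' H1 H2 x0 y0 Hx Hy; apply H2; lra.
- intros u Hu.
  assert (Iu : 0 < u < l) by lra.
  destruct (cv_quad cv u Iu) as [PX PY].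
  assert (Hr : 0 < dist2 (X u) (Y u) (X t) (Y t)).
  { apply dist2_pos; intros [E1 E2]; apply (Hst u Hu).
    apply (cv_simple cv); auto; lra. }
  set (pt := (u, (X t, Y t)) : R * (R * R)).
  assert (L : filterlim (fun p : R * (R * R) => kG (fst p) (fst (snd p)) (snd (snd p))) (locally pt)
    (locally (kG u (X t) (Y t)))).
  { unfold kernG; apply lim_kern; auto; try lra.
    - apply (lim_comp X fst u); [apply (cont_on_interior X l u); auto; apply (cv_X cv)|].
      apply (continuous_fst u (X t, Y t)).
    - apply (lim_comp Y fst u); [apply (cont_on_interior Y l u); auto; apply (cv_Y cv)|].
      apply (continuous_fst u (X t, Y t)).
    - apply lim_opp, (lim_comp dY fst u); [apply (cont_on_interior dY l u); auto; apply (cv_dYc cv)|].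
      apply (continuous_fst u (X t, Y t)).
    - apply (lim_comp dX fst u); [apply (cont_on_interior dX l u); auto; apply (cv_dXc cv)|].
      apply (continuous_fst u (X t, Y t)).
    - apply (continuous_comp snd fst pt); [apply (continuous_snd u (X t, Y t)) | apply (continuous_fst (X t) (Y t))].
    - apply (continuous_comp snd snd pt); [apply (continuous_snd u (X t, Y t)) | apply (continuous_snd (X t) (Y t))]. }
  assert (He2 : 0 < e / 2) by lra.
  destruct (proj1 (filterlim_locally _ _) L (mkposreal _ He2)) as [eta Heta].
  exists eta; split; [apply cond_pos|]; intros s Hs Hsu x0 y0 Hx Hy.
  assert (A1 : Rabs (kG s x0 y0 - kG u (X t) (Y t)) < e / 2).
  { apply (Heta (s, (x0, y0))); split; [exact Hsu | split; [exact Hx | exact Hy]]. }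
  assert (A2 : Rabs (kG s (X t) (Y t) - kG u (X t) (Y t)) < e / 2).
  { apply (Heta (s, (X t, Y t))); split; [exact Hsu | split; apply ball_center]. }
  replace (kG s x0 y0 - kG s (X t) (Y t)) with
    ((kG s x0 y0 - kG u (X t) (Y t)) - (kG s (X t) (Y t) - kG u (X t) (Y t))) by ring.
  eapply Rle_trans; [apply Rabs_triang|]; rewrite Rabs_Ropp; lra.
Qed.

Definition dens (x0 y0 s : R) : R := mu s * kG s x0 y0.

Lemma dens_continuous s x0 y0 : 0 < s < l -> 0 < x0 -> 0 < y0 -> 0 < dist2 (X s) (Y s) x0 y0 ->
  continuous (dens x0 y0) s.
Proof.
intros; unfold dens; apply lim_mult; [now apply (cont_on_interior mu l s)|].
now apply kernG_continuous.
Qed.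

(** For x >= h / 2 one has atan (x / r) = pi / 2 - atan (r / x) >= pi / 2 - 2 r / h; the two ends of
    the window add up. *)
Lemma poisson_mass sg de h : de <> 0 -> 0 < h -> Rabs (sg - t) <= h / 2 ->
  let P := atan ((t + h - sg) / de) - atan ((t - h - sg) / de) in
  (0 < de -> Rabs (P - PI) <= 4 * Rabs de / h) /\ (de < 0 -> Rabs (P + PI) <= 4 * Rabs de / h) /\
  Rabs P <= PI.
Proof.
intros Hde Hh Hsg P.
apply Rabs_le_between in Hsg.
assert (key : forall x r, 0 < r -> h / 2 <= x -> PI / 2 - 2 * r / h <= atan (x / r) < PI / 2).
{ intros x r Hr Hx; split; [|apply atan_bound].
  assert (Hxr : 0 < x / r) by (apply Rdiv_lt_0_compat; lra).
  assert (E := atan_inv (x / r) Hxr).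
  assert (B : atan (/ (x / r)) <= 2 * r / h).
  { apply Rle_trans with (/ (x / r)).
    - assert (Hi := Rinv_0_lt_compat _ Hxr).
      destruct (MVT_gen atan 0 (/ (x / r)) (fun z => / (1 + z ^ 2))) as [z [Hz Ez]].
      + intros z _; auto_derive; auto; field; nra.
      + intros z _; apply continuity_pt_filterlim, (ex_derive_continuous atan); auto_derive; auto.
      + rewrite atan_0, !Rminus_0_r in Ez; rewrite Ez.
        assert (/ (1 + z ^ 2) <= 1).
        { rewrite <- Rinv_1; apply Rinv_le_contravar; [lra | pose proof (pow2_ge_0 z); lra]. }
        nra.
    - replace (/ (x / r)) with (r / x) by (field; lra).
      replace (2 * r / h) with (r / (h / 2)) by (field; lra).
      apply Rmult_le_compat_l; [lra | apply Rinv_le_contravar; lra]. }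
  lra. }
assert (pos : forall r, 0 < r -> PI - 4 * r / h <= atan ((t + h - sg) / r) - atan ((t - h - sg) / r) < PI).
{ intros r Hr.
  replace ((t - h - sg) / r) with (- ((sg + h - t) / r)) by (field; lra); rewrite atan_opp.
  assert (K1 := key (t + h - sg) r Hr ltac:(lra)); assert (K2 := key (sg + h - t) r Hr ltac:(lra)).
  replace (4 * r / h) with (2 * r / h + 2 * r / h) by (field; lra); lra. }
assert (mass0 : forall r, 0 < r -> 0 <= atan ((t + h - sg) / r) - atan ((t - h - sg) / r)).
{ intros r Hr; assert (atan ((t - h - sg) / r) <= atan ((t + h - sg) / r)); [|lra].
  apply atan_le; apply Rmult_le_compat_r; [left; now apply Rinv_0_lt_compat | lra]. }
destruct (Rdichotomy _ _ Hde) as [Hn|Hp].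
- assert (EP : P = - (atan ((t + h - sg) / - de) - atan ((t - h - sg) / - de))).
  { unfold P; replace ((t + h - sg) / de) with (- ((t + h - sg) / - de)) by (field; lra).
    replace ((t - h - sg) / de) with (- ((t - h - sg) / - de)) by (field; lra).
    rewrite !atan_opp; ring. }
  specialize (pos (- de) ltac:(lra)); specialize (mass0 (- de) ltac:(lra)).
  rewrite (Rabs_left de) by auto; rewrite EP.
  repeat split; intros; try lra; apply Rabs_le; lra.
- specialize (pos de Hp); specialize (mass0 de Hp); fold P in pos, mass0.
  rewrite (Rabs_pos_eq de) by lra.
  repeat split; intros; try lra; apply Rabs_le; lra.
Qed.

(** The integrand is split as mu (k - P) + (mu - mu t) P + mu t P, with P the Poisson kernel over 2
    pi. The first part integrates to O(sqrt h), the second to at most om / 2 because P has total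
    mass at most 1/2, and the third is kept exactly. The estimate of [kernel_near] is a hypothesis
    so that its constants are shared with the rest of the argument. *)
Lemma near_window h0 C Bm h om sg de :
  0 <= C -> 0 <= Bm -> 0 < t - h0 -> t + h0 < l ->
  (forall s, 0 < s < l -> Rabs (mu s) <= Bm) ->
  (forall s sg de, Rabs (s - t) < h0 -> Rabs (sg - t) < h0 -> Rabs de < h0 ->
    0 < offx X dY sg de /\ 0 < offy Y dX sg de /\
    ((s - sg) ^ 2 + de ^ 2) / 2 <= dist2 (X s) (Y s) (offx X dY sg de) (offy Y dX sg de) /\
    (s <> sg -> Rabs (kG s (offx X dY sg de) (offy Y dX sg de)
      - / (2 * PI) * (de / ((s - sg) ^ 2 + de ^ 2))) <= C / sqrt (Rabs (s - sg)))) ->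
  0 < h < h0 -> (forall s, Rabs (s - t) <= h -> Rabs (mu s - mu t) <= om) ->
  Rabs (sg - t) <= h / 2 -> de <> 0 -> Rabs de < h0 ->
  Rabs (RInt (dens (offx X dY sg de) (offy Y dX sg de)) (t - h) (t + h)
    - / (2 * PI) * mu t * (atan ((t + h - sg) / de) - atan ((t - h - sg) / de)))
  <= 8 * (Bm * C) * sqrt (2 * h) + om / 2.
Proof.
intros HC HBm Hl0 Hr0 HB HN Hh Hom Hsg Hde Hde0.
assert (HPI := PI_RGT_0).
assert (Bsg := Hsg); apply Rabs_le_between in Bsg.
set (x0 := offx X dY sg de); set (y0 := offy Y dX sg de).
assert (HN' : forall s, t - h <= s <= t + h -> 0 < x0 /\ 0 < y0 /\ 0 < dist2 (X s) (Y s) x0 y0 /\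
  (s <> sg -> Rabs (kG s x0 y0 - / (2 * PI) * poisson sg de s) <= C / sqrt (Rabs (s - sg)))).
{ intros s Hs.
  destruct (HN s sg de) as (A1 & A2 & A3 & A4); auto; [apply Rabs_def1; lra | lra |].
  repeat split; auto; pose proof (poisson_den_pos sg de s Hde); unfold x0, y0; lra. }
set (fA := fun s => mu s * (kG s x0 y0 - / (2 * PI) * poisson sg de s)).
set (fB := fun s => / (2 * PI) * (mu s - mu t) * poisson sg de s).
set (fP := fun s => / (2 * PI) * mu t * poisson sg de s).
assert (Cmu : forall s, t - h <= s <= t + h -> continuous mu s).
{ intros s Hs; apply (cont_on_interior mu l s); auto; lra. }
assert (Cp : forall s, continuous (poisson sg de) s) by (intros s; now apply continuous_poisson).
assert (CA : forall s, t - h <= s <= t + h -> continuous fA s).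
{ intros s Hs; destruct (HN' s Hs) as (A1 & A2 & A3 & _); unfold fA.
  apply lim_mult; [now apply Cmu|]; apply lim_minus; [apply kernG_continuous; auto; lra|].
  apply lim_mult; [apply lim_const | apply Cp]. }
assert (CB : forall s, t - h <= s <= t + h -> continuous fB s).
{ intros s Hs; unfold fB; apply lim_mult; [|apply Cp]; apply lim_mult; [apply lim_const|].
  apply lim_minus; [now apply Cmu | apply lim_const]. }
assert (CP : forall s, t - h <= s <= t + h -> continuous fP s).
{ intros s Hs; unfold fP; apply lim_mult; [apply lim_const | apply Cp]. }
assert (exA : ex_RInt fA (t - h) (t + h)) by (apply ex_RInt_cont; auto; lra).
assert (exB : ex_RInt fB (t - h) (t + h)) by (apply ex_RInt_cont; auto; lra).
assert (exP : ex_RInt fP (t - h) (t + h)) by (apply ex_RInt_cont; auto; lra).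
assert (exAB : ex_RInt (fun s => fA s + fB s) (t - h) (t + h)) by now apply (ex_RInt_plus (V := R_NormedModule)).
assert (Esum : RInt (dens x0 y0) (t - h) (t + h) = RInt fA (t - h) (t + h) + RInt fB (t - h) (t + h) + RInt fP (t - h) (t + h)).
{ rewrite <- (RInt_plus (V := R_CompleteNormedModule) fA fB) by auto.
  rewrite <- (RInt_plus (V := R_CompleteNormedModule) (fun s => plus (fA s) (fB s)) fP) by auto.
  apply RInt_ext; intros s _; unfold dens, fA, fB, fP, plus; simpl; ring. }
assert (mass := is_RInt_unique _ _ _ _ (is_RInt_poisson sg de (t - h) (t + h) Hde)).
set (P := atan ((t + h - sg) / de) - atan ((t - h - sg) / de)) in *.
assert (EP : RInt fP (t - h) (t + h) = / (2 * PI) * mu t * P).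
{ rewrite <- mass; unfold fP.
  exact (RInt_scal (V := R_CompleteNormedModule) (poisson sg de) (t - h) (t + h) (/ (2 * PI) * mu t)
    (ex_intro _ _ (is_RInt_poisson sg de (t - h) (t + h) Hde))). }
rewrite Esum, EP; replace (RInt fA (t - h) (t + h) + RInt fB (t - h) (t + h) + / (2 * PI) * mu t * P - / (2 * PI) * mu t * P)
  with (RInt fA (t - h) (t + h) + RInt fB (t - h) (t + h)) by ring.
assert (Hsq : forall z, z <= 2 * h -> sqrt z <= sqrt (2 * h)) by (intros; now apply sqrt_le_1_alt).
assert (HBC : 0 <= Bm * C) by now apply Rmult_le_pos.
apply Rabs_plus_le.
- assert (bA : forall s, t - h <= s <= t + h -> s <> sg -> Rabs (fA s) <= 0 + (Bm * C) / sqrt (Rabs (s - sg))).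
  { intros s Hs Hne; destruct (HN' s Hs) as (_ & _ & _ & A4); unfold fA.
    rewrite Rplus_0_l; unfold Rdiv; rewrite Rmult_assoc; apply Rabs_mult_le; [apply HB; lra | now apply A4]. }
  rewrite (RInt_Chasles_R fA (t - h) sg (t + h)) by (apply ex_RInt_cont; [lra | intros s Hs; apply CA; lra]).
  replace (8 * (Bm * C) * sqrt (2 * h)) with (4 * (Bm * C) * sqrt (2 * h) + 4 * (Bm * C) * sqrt (2 * h)) by ring.
  apply Rabs_plus_le.
  + eapply Rle_trans; [apply (RInt_sqrt_left fA sg 0 (Bm * C)); [lra | intros s Hs; apply CA; lra | intros s Hs; apply bA; lra]|].
    rewrite Rminus_diag, sqrt_0.
    assert (S := Hsq (sg - (t - h)) ltac:(lra)).
    assert (2 * (Bm * C) * sqrt (sg - (t - h)) <= 2 * (Bm * C) * sqrt (2 * h)) by (apply Rmult_le_compat_l; lra).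
    assert (0 <= (Bm * C) * sqrt (2 * h)) by (apply Rmult_le_pos; [auto | apply sqrt_pos]). lra.
  + eapply Rle_trans; [apply (RInt_sqrt_right fA sg 0 (Bm * C)); [lra | intros s Hs; apply CA; lra | intros s Hs; apply bA; lra]|].
    rewrite Rminus_diag, sqrt_0.
    assert (S := Hsq (t + h - sg) ltac:(lra)).
    assert (2 * (Bm * C) * sqrt (t + h - sg) <= 2 * (Bm * C) * sqrt (2 * h)) by (apply Rmult_le_compat_l; lra).
    assert (0 <= (Bm * C) * sqrt (2 * h)) by (apply Rmult_le_pos; [auto | apply sqrt_pos]). lra.
- assert (Hade : Rabs de <> 0) by now apply Rabs_no_R0.
  assert (Hom0 : 0 <= om).
  { specialize (Hom t); rewrite !Rminus_diag, Rabs_R0 in Hom; apply Hom; lra. }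
  assert (Hi : 0 < / (2 * PI)) by (apply Rinv_0_lt_compat; lra).
  destruct (poisson_mass sg (Rabs de) h Hade (proj1 Hh) Hsg) as (_ & _ & M).
  apply Rle_trans with (/ (2 * PI) * om * PI); [|right; field; lra].
  (* The absolute value of [poisson sg de] is [poisson sg (Rabs de)], which treats both sides of the
     curve at once. *)
  apply Rle_trans with (/ (2 * PI) * om * RInt (poisson sg (Rabs de)) (t - h) (t + h)).
  + assert (exq : ex_RInt (poisson sg (Rabs de)) (t - h) (t + h)) by (eexists; now apply is_RInt_poisson).
    replace (/ (2 * PI) * om * RInt (poisson sg (Rabs de)) (t - h) (t + h)) with
      (RInt (fun s => / (2 * PI) * om * poisson sg (Rabs de) s) (t - h) (t + h))
      by exact (RInt_scal (V := R_CompleteNormedModule) (poisson sg (Rabs de)) (t - h) (t + h) (/ (2 * PI) * om) exq).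
    eapply Rle_trans; [apply abs_RInt_le; [lra | auto]|].
    apply RInt_le; [lra | | |].
    * apply ex_RInt_cont; [lra|]; intros s Hs; apply (lim_comp Rabs fB); [apply continuous_Rabs | now apply CB].
    * exact (ex_RInt_scal (V := R_NormedModule) (poisson sg (Rabs de)) (t - h) (t + h) (/ (2 * PI) * om) exq).
    * intros s Hs; unfold fB; apply Rabs_mult_le.
      -- apply Rabs_mult_le; [rewrite Rabs_pos_eq; lra|]; apply Hom, Rabs_le; lra.
      -- pose proof (poisson_den_pos sg de s Hde).
         unfold poisson, Rdiv; rewrite Rabs_mult, pow2_abs, (Rabs_pos_eq (/ _)); [lra|].
         left; now apply Rinv_0_lt_compat.
  + rewrite (is_RInt_unique _ _ _ _ (is_RInt_poisson sg (Rabs de) (t - h) (t + h) Hade)).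
    apply Rmult_le_compat_l; [apply Rmult_le_pos; lra|].
    eapply Rle_trans; [apply Rle_abs | exact M].
Qed.

End Potential.

Lemma improper_tail (f : R -> R) a b I c d A A' : a < c -> c <= d -> d < b -> improper_RInt f a b I ->
  (forall c', a < c' <= c -> Rabs (RInt f c' c) <= A) ->
  (forall d', d <= d' < b -> Rabs (RInt f d d') <= A') -> Rabs (I - RInt f c d) <= A + A'.
Proof.
intros Hc Hcd Hd [ex H] HA HA'; apply Rnot_lt_le; intros Hlt.
destruct (H (Rabs (I - RInt f c d) - (A + A'))) as [del [Hdel HD]]; [lra|].
set (c' := a + Rmin del (c - a) / 2); set (d' := b - Rmin del (b - d) / 2).
assert (Hc' : a < c' /\ c' < a + del /\ c' <= c) by (unfold c', Rmin; destruct Rle_dec; lra).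
assert (Hd' : d' < b /\ b - del < d' /\ d <= d') by (unfold d', Rmin; destruct Rle_dec; lra).
specialize (HD c' d' ltac:(lra) ltac:(lra) ltac:(lra)).
specialize (HA c' ltac:(lra)); specialize (HA' d' ltac:(lra)).
rewrite (RInt_Chasles_R f c' c d'), (RInt_Chasles_R f c d d') in HD; try (apply ex; lra).
assert (T := Rabs_triang (I - (RInt f c' c + (RInt f c d + RInt f d d'))) (RInt f c' c + RInt f d d')).
assert (T2 := Rabs_triang (RInt f c' c) (RInt f d d')).
rewrite (Rabs_minus_sym I (RInt f c' c + _)) in T.
replace (I - (RInt f c' c + (RInt f c d + RInt f d d')) + (RInt f c' c + RInt f d d')) with (I - RInt f c d) in T by ring.
lra.
Qed.

Section PotentialLimit.
Variables (al be a b l : R) (X Y dX dY mu : R -> R).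
Hypotheses (Hal : 0 < 2 * al < 1) (Hbe : 0 < 2 * be < 1).
Hypothesis cv : curve a b l X Y dX dY.
Hypothesis Hmu : cont_on mu 0 l.
Variable t : R.
Hypothesis Ht : 0 < t < l.

Notation kG := (kernG al be X Y dX dY).
Notation dn := (dens al be X Y dX dY mu).

(** In the coordinates (sg, de) the two sides are the signs of de, so that this part is free of
    topology. Existence of the potential and its limit are separate claims because the potential is
    a relation. *)
Lemma potential_limit : exists I1 I2 : R,
  improper_RInt (dn (X t) (Y t)) 0 t I1 /\ improper_RInt (dn (X t) (Y t)) t l I2 /\
  exists eta1, 0 < eta1 /\
  (forall sg de, Rabs (sg - t) < eta1 -> de <> 0 -> Rabs de < eta1 ->
     0 < offx X dY sg de /\ 0 < offy Y dX sg de /\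
     (forall s, 0 < s < l -> 0 < dist2 (X s) (Y s) (offx X dY sg de) (offy Y dX sg de)) /\
     exists v, improper_RInt (dn (offx X dY sg de) (offy Y dX sg de)) 0 l v) /\
  forall e, 0 < e -> exists eta, 0 < eta /\
   forall sg de v, Rabs (sg - t) < eta -> de <> 0 -> Rabs de < eta ->
     improper_RInt (dn (offx X dY sg de) (offy Y dX sg de)) 0 l v ->
     (0 < de -> Rabs (v - (/ 2 * mu t + (I1 + I2))) < e) /\
     (de < 0 -> Rabs (v - (- / 2 * mu t + (I1 + I2))) < e).
Proof.
assert (Hl := cv_l_pos cv); assert (HPI := PI_RGT_0).
destruct (cv_quad cv t Ht) as [HXt HYt].
destruct (kernel_near al be a b l X Y dX dY Hal Hbe cv t Ht) as (h0 & C & Hh0 & HC & Hl0 & Hr0 & HN).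
destruct (cont_on_bounded mu l Hl Hmu) as [Bm [HBm HB]].
assert (HB' : forall s, 0 < s < l -> Rabs (mu s) <= Bm) by (intros s Hs; apply HB; lra).
destruct (kernel_away_bound al be a b l X Y dX dY Hal Hbe cv t Ht (h0 / 2) ltac:(lra)) as (B0 & eta0 & HB0 & Heta0 & HA).
set (D := Bm * B0); set (E := Bm * C).
assert (HD : 0 <= D) by now apply Rmult_le_pos.
assert (HE : 0 <= E) by now apply Rmult_le_pos.
(* The boundary point itself is the offset with de = 0, so the near estimate also bounds the limit
   integrand. *)
assert (off0 : offx X dY t 0 = X t /\ offy Y dX t 0 = Y t) by (unfold offx, offy; split; ring).
assert (sq0 : forall s, 0 <= / sqrt (Rabs (s - t))).
{ intros s; destruct (Rle_lt_or_eq_dec 0 _ (sqrt_pos (Rabs (s - t)))) as [H|H].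
  - left; now apply Rinv_0_lt_compat.
  - rewrite <- H, Rinv_0; lra. }
set (f0 := dn (X t) (Y t)).
assert (Cf0 : forall s, 0 < s < l -> s <> t -> continuous f0 s).
{ intros s Hs Hst; unfold f0; apply (dens_continuous al be a b l); auto.
  apply dist2_pos; intros [E1 E2]; apply Hst; apply (cv_simple cv); auto; lra. }
assert (Bf0 : forall s, 0 < s < l -> s <> t -> Rabs (f0 s) <= D + E / sqrt (Rabs (s - t))).
{ intros s Hs Hst; unfold f0, dens.
  assert (HEs : 0 <= E / sqrt (Rabs (s - t))) by (apply Rmult_le_pos; auto).
  destruct (Rle_dec (h0 / 2) (Rabs (s - t))) as [Hge|Hlt].
  - destruct (HA (X t) (Y t)) as (_ & _ & HA'); try (rewrite Rminus_diag, Rabs_R0; lra).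
    destruct (HA' s Hs Hge) as [_ HA2].
    apply Rle_trans with D; [|lra]; apply Rabs_mult_le; auto.
  - destruct (HN s t 0) as (_ & _ & _ & HN'); try (rewrite ?Rminus_diag, ?Rabs_R0; lra).
    specialize (HN' Hst); destruct off0 as [-> ->] in HN'.
    replace (kG s (X t) (Y t) - / (2 * PI) * (0 / ((s - t) ^ 2 + 0 ^ 2))) with (kG s (X t) (Y t)) in HN'
      by (unfold Rdiv; ring).
    apply Rle_trans with (E / sqrt (Rabs (s - t))); [|lra].
    unfold E, Rdiv; rewrite Rmult_assoc; apply Rabs_mult_le; auto. }
set (G1 := fun s => D * s - 2 * E * sqrt (t - s)); set (G2 := fun s => D * s + 2 * E * sqrt (s - t)).
assert (Cid : forall z : R, continuous (fun u : R => u) z) by (intros z; apply continuous_id).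
assert (CG1 : forall s, continuous G1 s).
{ intros s; unfold G1; apply lim_minus; apply lim_mult; try apply lim_const; [apply Cid|].
  apply (lim_comp sqrt); [apply continuous_sqrt | apply lim_minus; [apply lim_const | apply Cid]]. }
assert (CG2 : forall s, continuous G2 s).
{ intros s; unfold G2; apply lim_plus; apply lim_mult; try apply lim_const; [apply Cid|].
  apply (lim_comp sqrt); [apply continuous_sqrt | apply lim_minus; [apply Cid | apply lim_const]]. }
destruct (improper_exists f0 G1 0 t) as [I1 [HI1 TI1]]; auto; [lra | | |].
{ intros s Hs; apply Cf0; lra. }
{ intros c d Hc Hcd Hd; apply (RInt_sqrt_left f0 t D E); [lra | |].
  - intros s Hs; apply Cf0; lra.
  - intros s Hs; apply Bf0; lra. }
destruct (improper_exists f0 G2 t l) as [I2 [HI2 TI2]]; auto; [lra | | |].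
{ intros s Hs; apply Cf0; lra. }
{ intros c d Hc Hcd Hd; apply (RInt_sqrt_right f0 t D E); [lra | |].
  - intros s Hs; apply Cf0; lra.
  - intros s Hs; apply Bf0; lra. }
exists I1, I2; split; auto; split; auto.
set (eta1 := Rmin (h0 / 4) (eta0 / 2)).
assert (Heta1 : 0 < eta1 /\ eta1 <= h0 / 4 /\ eta1 <= eta0 / 2) by (unfold eta1, Rmin; destruct Rle_dec; lra).
exists eta1; split; [lra|].
assert (nearby : forall sg de, Rabs (sg - t) < eta1 -> de <> 0 -> Rabs de < eta1 ->
  0 < offx X dY sg de /\ 0 < offy Y dX sg de /\
  (forall s, 0 < s < l -> 0 < dist2 (X s) (Y s) (offx X dY sg de) (offy Y dX sg de)) /\
  (forall s, 0 < s < l -> h0 / 2 <= Rabs (s - t) -> Rabs (dn (offx X dY sg de) (offy Y dX sg de) s) <= D)).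
{ intros sg de Hsg Hde Hde1.
  assert (Bsg := Hsg); apply Rabs_lt_between in Bsg.
  destruct (offset_near cv sg t de ltac:(lra) Ht) as [O1 O2].
  destruct (HA (offx X dY sg de) (offy Y dX sg de)) as (P1 & P2 & P3); try lra.
  split; auto; split; auto; split.
  - intros s Hs; destruct (Rle_dec (h0 / 2) (Rabs (s - t))) as [Hge|Hlt].
    + now apply P3.
    + destruct (HN s sg de) as (_ & _ & Q & _); try lra.
      pose proof (poisson_den_pos sg de s Hde); lra.
  - intros s Hs Hge; unfold dens; destruct (P3 s Hs Hge) as [_ P4]; apply Rabs_mult_le; auto. }
split.
{ intros sg de Hsg Hde Hde1; destruct (nearby sg de Hsg Hde Hde1) as (P1 & P2 & P3 & P4).
  do 3 (split; auto).
  (* For a fixed point off the curve the integrand is bounded, by continuity near t and by [D]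
     elsewhere, so a linear modulus gives the improper integral. *)
  set (w := dn (offx X dY sg de) (offy Y dX sg de)) in *.
  assert (Cw : forall s, 0 < s < l -> continuous w s) by (intros s Hs; apply (dens_continuous al be a b l); auto).
  destruct (continuity_ab_maj (fun s => Rabs (w s)) (t - h0 / 2) (t + h0 / 2)) as [m [Hm Im]]; [lra| |].
  { intros s Hs; apply continuity_pt_filterlim, (lim_comp Rabs w); [apply continuous_Rabs | apply Cw; lra]. }
  set (K := Rabs (w m) + D).
  assert (bw : forall s, 0 < s < l -> Rabs (w s) <= K).
  { intros s Hs; pose proof (Rabs_pos (w m)); unfold K.
    destruct (Rle_dec (h0 / 2) (Rabs (s - t))) as [Hge|Hlt].
    - specialize (P4 s Hs Hge); lra.
    - assert (Hst : Rabs (s - t) < h0 / 2) by lra; apply Rabs_lt_between in Hst.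
      specialize (Hm s ltac:(lra)); lra. }
  destruct (improper_exists w (fun s => K * s) 0 l) as [v [Hv _]]; auto.
  - apply lim_mult; [apply lim_const | apply Cid].
  - apply lim_mult; [apply lim_const | apply Cid].
  - intros c d Hc Hcd Hd; replace (K * d - K * c) with ((d - c) * K) by ring.
    apply abs_RInt_le_const; auto; [apply ex_RInt_cont; auto; intros s Hs; apply Cw; lra|].
    intros s Hs; apply bw; lra.
  - now exists v. }
intros e He.
(* The budget in units of e1: 2 for the ends of the potential, 1 for each of the two compact parts,
   3/2 for the window, 2 for truncating each of I1 and I2, 2 for the Poisson mass; together 23/2. *)
set (e1 := e / 12).
assert (He1 : 0 < e1) by (unfold e1; lra).
set (H := fun h => D * h + 8 * E * sqrt (2 * h)).
assert (CH : continuous H 0).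
{ unfold H; apply lim_plus; apply lim_mult; try apply lim_const; [apply Cid|].
  apply (lim_comp sqrt); [apply continuous_sqrt | apply lim_mult; [apply lim_const | apply Cid]]. }
destruct (proj1 (continuous_eps H 0) CH e1 He1) as [k1 [Hk1 HH]].
destruct (proj1 (continuous_eps mu t) (cont_on_interior mu l t Hmu Ht) e1 He1) as [k2 [Hk2 Hmut]].
set (h := Rmin (Rmin k1 k2) h0 / 2).
assert (Hh : 0 < h /\ h < k1 /\ h < k2 /\ h <= h0 / 2) by (unfold h, Rmin; repeat destruct Rle_dec; lra).
assert (Hsm : D * h + 8 * E * sqrt (2 * h) < e1).
{ specialize (HH h ltac:(rewrite Rminus_0_r, Rabs_pos_eq; lra)); unfold H in HH.
  rewrite !Rmult_0_r, sqrt_0, Rmult_0_r, Rplus_0_r, Rminus_0_r in HH.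
  apply Rabs_lt_between in HH; lra. }
assert (Hsq : sqrt h <= sqrt (2 * h)) by (apply sqrt_le_1_alt; lra).
assert (HEs : 0 <= E * sqrt (2 * h)) by (apply Rmult_le_pos; [auto | apply sqrt_pos]).
assert (HEs2 : E * sqrt h <= E * sqrt (2 * h)) by now apply Rmult_le_compat_l.
assert (HDh : 0 <= D * h) by (apply Rmult_le_pos; lra).
assert (g1 : G1 t - G1 (t - h) <= e1).
{ unfold G1; rewrite Rminus_diag, sqrt_0; replace (t - (t - h)) with h by ring; lra. }
assert (g2 : G2 (t + h) - G2 t <= e1).
{ unfold G2; rewrite Rminus_diag, sqrt_0; replace (t + h - t) with h by ring; lra. }
destruct (proj1 (continuous_eps G1 0) (CG1 0) e1 He1) as [k3 [Hk3 HG1]].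
destruct (proj1 (continuous_eps G2 l) (CG2 l) e1 He1) as [k4 [Hk4 HG2]].
assert (HkD : 0 < e1 / (D + 1)) by (apply Rdiv_lt_0_compat; lra).
(* Length cut off at both ends of the curve: small for the moduli G1 and G2, with D k5 <= e1, and
   leaving the window of radius h0 untouched. *)
set (k5 := Rmin (Rmin k3 k4) (Rmin (e1 / (D + 1)) (Rmin (t - h0) (l - (t + h0)))) / 2).
assert (Hk5 : 0 < k5 /\ k5 < k3 /\ k5 < k4 /\ k5 < e1 / (D + 1) /\ k5 < t - h0 /\ k5 < l - (t + h0)).
{ unfold k5, Rmin; repeat destruct Rle_dec; lra. }
assert (HDk : D * k5 <= e1).
{ apply Rle_trans with ((D + 1) * (e1 / (D + 1))); [apply Rmult_le_compat; lra | right; field; lra]. }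
set (c := k5); set (d := l - k5).
assert (gc : G1 c - G1 0 < e1).
{ specialize (HG1 c ltac:(unfold c; rewrite Rminus_0_r, Rabs_pos_eq; lra)); apply Rabs_lt_between in HG1; lra. }
assert (gd : G2 l - G2 d < e1).
{ specialize (HG2 d ltac:(unfold d; rewrite Rabs_left; lra)); apply Rabs_lt_between in HG2; lra. }
set (e2 := e1 / (l * (Bm + 1))).
assert (HlB : 0 < l * (Bm + 1)) by (apply Rmult_lt_0_compat; lra).
assert (He2 : 0 < e2) by now apply Rdiv_lt_0_compat.
destruct (kernel_away_uniform al be a b l X Y dX dY Hal Hbe cv t Ht c (t - h) e2) as [n1 [Hn1 U1]];
  [unfold c; lra | lra | intros s Hs; lra | auto |].
destruct (kernel_away_uniform al be a b l X Y dX dY Hal Hbe cv t Ht (t + h) d e2) as [n2 [Hn2 U2]];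
  [lra | unfold d; lra | intros s Hs; lra | auto |].
(* With |de| <= k6 / 2 the missing Poisson mass 4 |de| / h, weighted by |mu t|, is at most 2 e1.
   Here h is already fixed, so de is small compared with the window. *)
set (k6 := e1 * h / (Rabs (mu t) + 1)).
assert (Hmt := Rabs_pos (mu t)).
assert (Hk6 : 0 < k6) by (apply Rdiv_lt_0_compat; [nra | lra]).
set (eta := Rmin (Rmin (Rmin n1 n2) (Rmin h eta1)) k6 / 2).
assert (Heta : 0 < eta /\ eta <= n1 / 2 /\ eta <= n2 / 2 /\ eta <= h / 2 /\ eta <= eta1 / 2 /\ eta <= k6 / 2).
{ unfold eta, Rmin; repeat destruct Rle_dec; lra. }
exists eta; split; [lra|].
intros sg de v Hsg Hde Hde1 Hv.
destruct (nearby sg de ltac:(lra) Hde ltac:(lra)) as (P1 & P2 & P3 & P4).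
assert (Bsg := Hsg); apply Rabs_lt_between in Bsg.
destruct (offset_near cv sg t de ltac:(lra) Ht) as [O1 O2].
set (x0 := offx X dY sg de) in *; set (y0 := offy Y dX sg de) in *.
set (w := dn x0 y0) in *.
assert (Cw : forall s, 0 < s < l -> continuous w s) by (intros s Hs; apply (dens_continuous al be a b l); auto).
assert (exw : forall c d, 0 < c -> c <= d -> d < l -> ex_RInt w c d).
{ intros c' d' Hc' Hcd' Hd'; apply ex_RInt_cont; auto; intros s Hs; apply Cw; lra. }
assert (B1 : Rabs (v - RInt w c d) <= e1 + e1).
{ apply (improper_tail w 0 l v c d); auto; try (unfold c, d; lra).
  - intros c' Hc'; apply Rle_trans with ((c - c') * D).
    + apply abs_RInt_le_const; [lra | apply exw; unfold c in *; lra|].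
      intros s Hs; apply P4; unfold c in *; [lra | rewrite Rabs_left; lra].
    + apply Rle_trans with (k5 * D); [apply Rmult_le_compat_r; unfold c in *; lra | lra].
  - intros d' Hd'; apply Rle_trans with ((d' - d) * D).
    + apply abs_RInt_le_const; [lra | apply exw; unfold d in *; lra|].
      intros s Hs; apply P4; unfold d in *; [lra | rewrite Rabs_pos_eq; lra].
    + apply Rle_trans with (k5 * D); [apply Rmult_le_compat_r; unfold d in *; lra | lra]. }
assert (awayd : forall p q, 0 < p -> p <= q -> q < l -> (forall s, p <= s <= q -> s <> t) ->
  (forall s, p <= s <= q -> Rabs (kG s x0 y0 - kG s (X t) (Y t)) <= e2) ->
  Rabs (RInt w p q - RInt f0 p q) <= e1).
{ intros p q Hp Hpq Hq Hst Hs.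
  assert (exf : ex_RInt f0 p q) by (apply ex_RInt_cont; auto; intros s Is; apply Cf0; [lra | auto]).
  assert (Em : RInt (fun s => w s - f0 s) p q = RInt w p q - RInt f0 p q)
    by exact (RInt_minus (V := R_CompleteNormedModule) w f0 p q (exw p q Hp Hpq Hq) exf).
  rewrite <- Em.
  apply Rle_trans with ((q - p) * (Bm * e2)).
  - apply abs_RInt_le_const; auto.
    + exact (ex_RInt_minus (V := R_NormedModule) w f0 p q (exw p q Hp Hpq Hq) exf).
    + intros s Is; unfold w, f0, dens; rewrite <- Rmult_minus_distr_l; apply Rabs_mult_le; [apply HB'; lra | now apply Hs].
  - apply Rle_trans with (l * ((Bm + 1) * e2)).
    + apply Rmult_le_compat; try lra; apply Rmult_le_pos; lra.
    + right; unfold e2; field; lra. }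
assert (B2 := awayd c (t - h) ltac:(unfold c; lra) ltac:(unfold c; lra) ltac:(lra) ltac:(intros s Hs; lra)
  (fun s Hs => U1 s Hs x0 y0 ltac:(lra) ltac:(lra))).
assert (B3 := awayd (t + h) d ltac:(lra) ltac:(unfold d; lra) ltac:(unfold d; lra) ltac:(intros s Hs; lra)
  (fun s Hs => U2 s Hs x0 y0 ltac:(lra) ltac:(lra))).
assert (B4 := near_window al be a b l X Y dX dY mu Hal Hbe cv Hmu t h0 C Bm h e1 sg de HC HBm Hl0 Hr0 HB' HN
  ltac:(lra) ltac:(intros s Hs; left; apply Hmut; lra) ltac:(lra) Hde ltac:(lra)).
fold x0 y0 w E in B4.
assert (B5 := TI1 c (t - h) ltac:(unfold c; lra) ltac:(unfold c; lra) ltac:(lra)).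
assert (B6 := TI2 (t + h) d ltac:(lra) ltac:(unfold d; lra) ltac:(unfold d; lra)).
destruct (poisson_mass t sg de h Hde ltac:(lra) ltac:(lra)) as (M1 & M2 & _).
set (P := atan ((t + h - sg) / de) - atan ((t - h - sg) / de)) in *.
assert (Ch : RInt w c d = RInt w c (t - h) + (RInt w (t - h) (t + h) + RInt w (t + h) d)).
{ rewrite (RInt_Chasles_R w c (t - h) d), (RInt_Chasles_R w (t - h) (t + h) d); auto; apply exw; unfold c, d; lra. }
assert (Hi : 0 < / (2 * PI)) by (apply Rinv_0_lt_compat; lra).
assert (Hi1 : / (2 * PI) <= 1).
{ rewrite <- Rinv_1; apply Rinv_le_contravar; [lra | pose proof PI2_3_2; unfold PI2 in *; lra]. }
assert (Hk : 4 * Rabs de / h * Rabs (mu t) <= 2 * e1).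
{ apply Rle_trans with (4 * (k6 / 2) / h * (Rabs (mu t) + 1)).
  - apply Rmult_le_compat; try lra.
    + apply Rdiv_le_0_compat; [pose proof (Rabs_pos de); lra | lra].
    + apply Rmult_le_compat_r; [left; apply Rinv_0_lt_compat; lra | lra].
  - right; unfold k6; field; lra. }
assert (J : forall z, Rabs z <= 4 * Rabs de / h -> Rabs (/ (2 * PI) * mu t * z) <= 2 * e1).
{ intros z Hz; rewrite Rmult_assoc.
  apply Rle_trans with (1 * (Rabs (mu t) * (4 * Rabs de / h))); [|lra].
  apply Rabs_mult_le; [rewrite Rabs_pos_eq; lra|]; apply Rabs_mult_le; lra. }
assert (HJ : / (2 * PI) * mu t * PI = / 2 * mu t) by (field; lra).
apply Rabs_le_between in B1, B2, B3, B4, B5, B6.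
assert (Ee : e = 12 * e1) by (unfold e1; lra).
split; intros Hsgn.
- assert (J1 := J _ (M1 Hsgn)); apply Rabs_le_between in J1.
  rewrite Rmult_minus_distr_l, HJ in J1; apply Rabs_def1; lra.
- assert (J1 := J _ (M2 Hsgn)); apply Rabs_le_between in J1.
  rewrite Rmult_plus_distr_l, HJ in J1; apply Rabs_def1; lra.
Qed.

End PotentialLimit.

(** * From the stated hypotheses to the geometric ones, and the theorem *)

Lemma holder_bounded (f : R -> R) l eps H : 0 < l -> 0 < eps ->
  (forall s s', 0 < s < l -> 0 < s' < l -> Rabs (f s - f s') <= H * Rpower (Rabs (s - s')) eps) ->
  exists B, 0 <= B /\ forall s, 0 < s < l -> Rabs (f s) <= B.
Proof.
intros Hl He Hf.
assert (HP := Rpower_pos l eps).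
exists (Rabs (f (l / 2)) + Rabs H * Rpower l eps); split.
{ apply Rplus_le_le_0_compat; [apply Rabs_pos | apply Rmult_le_pos; [apply Rabs_pos | lra]]. }
intros s Hs.
(* At the midpoint the power has base 0, where [Rpower] takes a default value instead of 0. *)
destruct (Req_dec s (l / 2)) as [->|Hne].
{ assert (0 <= Rabs H * Rpower l eps) by (apply Rmult_le_pos; [apply Rabs_pos | lra]); lra. }
replace (f s) with (f (l / 2) + (f s - f (l / 2))) by ring.
apply Rabs_plus_le; [lra|].
eapply Rle_trans; [apply Hf; lra|].
assert (Hz : 0 < Rabs (s - l / 2) <= l) by (split; [apply Rabs_pos_lt; lra | apply Rabs_le; lra]).
apply Rle_trans with (Rabs H * Rpower (Rabs (s - l / 2)) eps).
- apply Rmult_le_compat_r; [left; apply Rpower_pos | apply Rle_abs].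
- apply Rmult_le_compat_l; [apply Rabs_pos | apply Rle_Rpower_l; lra].
Qed.

Lemma lipschitz_of_derive (f f' : R -> R) l B : (forall s, 0 < s < l -> derivable_pt_lim f s (f' s)) ->
  (forall s, 0 < s < l -> Rabs (f' s) <= B) ->
  forall s s', 0 < s < l -> 0 < s' < l -> Rabs (f s - f s') <= B * Rabs (s - s').
Proof.
intros Hd HB s s' Hs Hs'.
assert (In : forall z, Rmin s' s <= z <= Rmax s' s -> 0 < z < l)
  by (intros z; unfold Rmin, Rmax; destruct Rle_dec; lra).
apply (MVT_bound f f'); intros z Hz; apply In in Hz; [apply is_derive_Reals|]; auto.
Qed.

Theorem theorem1
  (al be a b l eps : R) (X Y dX dY d2X d2Y mu : R -> R)
  (Hal : 0 < 2*al < 1) (Hbe : 0 < 2*be < 1)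
  (Ha : a > 0) (Hb : b > 0) (Hl : l > 0)
  (* Gamma joins B(0,b) (s=0) and A(a,0) (s=l), otherwise in the open quadrant, simple *)
  (HB : X 0 = 0 /\ Y 0 = b) (HA : X l = a /\ Y l = 0)
  (Hquad : forall s, 0 < s < l -> X s > 0 /\ Y s > 0)
  (Hsimple : forall s s', 0 <= s <= l -> 0 <= s' <= l -> X s = X s' -> Y s = Y s' -> s = s')
  (* regularity; arc-length parametrization *)
  (HXc : cont_on X 0 l) (HYc : cont_on Y 0 l)
  (HdX : forall s, 0 < s < l -> derivable_pt_lim X s (dX s))
  (HdY : forall s, 0 < s < l -> derivable_pt_lim Y s (dY s))
  (HdXc : cont_on dX 0 l) (HdYc : cont_on dY 0 l)
  (Harc : forall s, 0 < s < l -> (dX s)^2 + (dY s)^2 = 1)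
  (Hd2X : forall s, 0 < s < l -> derivable_pt_lim dX s (d2X s))
  (Hd2Y : forall s, 0 < s < l -> derivable_pt_lim dY s (d2Y s))
  (Heps : 0 < eps < 1)
  (Hhold : exists H, forall s s', 0 < s < l -> 0 < s' < l ->
      Rabs (d2X s - d2X s') <= H * Rpower (Rabs (s - s')) eps /\
      Rabs (d2Y s - d2Y s') <= H * Rpower (Rabs (s - s')) eps)
  (Hends : exists C del, del > 0 /\ forall s, 0 < s < l -> (s < del \/ l - del < s) ->
      Rabs (dX s) <= C * Rpower (Y s) (1 + eps) /\
      Rabs (dY s) <= C * Rpower (X s) (1 + eps))
  (Hmu : cont_on mu 0 l) :
  forall t, 0 < t < l ->
    exists I1 I2 : R,
      improper_int (fun s => mu s * K3 al be X Y dX dY s t) 0 t I1 /\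
      improper_int (fun s => mu s * K3 al be X Y dX dY s t) t l I2 /\
      rel_lim_within (Omega a b l X Y) (w3_is al be l X Y dX dY mu) (X t) (Y t)
        (- / 2 * mu t + (I1 + I2)) /\
      rel_lim_within (Exterior a b l X Y) (w3_is al be l X Y dX dY mu) (X t) (Y t)
        (/ 2 * mu t + (I1 + I2)).
Proof.
assert (cv : curve a b l X Y dX dY).
{ constructor; auto.
  - intros s Hs; apply is_derive_Reals; auto.
  - intros s Hs; apply is_derive_Reals; auto.
  - destruct Hhold as [H HH].
    destruct (holder_bounded d2X l eps H Hl (proj1 Heps)) as [B1 [HB1 D1]].
    { intros s s' Hs Hs'; now apply HH. }
    destruct (holder_bounded d2Y l eps H Hl (proj1 Heps)) as [B2 [HB2 D2]].
    { intros s s' Hs Hs'; now apply HH. }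
    exists (B1 + B2 + 1); split; [lra|]; intros s s' Hs Hs'; split.
    + apply (lipschitz_of_derive dX d2X l); auto; intros z Hz; specialize (D1 z Hz); lra.
    + apply (lipschitz_of_derive dY d2Y l); auto; intros z Hz; specialize (D2 z Hz); lra.
  - destruct Hends as (C & del & Hdel & HE).
    (* Close to B one has X < 1, whence X^(1 + eps) <= X. *)
    destruct (HXc 0 ltac:(lra) 1 ltac:(lra)) as [d [Hd HX1]].
    exists (Rabs C), (Rmin del d); split; [apply Rabs_pos|]; split; [now apply Rmin_pos|].
    intros s Hs Hsd; pose proof (Rmin_l del d); pose proof (Rmin_r del d).
    destruct (HE s Hs ltac:(left; lra)) as [_ HY1]; destruct (Hquad s Hs) as [PX _].
    specialize (HX1 s ltac:(lra) ltac:(rewrite Rminus_0_r, Rabs_pos_eq; lra)).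
    rewrite (proj1 HB), Rminus_0_r in HX1; apply Rabs_lt_between in HX1.
    eapply Rle_trans; [apply HY1|].
    apply Rmult_le_compat; [|left; apply Rpower_pos | apply Rle_abs |].
    + apply Rnot_lt_le; intros HC; pose proof (Rabs_pos (dY s)); pose proof (Rpower_pos (X s) (1 + eps)); nra.
    + rewrite Rpower_plus, Rpower_1 by lra.
      assert (Rpower (X s) eps <= 1).
      { replace 1 with (Rpower 1 eps) by (unfold Rpower; rewrite ln_1, Rmult_0_r; apply exp_0).
        apply Rle_Rpower_l; lra. }
      nra. }
intros t Ht.
assert (Ha' : 0 < al) by lra; assert (Hb' : 0 < 1 - be) by lra.
destruct (Hquad t Ht) as [HXt HYt].
destruct (potential_limit al be a b l X Y dX dY mu Hal Hbe cv Hmu t Ht)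
  as (I1 & I2 & HI1 & HI2 & eta1 & Heta1 & Hex & Hlim).
(* At s = t the closed form and [dn_q3] are not compared; the improper integrals over (0, t) and (t,
   l) never see that point. *)
assert (EK : forall s, 0 < s < l -> s <> t ->
  dens al be X Y dX dY mu (X t) (Y t) s = mu s * K3 al be X Y dX dY s t).
{ intros s Hs Hst; unfold dens, K3, kernG; f_equal; symmetry; destruct (Hquad s Hs).
  apply dn_q3_kern; auto; apply dist2_pos; intros [E1 E2]; apply Hst, Hsimple; auto; lra. }
destruct (sides cv t Ht) as [h1 [Hh1 HS]].
assert (conv : forall sg de v, Rabs (sg - t) < eta1 -> de <> 0 -> Rabs de < eta1 ->
  w3_is al be l X Y dX dY mu (offx X dY sg de) (offy Y dX sg de) v <->
  improper_RInt (dens al be X Y dX dY mu (offx X dY sg de) (offy Y dX sg de)) 0 l v).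
{ intros sg de v A1 A2 A3; unfold w3_is; rewrite improper_int_RInt.
  destruct (Hex sg de A1 A2 A3) as (P1 & P2 & P3 & _).
  assert (E : forall s, 0 < s < l -> w3_integrand al be X Y dX dY mu (offx X dY sg de) (offy Y dX sg de) s
     = dens al be X Y dX dY mu (offx X dY sg de) (offy Y dX sg de) s).
  { intros s Hs; destruct (Hquad s Hs); unfold w3_integrand, dens, kernG.
    rewrite <- dn_q3_kern by auto; ring. }
  split; apply improper_RInt_ext; intros s Hs; [|symmetry]; now apply E. }
(* Translation from position to (sg, de): off the boundary de is nonzero, since de = 0 would be a
   point of the curve, and its sign is decided by [escapes]. *)
assert (coord : forall h, 0 < h -> exists del, del > 0 /\ forall x y, ~ bdry a b l X Y x y ->
  (x - X t) ^ 2 + (y - Y t) ^ 2 < del -> exists sg de, Rabs (sg - t) < h /\ de <> 0 /\ Rabs de < h /\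
  x = offx X dY sg de /\ y = offy Y dX sg de /\ (escapes a b l X Y x y -> 0 < de) /\ (~ escapes a b l X Y x y -> de < 0)).
{ intros h Hh.
  set (h' := Rmin (Rmin h h1) (Rmin t (l - t))).
  assert (Hh' : 0 < h' /\ h' <= h /\ h' <= h1 /\ h' <= t /\ h' <= l - t)
    by (unfold h', Rmin; repeat destruct Rle_dec; lra).
  destruct (nearest_point cv t h' Ht (proj1 Hh')) as [del [Hdel HP]].
  exists del; split; auto; intros x y Hnb Hd.
  destruct (HP x y Hd) as (sg & de & A1 & A2 & -> & ->).
  exists sg, de.
  assert (Hde : de <> 0).
  { intros ->; apply Hnb; right; right; exists sg; apply Rabs_lt_between in A1.
    split; [lra | unfold offx, offy; split; ring]. }
  destruct (HS sg de ltac:(lra) ltac:(lra)) as [S1 S2].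
  repeat split; auto; try lra.
  - intros Hesc; destruct (Rdichotomy _ _ Hde) as [Hn|Hp]; [exfalso; now apply S2 | lra].
  - intros Hesc; destruct (Rdichotomy _ _ Hde) as [Hn|Hp]; [lra | exfalso; now apply Hesc, S1]. }
assert (exist : exists del, del > 0 /\ forall x y, ~ bdry a b l X Y x y -> (x - X t) ^ 2 + (y - Y t) ^ 2 < del ->
  exists v, w3_is al be l X Y dX dY mu x y v).
{ destruct (coord eta1 Heta1) as [del [Hdel HC]]; exists del; split; auto; intros x y Hnb Hd.
  destruct (HC x y Hnb Hd) as (sg & de & A1 & A2 & A3 & -> & -> & _).
  destruct (Hex sg de A1 A2 A3) as (_ & _ & _ & v & Hv); exists v; now apply conv. }
assert (limit : forall e, e > 0 -> exists del, del > 0 /\ forall x y v, ~ bdry a b l X Y x y ->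
  (x - X t) ^ 2 + (y - Y t) ^ 2 < del -> w3_is al be l X Y dX dY mu x y v ->
  (escapes a b l X Y x y -> Rabs (v - (/ 2 * mu t + (I1 + I2))) < e) /\
  (~ escapes a b l X Y x y -> Rabs (v - (- / 2 * mu t + (I1 + I2))) < e)).
{ intros e He; destruct (Hlim e He) as [eta [Heta HL]].
  destruct (coord (Rmin eta eta1)) as [del [Hdel HC]]; [now apply Rmin_pos|].
  exists del; split; auto; intros x y v Hnb Hd Hv.
  destruct (HC x y Hnb Hd) as (sg & de & A1 & A2 & A3 & -> & -> & S1 & S2).
  pose proof (Rmin_l eta eta1); pose proof (Rmin_r eta eta1).
  apply conv in Hv; [|lra | auto | lra].
  destruct (HL sg de v ltac:(lra) A2 ltac:(lra) Hv) as [L1 L2].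
  split; intros Hesc; [now apply L1, S1 | now apply L2, S2]. }
(* [Omega] and [Exterior] differ only in [escapes], so the same existence and limit statements serve
   both. *)
exists I1, I2; split; [|split; [|split; split]].
- apply improper_int_RInt; apply improper_RInt_ext with (2 := HI1); intros s Hs; apply EK; lra.
- apply improper_int_RInt; apply improper_RInt_ext with (2 := HI2); intros s Hs; apply EK; lra.
- destruct exist as [del [Hdel HD]]; exists del; split; auto.
  intros x y (_ & _ & Hnb & _); now apply HD.
- intros e He; destruct (limit e He) as [del [Hdel HD]]; exists del; split; auto.
  intros x y v (_ & _ & Hnb & Hne) Hd Hv; now apply (HD x y v Hnb Hd Hv).
- destruct exist as [del [Hdel HD]]; exists del; split; auto.
  intros x y (_ & _ & Hnb & _); now apply HD.
- intros e He; destruct (limit e He) as [del [Hdel HD]]; exists del; split; auto.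
  intros x y v (_ & _ & Hnb & Hesc) Hd Hv; now apply (HD x y v Hnb Hd Hv).
Qed.
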